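(* Suppose $\mathbf{X}:M\to\mathbb{E}^3$ is a smooth minimal immersion of degree four, with entropy differentials $(P_\ell)_{\ell\geqslant 2}$, whose Hopf differential vanishes to order $n\in\mathbb{N}$ (so $n\geqslant 1$) at some umbilic point. Then the Hopf differential vanishes to order $n$ at every umbilic point and the immersion $\mathbf{X}$ satisfies $$P_4+\frac{12(n+2)^2}{3n^2+4n}(P_2)^2=0.$$
   Context: Surfaces are smooth and connected; $\mathbb{E}^3$ is Euclidean $3$-space. Let $\mathbf{X}:M\to\mathbb{E}^3$ be a minimal immersion of an oriented surface, with induced metric $g=d\mathbf{X}\cdot d\mathbf{X}$, Gauss curvature $K\leqslant 0$, orientation-compatible Gauss map $\mathbf{N}=(\mathbf{N}^1,\mathbf{N}^2,\mathbf{N}^3):M\to S^2$ and second fundamental form $A=-d\mathbf{N}\cdot d\mathbf{X}$. ''Non-flat'' means $K\not\equiv 0$. $M$ carries the complex structure determined by $g$ and the orientation. The Hopf differential $Q$ is the holomorphic quadratic differential on $M$ with $\mathrm{Re}(Q)=A$. The umbilic points are the points where $K=0$, equivalently the zeros of $Q$; $M'$ denotes the complement of the set of umbilic points. The stereographically projected Gauss map $G=(\mathbf{N}^1+i\mathbf{N}^2)/(1-\mathbf{N}^3):M\to\hat{\mathbb{C}}=\mathbb{C}\cup\{\infty\}$ is meromorphic, and locally injective on $M'$. On $M'$ the metric $g_0=\sqrt{-K}\,g$ is flat. Entropy differentials. Let $L$ be the canonical bundle of $M$, and let $\nabla$ be the Levi-Civita connection of $g_0$. In a local holomorphic coordinate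 $z$ on $M'$ write $\nabla_{\partial_z}\partial_z=\gamma\,\partial_z$. For a section $\sigma=s\,dz^\ell$ of $L^\ell$ let $\sigma'=(\partial_z s-\ell\gamma s)\,dz^{\ell+1}$, a section of $L^{\ell+1}$ (independent of the coordinate). For a locally injective meromorphic function $f$ set $$\mathrm{S}^\nabla_2(f)=\frac{f'''}{f'}-\frac32\left(\frac{f''}{f'}\right)^2=\left(\{f,z\}+\tfrac12\gamma^2-\partial_z\gamma\right)dz^2,\qquad \{f,z\}=\frac{\partial_z^3f}{\partial_z f}-\frac32\left(\frac{\partial_z^2 f}{\partial_z f}\right)^2,$$ where at poles of $f$ one uses $\{f,z\}=\{1/f,z\}$, and $\mathrm{S}^\nabla_{\ell+1}(f)=(\mathrm{S}^\nabla_\ell(f))'$ for $\ell\geqslant 2$. The entropy differentials of $\mathbf{X}$ are $P_\ell=\mathrm{S}^\nabla_\ell(G)$, $\ell\geqslant 2$, on $M'$; they extend to meromorphic differentials of degree $\ell$ on $M$. Degree. A non-flat minimal immersion has degree $n$ if $P_n$ vanishes identically or if $P_n=\psi_n(P_2,\ldots,P_{n-1})$ for some polynomial $\psi_n:\mathbb{C}^{n-2}\to\mathbb{C}$ that is weighted-homogeneous of degree $n$ with weights $(2,3,\ldots,n-1)$, i.e. $\psi_n$ is not identically zero and $\psi_n(\lambda^2z_1,\lambda^3z_2,\ldots,\lambda^{n-1}z_{n-2})=\lambda^n\psi_n(z_1,\ldots,z_{n-2})$ for all $\lambda\neq 0$; ''the degree'' always denotes the smallest such integer $n$. In particular the notion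 of degree presupposes that the immersion is non-flat. *)

(* Defs.v *)
From HB Require Import structures.
From mathcomp Require Import all_boot all_order all_algebra.
From mathcomp Require Import complex.
From mathcomp Require Import all_classical all_reals all_analysis.
(* mpoly is not imported: its notations clash with those of mathcomp-analysis. *)
From mathcomp Require mpoly.

Set Implicit Arguments.
Unset Strict Implicit.
Unset Printing Implicit Defensive.

Import Order.TTheory GRing.Theory Num.Theory.
Import numFieldNormedType.Exports.

Local Open Scope classical_set_scope.
Local Open Scope ring_scope.

Section Calculus.
Variable R : realType.

Definition partial (V : normedModType R) (i : 'I_2) (f : 'rV[R]_2 -> V) :
  'rV[R]_2 -> V := 'D_(delta_mx 0 i) f.

Fixpoint Cn (V : normedModType R) (k : nat) (U : set 'rV[R]_2)
    (f : 'rV[R]_2 -> V) : Prop :=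
  if k is k'.+1 then
    (forall z, U z -> differentiable f z) /\
    (forall i, Cn k' U (partial i f))
  else forall z, U z -> {for z, continuous f}.

(* Meaningful for open U, since the derivatives are two-sided. *)
Definition smooth_on (V : normedModType R) (U : set 'rV[R]_2)
  (f : 'rV[R]_2 -> V) : Prop := forall k, Cn k U f.

(* The plane of z = x + i y is 'rV[R]_2, with x = z 0 0 and y = z 0 1. *)
Definition cpartial (i : 'I_2) (f : 'rV[R]_2 -> R[i]) (z : 'rV[R]_2) : R[i] :=
  Complex (partial (V := R^o) i (fun w => complex.Re (f w)) z)
          (partial (V := R^o) i (fun w => complex.Im (f w)) z).

Definition dz (f : 'rV[R]_2 -> R[i]) (z : 'rV[R]_2) : R[i] :=
  (cpartial 0 f z - 'i * cpartial 1 f z) / 2%:R.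

End Calculus.

Section Euclidean.
Variable R : realType.
Implicit Types u v : 'rV[R]_3.

Definition dot u v : R := \sum_(i < 3) u 0 i * v 0 i.

Definition cross u v : 'rV[R]_3 :=
  \row_(i < 3) (u 0 (i + 1) * v 0 (i + 2%:R) - u 0 (i + 2%:R) * v 0 (i + 1)).

End Euclidean.

Section Surfaces.
Variables (R : realType) (M : topologicalType).

(* The values of chart_coord outside dom and of param outside img are irrelevant. *)
Record chart := Chart {
  dom : set M;
  chart_coord : M -> 'rV[R]_2;
  param : 'rV[R]_2 -> M;
  img := chart_coord @` dom;
  open_dom : open dom;
  open_img : open img;
  coordK : forall p, dom p -> param (chart_coord p) = p;
  coord_continuous : forall p, dom p -> {for p, continuous chart_coord};
  param_continuous : forall z, img z -> {for z, continuous param} }.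

Definition oriented_transition (a b : chart) : Prop :=
  let W := chart_coord a @` (dom a `&` dom b) in
  let tau := chart_coord b \o param a in
  smooth_on W tau /\ (forall z, W z -> 0 < \det ('J tau z)).

Definition compatible (a b : chart) : Prop :=
  oriented_transition a b /\ oriented_transition b a.

(* A connected oriented smooth surface: the charts are the positively oriented
   ones of the smooth structure, as a maximal atlas. *)
Record oriented_surface := OrientedSurface {
  charts : set chart;
  charts_cover : forall p, exists2 c, charts c & dom c p;
  charts_compatible : forall a b, charts a -> charts b -> compatible a b;
  charts_maximal :
    forall a, (forall b, charts b -> compatible a b) -> charts a;
  surface_hausdorff : hausdorff_space M;
  surface_second_countable : @second_countable M;
  surface_connected : connected [set: M] }.

End Surfaces.

Section Immersions.
Variables (R : realType) (M : topologicalType).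
Implicit Types (c : chart R M) (X : M -> 'rV[R]_3) (z : 'rV[R]_2).

(* Tensor fields on the surface are given by their components in a chart,
   as functions of the coordinates. *)

Definition local_immersion X c : 'rV[R]_2 -> 'rV[R]_3 := X \o param c.

Definition tangent X c (i : 'I_2) : 'rV[R]_2 -> 'rV[R]_3 :=
  partial i (local_immersion X c).

Definition metric X c z : 'M[R]_2 :=
  \matrix_(i, j) dot (tangent X c i z) (tangent X c j z).

Definition gauss_map X c z : 'rV[R]_3 :=
  let n := cross (tangent X c 0 z) (tangent X c 1 z) in
  (Num.sqrt (dot n n))^-1 *: n.

Definition second_form X c z : 'M[R]_2 :=
  \matrix_(i, j) - dot (partial i (gauss_map X c) z) (tangent X c j z).

Definition mean_curvature X c z : R :=
  \tr (invmx (metric X c z) *m second_form X c z) / 2%:R.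

Definition gauss_curvature X c z : R :=
  \det (invmx (metric X c z) *m second_form X c z).

Definition minimal_immersion (S : oriented_surface R M) X : Prop :=
  forall c, charts S c ->
    smooth_on (img c) (local_immersion X c) /\
    forall z, img c z ->
      row_free (col_mx (tangent X c 0 z) (tangent X c 1 z)) /\
      mean_curvature X c z = 0.

Definition umbilic (S : oriented_surface R M) X (p : M) : Prop :=
  exists c, [/\ charts S c, dom c p & gauss_curvature X c (chart_coord c p) = 0].

Definition nonflat (S : oriented_surface R M) X : Prop :=
  exists p, ~ umbilic S X p.

(* Local holomorphic coordinates for the complex structure determined by the
   induced metric and the orientation: positively oriented charts z = x + i y
   in which the metric is a multiple of dx^2 + dy^2. *)
Definition holomorphic_coordinate (S : oriented_surface R M) X c : Prop :=
  charts S c /\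
  forall z, img c z ->
    metric X c z 0 0 = metric X c z 1 1 /\ metric X c z 0 1 = 0.

(* Q = q dz^2 with Re Q = A: the real part of q (dx + i dy)^2 is
   Re q (dx^2 - dy^2) - 2 Im q dx dy, to be compared with
   A = h_00 (dx^2 - dy^2) + 2 h_01 dx dy. *)
Definition hopf X c z : R[i] :=
  Complex (second_form X c z 0 0) (- second_form X c z 0 1).

Definition hopf_vanishes_to_order (S : oriented_surface R M) X (p : M)
    (n : nat) : Prop :=
  exists c, [/\ holomorphic_coordinate S X c, dom c p,
    forall k, (k < n)%N -> iter k (@dz R) (hopf X c) (chart_coord c p) = 0 &
    iter n (@dz R) (hopf X c) (chart_coord c p) <> 0].

Definition christoffel (g : 'rV[R]_2 -> 'M[R]_2) (k i j : 'I_2) z : R :=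
  let dg l a b := partial (V := R^o) l (fun w => g w a b) z in
  2%:R^-1 * \sum_(l < 2) invmx (g z) k l * (dg i j l + dg j i l - dg l i j).

Definition flat_metric X c z : 'M[R]_2 :=
  Num.sqrt (- gauss_curvature X c z) *: metric X c z.

(* The coefficient gamma in nabla_{d/dz} d/dz = gamma d/dz, for
   d/dz = (d/dx - i d/dy) / 2: the d/dx component of
   nabla_{d/dz} d/dz is (Gam^0_00 - Gam^0_11 - 2 i Gam^0_01) / 4,
   and that of gamma d/dz is gamma / 2. *)
Definition connection_coef X c z : R[i] :=
  let Gam := christoffel (flat_metric X c) in
  Complex ((Gam 0 0 0 z - Gam 0 1 1 z) / 2%:R) (- Gam 0 0 1 z).

(* The Riemann sphere: None is the point at infinity. *)
Definition sphere : Type := one_point_compactification R[i].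

Definition sphere_inv (w : sphere) : sphere :=
  if w is Some x then (if x == 0 then None else Some x^-1) else Some 0.

Definition finite_part (w : sphere) : R[i] := if w is Some x then x else 0.

Definition stereographic (u : 'rV[R]_3) : sphere :=
  if u 0 2%:R == 1 then None
  else Some (Complex (u 0 0) (u 0 1) / Complex (1 - u 0 2%:R) 0).

Definition stereo_gauss_map X c z : sphere := stereographic (gauss_map X c z).

Definition schwarzian_finite (f : 'rV[R]_2 -> R[i]) z : R[i] :=
  dz (dz (dz f)) z / dz f z - 3%:R / 2%:R * (dz (dz f) z / dz f z) ^+ 2.

Definition schwarzian (f : 'rV[R]_2 -> sphere) z : R[i] :=
  if f z is Some _ then schwarzian_finite (finite_part \o f) z
  else schwarzian_finite (finite_part \o sphere_inv \o f) z.

Fixpoint entropy_from2 X c (k : nat) : 'rV[R]_2 -> R[i] :=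
  if k is k'.+1 then
    fun z => dz (entropy_from2 X c k') z -
             k'.+2%:R * connection_coef X c z * entropy_from2 X c k' z
  else
    fun z => schwarzian (stereo_gauss_map X c) z +
             connection_coef X c z ^+ 2 / 2%:R - dz (connection_coef X c) z.

(* The coefficient of dz^l in the entropy differential P_l, for l >= 2. *)
Definition entropy X c (l : nat) : 'rV[R]_2 -> R[i] :=
  entropy_from2 X c (l - 2).

(* An identity between coefficients of differentials, in every local
   holomorphic coordinate, at every point that is not umbilic. *)
Definition on_nonumbilic (S : oriented_surface R M) X
    (E : chart R M -> 'rV[R]_2 -> Prop) : Prop :=
  forall c, holomorphic_coordinate S X c ->
  forall p, dom c p -> ~ umbilic S X p -> E c (chart_coord c p).

(* Weights 2, 3, ..., n - 1 for a polynomial in n - 2 variables. *)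
Definition weighted_homogeneous (n : nat) (psi : mpoly.mpoly (n - 2) R[i]) :
    Prop :=
  (exists v : 'I_(n - 2) -> R[i], mpoly.meval v psi <> 0) /\
  forall (lambda : R[i]) (v : 'I_(n - 2) -> R[i]), lambda != 0 ->
    mpoly.meval (fun i => lambda ^+ (i + 2) * v i) psi =
    lambda ^+ n * mpoly.meval v psi.

Definition satisfies_degree (S : oriented_surface R M) X (n : nat) : Prop :=
  on_nonumbilic S X (fun c z => entropy X c n z = 0) \/
  exists2 psi : mpoly.mpoly (n - 2) R[i], weighted_homogeneous psi &
    on_nonumbilic S X (fun c z =>
      entropy X c n z =
      mpoly.meval (fun i : 'I_(n - 2) => entropy X c (i + 2) z) psi).

Definition has_degree (S : oriented_surface R M) X (n : nat) : Prop :=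
  [/\ nonflat S X, (2 <= n)%N, satisfies_degree S X n &
    forall m, (2 <= m < n)%N -> ~ satisfies_degree S X m].

End Immersions.

(* Main.v *)
(* In a conformal coordinate [z] write [Q = q dz^2]. The flat metric is
   [|q| |dz|^2], with connection coefficient [gam = q' / (2 q)]. The Weierstrass
   data show that near every point the Gauss map or its inverse is a quotient
   with derivative [- q / f], where [f] is holomorphic without zeros. With
   [k = f' / f], the coefficient of [P_2] is therefore
   [gam' - 3/2 gam^2 + 2 gam k - k' - k^2/2], where [k] is holomorphic even at the
   umbilic points.

   By weighted homogeneity a relation of degree four reads [P_4 = b P_2^2]. At a
   zero of order [n] of [q] one has [gam ~ n / (2 z)], so that the leading
   coefficients of [P_2] and [P_4] are [a = - (3 n^2 + 4 n) / 8] and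
   [3/2 (n + 2)^2 a]. Hence [12 (n + 2)^2 + b (3 n^2 + 4 n) = 0], which determines
   [b] from [n], and [n] from [b].

   Every umbilic point is a zero of finite order of [q] in some conformal
   coordinate. Such coordinates exist because the coordinate functions of the
   immersion are harmonic, and by unique continuation the interior of the set of
   umbilic points is open and closed, hence empty. *)

(* Two obstacles shape the argument. The first is the value infinity of the Gauss map. With [phi]
   the complex gradient of the immersion, the null relation factors as [(phi 0 - 'i * phi 1) * (phi
   0 + 'i * phi 1) = - phi 2 ^ 2]. Its two factors are the denominators of the Gauss map and of its
   inverse; they never vanish together, and Wronskian identities bring in the Hopf coefficient. The
   second is that holomorphic functions appear only as smooth solutions of the Cauchy-Riemann
   equations. Zeros are therefore measured by iterated derivatives, leading coefficients are limits
   along a half-line obtained by repeated use of L'Hopital's rule, and unique continuation comes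
   from the maximum principle.

   The constants arise as follows. If a differential of degree l has leading term [c / z ^ l], its
   covariant derivative has leading coefficient [- l (n + 2) c / 2], because [gam ~ n / (2 z)]. The
   cases l = 2 and l = 3 give the factor [3/2 (n + 2)^2]. The function [k] only adds poles of lower
   order. *)
Require Import Defs.
From HB Require Import structures.
From mathcomp Require Import all_boot all_order all_algebra.
From mathcomp Require Import complex ring lra zify.
From mathcomp Require Import all_classical all_reals all_analysis.
Set Implicit Arguments.
Unset Strict Implicit.
Unset Printing Implicit Defensive.
Import Order.TTheory GRing.Theory Num.Theory.
Import numFieldNormedType.Exports.
Local Open Scope classical_set_scope.
Local Open Scope ring_scope.
Arguments dz : simpl never.

(** * Calculus in the plane *)

Section PlaneCalculus.
Variable R : realType.
Local Notation E := 'rV[R]_2.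
Local Notation pd i f := (partial (V := R^o) i f).
Local Notation dfb f z := (differentiable (f : E -> R^o) z).

Lemma near_partial (V : normedModType R) i (f g : E -> V) z :
  (\forall w \near z, f w = g w) -> partial i f z = partial i g z.
Proof. exact: near_eq_derive. Qed.

Lemma open_near (T : topologicalType) (U : set T) z (P : T -> Prop) :
  open U -> U z -> (forall w, U w -> P w) -> \forall w \near z, P w.
Proof.
by move=> oU Uz H; apply: filterS H _; apply: open_nbhs_nbhs.
Qed.

(** Differentiability is unfolded once into an epsilon estimate, so that invariance under equality
    of germs and differentiability of a local inverse can be proved by plain inequalities. *)
Lemma is_diff_eps (V W : normedModType R) (f : V -> W) x (L : {linear V -> W}) :
  continuous L ->
  (forall e, 0 < e -> \forall h \near (0 : V), `|f (h + x) - f x - L h| <= e * `|h|) ->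
  is_diff x f L.
Proof.
move=> Lc H.
have fE : f \o shift x = cst (f x) + L +o_ 0 id.
  apply/eqaddoP => e e0; apply: filterS (H e e0) => h.
  by rewrite /= !fctE opprD addrA.
have dE := diff_unique Lc fE.
apply: DiffDef => //; apply/diff_locallyP; rewrite dE; split => //.
Qed.

Lemma diff_eps (V W : normedModType R) (f : V -> W) x :
  differentiable f x ->
  forall e, 0 < e -> \forall h \near (0 : V), `|f (h + x) - f x - 'd f x h| <= e * `|h|.
Proof.
move=> /diff_locallyP[dc /eqaddoP H] e e0.
by apply: filterS (H e e0) => h; rewrite /= !fctE opprD addrA.
Qed.

Lemma near_differentiable (V W : normedModType R) (f g : V -> W) z :
  (\forall w \near z, f w = g w) -> differentiable f z -> differentiable g z.
Proof.
move=> fg df.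
suff : is_diff z g ('d f z) by case.
apply: is_diff_eps; first exact: diff_continuous.
move=> e e0; have := diff_eps df e0.
have : \forall h \near (0 : V), f (h + z) = g (h + z).
  by move: fg; rewrite (near_shift 0 z) /=; apply: filterS => h; rewrite subr0.
apply: filterS2 => h <-; by rewrite (nbhs_singleton fg).
Qed.

Lemma partialD i (f g : E -> R) z : dfb f z -> dfb g z ->
  pd i (fun w => f w + g w) z = pd i f z + pd i g z.
Proof.
move=> df dg.
exact: (deriveD (diff_derivable (v:=delta_mx 0 i) df)
               (diff_derivable (v:=delta_mx 0 i) dg)).
Qed.

Lemma partialN i (f : E -> R) z : dfb f z -> pd i (fun w => - f w) z = - pd i f z.
Proof. by move=> df; exact: (deriveN (diff_derivable (v:=delta_mx 0 i) df)). Qed.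

Lemma partialB i (f g : E -> R) z : dfb f z -> dfb g z ->
  pd i (fun w => f w - g w) z = pd i f z - pd i g z.
Proof.
move=> df dg.
exact: (deriveB (diff_derivable (v:=delta_mx 0 i) df)
               (diff_derivable (v:=delta_mx 0 i) dg)).
Qed.

Lemma partialM i (f g : E -> R) z : dfb f z -> dfb g z ->
  pd i (fun w => f w * g w) z = pd i f z * g z + f z * pd i g z.
Proof.
move=> df dg.
apply: etrans (deriveM (diff_derivable (v:=delta_mx 0 i) df)
                (diff_derivable (v:=delta_mx 0 i) dg)) _.
by rewrite addrC; congr (_ + _); rewrite -[LHS]/(_ * _) mulrC.
Qed.

Lemma partialV i (f : E -> R) z : dfb f z -> f z != 0 ->
  pd i (fun w => (f w)^-1) z = - pd i f z / f z ^+ 2.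
Proof.
move=> df fz.
apply: etrans (deriveV fz (diff_derivable (v:=delta_mx 0 i) df)) _.
by rewrite -[LHS]/(_ * _) mulrC mulrN mulNr.
Qed.

Lemma partialC i (c : R) z : pd i (fun=> c) z = 0.
Proof. exact: (derive_cst (c : R^o) z (delta_mx 0 i)). Qed.

Lemma partial_coord i j (z : E) : pd i (fun w => w 0 j) z = (i == j)%:R.
Proof.
have dv : derivable (id : E -> E) z (delta_mx 0 i) by exact: derivable_id.
have := derive_mx dv.
rewrite derive_id => /matrixP/(_ 0 j); rewrite !mxE eqxx /= => H; rewrite /partial -H.
by rewrite eq_sym.
Qed.

Lemma diff_coord j (z : E) : dfb (fun w => w 0 j) z.
Proof. exact: differentiable_coord. Qed.

(** * Stability of the classes [Cn] under arithmetic, composition and square roots *)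

Lemma CnS (V : normedModType R) k U (f : E -> V) : Cn k.+1 U f -> Cn k U f.
Proof.
elim: k f => [|k IH] f /=.
  by move=> [df _] z Uz; apply: differentiable_continuous; exact: df.
move=> [df Hd]; split => // i; apply: IH; exact: Hd.
Qed.

Lemma Cn_ext (V : normedModType R) k U (f g : E -> V) : open U ->
  (forall z, U z -> f z = g z) -> Cn k U f -> Cn k U g.
Proof.
move=> oU; elim: k f g => [|k IH] f g fg /=.
  move=> H z Uz; have fgz : {near z, f =1 g} by exact: (open_near oU Uz fg).
  apply: cvg_trans (near_eq_cvg fgz) _; rewrite -fg //; exact: H.
move=> [df H]; split=> [z Uz|i].
  by apply: near_differentiable (df z Uz); exact: open_near oU Uz fg.
apply: IH (H i) => z Uz; apply: near_partial; exact: (open_near oU Uz fg).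
Qed.

Lemma Cn_sub (V : normedModType R) k (U U' : set E) (f : E -> V) :
  U' `<=` U -> Cn k U f -> Cn k U' f.
Proof.
move=> sU; elim: k f => [|k IH] f /= H; first by move=> z /sU; exact: H.
by case: H => df H; split=> [z /sU|i]; [exact: df|exact: IH].
Qed.

(** The induction step behind the closure properties: partial derivatives may be replaced by any
    formula that agrees with them on the open set, and the induction hypothesis is then applied to
    the pieces of that formula. *)
Lemma Cn_step (V : normedModType R) k U (f : E -> V) (g : 'I_2 -> E -> V) :
  open U -> (forall z, U z -> differentiable f z) ->
  (forall i z, U z -> partial i f z = g i z) ->
  (forall i, Cn k U (g i)) -> Cn k.+1 U f.
Proof.
move=> oU df fg Hg; split => // i.
by apply: Cn_ext (Hg i) => // z Uz; rewrite fg.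
Qed.

Local Notation C k U f := (Cn (V := R^o) k U f).

Lemma C_cst k U (c : R) : C k U (fun=> c).
Proof.
elim: k U c => [|k IH] U c /=; first by move=> z _; exact: (@cst_continuous _ R^o c z).
split => [z _|i]; first exact: differentiable_cst.
have -> : pd i (fun=> c) = fun=> 0 by apply: funext => z; rewrite partialC.
exact: IH.
Qed.

Lemma C_coord k U j : C k U (fun w => w 0 j).
Proof.
case: k => [|k] /=.
  by move=> z _; apply: differentiable_continuous; exact: diff_coord.
split => [z _|i]; first exact: diff_coord.
have -> : pd i (fun w => w 0 j) = fun=> (i == j)%:R.
  by apply: funext => z; rewrite partial_coord.
exact: C_cst.
Qed.

Lemma C_D k U (f g : E -> R) : open U -> C k U f -> C k U g ->
  C k U (fun w => f w + g w).
Proof.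
move=> oU; elim: k f g => [|k IH] f g Hf Hg.
  by move=> z Uz; apply: (@continuousD R R^o _ f g z); [exact: Hf|exact: Hg].
case: (Hf) => df Hf'; case: (Hg) => dg Hg'.
apply: (Cn_step (g := fun i w => pd i f w + pd i g w)) => //.
- by move=> z Uz; apply: differentiableD; [exact: df|exact: dg].
- by move=> i z Uz; rewrite partialD //; [exact: df|exact: dg].
- by move=> i; apply: IH; [exact: Hf'|exact: Hg'].
Qed.

Lemma C_M k U (f g : E -> R) : open U -> C k U f -> C k U g ->
  C k U (fun w => f w * g w).
Proof.
move=> oU; elim: k f g => [|k IH] f g Hf Hg.
  by move=> z Uz; apply: (@continuousM R _ f g z); [exact: Hf|exact: Hg].
case: (Hf) => df Hf'; case: (Hg) => dg Hg'.
apply: (Cn_step (g := fun i w => pd i f w * g w + f w * pd i g w)) => //.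
- by move=> z Uz; apply: differentiableM; [exact: df|exact: dg].
- by move=> i z Uz; rewrite partialM //; [exact: df|exact: dg].
- move=> i; apply: C_D => //; apply: IH => //; by [exact: Hf'|exact: Hg'|exact: CnS].
Qed.

Lemma C_N k U (f : E -> R) : open U -> C k U f -> C k U (fun w => - f w).
Proof.
move=> oU Hf; apply: Cn_ext (C_M oU (C_cst k U (-1)) Hf) => // z _.
by rewrite mulN1r.
Qed.

Lemma C_B k U (f g : E -> R) : open U -> C k U f -> C k U g ->
  C k U (fun w => f w - g w).
Proof. by move=> oU Hf Hg; apply: C_D => //; exact: C_N. Qed.

(** The derivative of an inverse is a product that again contains inverses, to which the induction
    hypothesis applies at order [k]; the same device serves for [C_sqrt]. *)
Lemma C_V k U (f : E -> R) : open U -> (forall z, U z -> f z != 0) -> C k U f ->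
  C k U (fun w => (f w)^-1).
Proof.
move=> oU f0; elim: k => [|k IH] Hf.
  by move=> z Uz; apply: (@continuousV R _ f z); [exact: f0|exact: Hf].
case: (Hf) => df Hf'.
apply: (Cn_step (g := fun i w => - pd i f w * ((f w)^-1 * (f w)^-1))) => //.
- by move=> z Uz; apply: differentiableV; [exact: df|exact: f0].
- move=> i z Uz; rewrite partialV ?f0 //; last exact: df.
  by rewrite expr2 invfM.
- move=> i; apply: C_M => //; first by apply: C_N => //; exact: Hf'.
  by apply: C_M => //; apply: IH; exact: CnS.
Qed.

Lemma rowE (v : E) : v = v 0 0 *: delta_mx 0 0 + v 0 1 *: delta_mx 0 1.
Proof. by rewrite [LHS]row_sum_delta !big_ord_recl big_ord0 addr0; congr (_ + _ *: delta_mx 0 _);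
  [congr (v 0 _)|]; apply/val_inj. Qed.

Lemma diff_partial (V : normedModType R) (f : E -> V) z (v : E) : differentiable f z ->
  'd f z v = v 0 0 *: partial 0 f z + v 0 1 *: partial 1 f z.
Proof.
move=> df; rewrite {1}(rowE v) linearD !linearZ /=.
by rewrite /partial !deriveE.
Qed.

Lemma differentiable_row n (s : E -> 'rV[R]_n) z :
  (forall j, dfb (fun w => s w 0 j) z) -> differentiable s z.
Proof.
move=> H.
have -> : s = \sum_j (fun w => s w 0 j *: (delta_mx 0 j : 'rV[R]_n)).
  by apply: funext => w; rewrite fct_sumE -row_sum_delta.
apply: differentiable_sum => j.
exact: (differentiableZl (delta_mx 0 j : 'rV[R]_n) (H j)).
Qed.

Lemma differentiable_entry n (s : E -> 'rV[R]_n) z j :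
  differentiable s z -> dfb (fun w => s w 0 j) z.
Proof.
move=> ds.
apply: (@differentiable_comp R E 'rV[R]_n R^o s (fun M => M 0 j)) => //.
exact: differentiable_coord.
Qed.

Lemma partial_entry n (s : E -> 'rV[R]_n) z i j :
  differentiable s z -> partial i s z 0 j = pd i (fun w => s w 0 j) z.
Proof.
move=> ds; rewrite /partial derive_mx; last exact: diff_derivable.
by rewrite mxE.
Qed.

Lemma partial_comp i (f : E -> R) (s : E -> E) z :
  differentiable s z -> dfb f (s z) ->
  pd i (fun w => f (s w)) z =
  pd i (fun w => s w 0 0) z * pd 0 f (s z) + pd i (fun w => s w 0 1) z * pd 1 f (s z).
Proof.
move=> ds df.
have dfs : dfb (fun w => f (s w)) z by exact: (differentiable_comp ds df).
rewrite {1}/partial deriveE //.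
have -> : (fun w => f (s w)) = (f : E -> R^o) \o s by [].
rewrite diff_comp //= (diff_partial _ df) -deriveE //.
by rewrite -!partial_entry.
Qed.

Lemma C_comp k U U' (f : E -> R) (s : E -> E) : open U -> open U' ->
  (forall z, U z -> U' (s z)) -> (forall j, C k U (fun w => s w 0 j)) ->
  C k U' f -> C k U (fun w => f (s w)).
Proof.
move=> oU oU' sU; elim: k f => [|k IH] f Hs Hf.
  move=> z Uz; apply: (@continuous_comp _ _ R^o s f); last exact: Hf (sU _ Uz).
  have -> : s = (fun w => s w 0 0 *: (delta_mx 0 0 : E) + s w 0 1 *: (delta_mx 0 1 : E)).
    by apply: funext => w; rewrite -rowE.
  apply: (@continuousD R E _ (fun w => s w 0 0 *: (delta_mx 0 0 : E)) (fun w => s w 0 1 *: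
    (delta_mx 0 1 : E)));
  apply: continuousZr_tmp; exact: Hs.
case: (Hf) => df Hf'.
have ds z : U z -> differentiable s z.
  by move=> Uz; apply: differentiable_row => j; case: (Hs j) => + _; apply.
apply: (Cn_step (g := fun i w => pd i (fun w => s w 0 0) w * pd 0 f (s w) + pd i (fun w => s w 0 1)
  w * pd 1 f (s w))) => //.
- by move=> z Uz; exact: (@differentiable_comp R E E R^o s f z (ds z Uz) (df _ (sU _ Uz))).
- by move=> i z Uz; exact: (partial_comp i (ds z Uz) (df _ (sU _ Uz))).
- move=> i; have IH' j : C k U (fun w => pd j f (s w)).
    by apply: IH => //; [move=> l; exact: CnS|exact: Hf'].
  by apply: C_D => //; apply: C_M => //; [case: (Hs 0)|case: (Hs 1)] => _; apply.
Qed.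

Lemma comp1_diff (h : R -> R) (f : E -> R) z dh : dfb f z -> is_derive (f z) 1 h dh ->
  dfb (fun w => h (f w)) z.
Proof.
move=> df hh; apply: (@differentiable_comp R E R^o R^o f h) => //.
exact/derivable1_diffP.
Qed.

Lemma partial_comp1 i (h : R -> R) (f : E -> R) z dh : dfb f z ->
  is_derive (f z) 1 h dh ->
  pd i (fun w => h (f w)) z = dh * pd i f z.
Proof.
move=> df hh; have dh' : differentiable (h : R^o -> R^o) (f z) by apply/derivable1_diffP.
have dfs : dfb (fun w => h (f w)) z by exact: (differentiable_comp df dh').
rewrite {1}/partial deriveE //.
have -> : (fun w => h (f w)) = (h : R^o -> R^o) \o (f : E -> R^o) by [].
rewrite diff_comp //= (deriv1E (ex_derive (is_derive := hh))) /=.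
by rewrite derive1E derive_val -deriveE // -[LHS]/(_ * _) mulrC.
Qed.

Lemma C_sqrt k U (f : E -> R) : open U -> (forall z, U z -> 0 < f z) -> C k U f ->
  C k U (fun w => Num.sqrt (f w)).
Proof.
move=> oU f0; elim: k => [|k IH] Hf.
  move=> z Uz; apply: (@continuous_comp _ R^o R^o f Num.sqrt); first exact: Hf.
  exact: sqrt_continuous.
case: (Hf) => df Hf'.
have ds z : U z -> is_derive (f z) 1 (Num.sqrt : R -> R) ((2 * Num.sqrt (f z))^-1).
  by move=> Uz; exact: is_derive1_sqrt (f0 _ Uz).
apply: (Cn_step (g := fun i w => 2^-1 * (Num.sqrt (f w))^-1 * pd i f w)) => //.
- move=> z Uz; apply: comp1_diff (ds _ Uz); exact: df.
- move=> i z Uz; rewrite (partial_comp1 _ _ (ds _ Uz)); last exact: df.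
  by rewrite invfM.
- move=> i; apply: C_M => //; last exact: Hf'.
  apply: C_M => //; first exact: C_cst.
  apply: C_V => //; last by apply: IH; exact: CnS.
  by move=> z Uz; rewrite gt_eqF // sqrtr_gt0 f0.
Qed.

(** Directional derivatives become ordinary derivatives along a line, which gives access to the
    one-variable mean value theorem. *)
Lemma is_derive_line (V : normedModType R) (f : E -> V) (z v : E) t :
  derivable f (z + t *: v) v ->
  is_derive t 1 (fun t : R => f (z + t *: v)) ('D_v f (z + t *: v)).
Proof.
move=> df.
have H : (fun h : R => h^-1 *: ((fun t => f (z + t *: v)) (h *: 1 + t) - f (z + t *: v)))
  = (fun h : R => h^-1 *: (f (h *: v + (z + t *: v)) - f (z + t *: v))).
  apply: funext => h; congr (_ *: (f _ - _)).
  by rewrite -[h *: 1]/(h * 1) mulr1 scalerDl addrCA.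
apply: DeriveDef.
  by rewrite /derivable /= H.
by rewrite /derive /= H.
Qed.

End PlaneCalculus.

(** * Mixed partial derivatives and primitives of closed forms *)

Section MixedPartialsAndPrimitives.
Variable R : realType.
Local Notation E := 'rV[R]_2.
Local Notation pd i f := (partial (V := R^o) i f).
Local Notation dfb f z := (differentiable (f : E -> R^o) z).
Local Notation C k U f := (Cn (V := R^o) k U f).

Lemma ord2_ind (P : 'I_2 -> Prop) : P 0 -> P 1 -> forall i, P i.
Proof.
move=> P0 P1 [[|[|//]] Hi].
- by have -> : Ordinal Hi = 0 by exact: val_inj.
- by have -> : Ordinal Hi = 1 by exact: val_inj.
Qed.

Lemma rowP2 (v w : E) : v 0 0 = w 0 0 -> v 0 1 = w 0 1 -> v = w.
Proof. by move=> h0 h1; apply/rowP; apply: ord2_ind. Qed.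

Lemma ball2 (z w : E) r : 0 < r ->
  ball z r w <-> `|z 0 0 - w 0 0| < r /\ `|z 0 1 - w 0 1| < r.
Proof.
move=> r0; rewrite -ball_normE /ball_ /= /Num.Def.normr /= mx_normrE.
split=> [H|[H0 H1]].
  by split; apply: le_lt_trans H;
    [have := le_bigmax (0:R) (fun i : 'I_1 * 'I_2 => `|(z - w) i.1 i.2|) (0,0)|have := le_bigmax
      (0:R) (fun i : 'I_1 * 'I_2 => `|(z - w) i.1 i.2|) (0,1)]; rewrite /= !mxE.
apply: bigmax_lt => // -[i j] _ /=; rewrite ord1 !mxE.
by elim/ord2_ind: j.
Qed.

Lemma near2P (z : E) (P : E -> Prop) :
  (\forall w \near z, P w) <->
  exists2 r, 0 < r & forall w : E, `|w 0 0 - z 0 0| < r -> `|w 0 1 - z 0 1| < r -> P w.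
Proof.
split=> [/nbhs_ballP[r /= r0 H]|[r r0 H]].
  exists r => // w w0 w1; apply: H; apply/ball2 => //.
  by rewrite distrC (distrC (z 0 1)).
apply/nbhs_ballP; exists r => //= w /(ball2 _ _ r0)[w0 w1]; apply: H.
  by rewrite distrC.
by rewrite distrC.
Qed.

Lemma nbhs2P (z : E) (U : set E) : open U -> U z ->
  exists2 r, 0 < r & forall w : E, `|w 0 0 - z 0 0| < r -> `|w 0 1 - z 0 1| < r -> U w.
Proof.
by move=> oU Uz; apply/near2P; apply: open_near oU Uz _.
Qed.

Lemma seg_MVT (f : E -> R) (z v : E) :
  (forall t : R, 0 <= t <= 1 -> dfb f (z + t *: v)) ->
  exists2 t, 0 < t < 1 & f (z + v) - f z =
    v 0 0 * pd 0 f (z + t *: v) + v 0 1 * pd 1 f (z + t *: v).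
Proof.
move=> df.
have dg (t : R) : 0 <= t <= 1 -> is_derive t 1 (fun t : R => (f : E -> R^o) (z + t *: v))
   ('D_v (f : E -> R^o) (z + t *: v)).
  by move=> t01; apply: is_derive_line; apply: diff_derivable; exact: df.
have [||c] := @MVT R (fun t => f (z + t *: v)) (fun t => 'D_v (f : E -> R^o) (z + t *: v)) 0 1
  ltr01.
- by move=> t; rewrite in_itv /= => /andP[t0 t1]; apply: dg; rewrite !ltW.
- apply: derivable_within_continuous => t; rewrite in_itv /= => t01.
  by have := dg t t01; case.
rewrite in_itv /= subr0 mulr1 scale0r addr0 scale1r => c01 ->.
exists c => //; rewrite deriveE ?diff_partial //; apply: df;
by case/andP: c01 => *; rewrite !ltW.
Qed.

(** The second difference [D] over a square of side [h] is [h * h] times either mixed derivative at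
    some point of the square, by two applications of the mean value theorem in either order.
    Continuity at [z] then makes the two values agree up to [e]. *)
Lemma mixed_partial U (f : E -> R) (z : E) : open U -> C 2 U f -> U z ->
  pd 0 (pd 1 f) z = pd 1 (pd 0 f) z.
Proof.
move=> oU [df Hf] Uz.
have [d0 c0] := Hf 0; have [d1 c1] := Hf 1.
apply/eqP; rewrite -subr_eq0 -normr_eq0.
rewrite eq_le normr_ge0 andbT; apply/ler_addgt0Pr => e e0; rewrite add0r.
have e20 : 0 < e / 2 by rewrite divr_gt0.
have := c1 0 z Uz => /cvgrPdist_lt/(_ _ e20)/near2P[r1 r10 H1].
have := c0 1 z Uz => /cvgrPdist_lt/(_ _ e20)/near2P[r2 r20 H2].
have [r3 r30 H3] := nbhs2P oU Uz.
(* Half of the smallest radius: the square with corner [z] and side [h] lies in [U], and on it both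
   mixed derivatives vary by less than [e / 2]. *)
set h := Num.min (Num.min r1 r2) r3 / 2.
have m0 : 0 < Num.min (Num.min r1 r2) r3 by rewrite !lt_min r10 r20.
have h0 : 0 < h by rewrite divr_gt0.
have hlt : h < Num.min (Num.min r1 r2) r3.
  by rewrite /h ltr_pdivrMr // mulr2n mulrDr mulr1 ltrDl.
have [hr1 hr2 hr3] : [/\ h < r1, h < r2 & h < r3].
  by move: hlt; rewrite !lt_min => /andP[/andP[]].
pose p (a b : R) : E := z + a *: delta_mx 0 0 + b *: delta_mx 0 1.
have p0 a b : p a b 0 0 = z 0 0 + a by rewrite !mxE /= !mulr1 !mulr0 addr0.
have p1 a b : p a b 0 1 = z 0 1 + b by rewrite !mxE /= !mulr1 !mulr0 addr0.
have inU (a b : R) : 0 <= a <= h -> 0 <= b <= h -> U (p a b).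
  move=> /andP[a0 ah] /andP[b0 bh]; apply: H3.
    by rewrite p0 addrC addKr ger0_norm // (le_lt_trans ah).
  by rewrite p1 addrC addKr ger0_norm // (le_lt_trans bh).
have sc (t : R) : 0 <= t <= 1 -> 0 <= t * h <= h.
  move=> /andP[t0 t1]; rewrite mulr_ge0 ?(ltW h0) //=.
  by rewrite ger_pMl.
have hh : 0 <= h <= h by rewrite lexx ltW.
have zz : (0 : R) <= 0 <= h by rewrite lexx ltW.
have pE0 a b t : p a b + t *: (h *: delta_mx 0 0) = p (a + t * h) b.
  by apply: rowP2; rewrite !mxE /= ?mulr1 ?mulr0 ?addr0 ?addrA.
have pE1 a b t : p a b + t *: (h *: delta_mx 0 1) = p a (b + t * h).
  by apply: rowP2; rewrite !mxE /= ?mulr1 ?mulr0 ?addr0 ?addrA.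
pose D := f (p h h) - f (p h 0) - f (p 0 h) + f (p 0 0).
have sh (g : E -> R) i (w : E) : dfb g (w + h *: delta_mx 0 i) ->
    dfb (fun w => g (w + h *: delta_mx 0 i)) w /\
    forall j, pd j (fun w => g (w + h *: delta_mx 0 i)) w = pd j g (w + h *: delta_mx 0 i).
  move=> dg.
  have ds : is_diff w (fun w : E => w + h *: delta_mx 0 i) id.
    have := is_diffD (is_diff_id w) (is_diff_cst (h *: delta_mx 0 i : E) w).
    by rewrite addr0.
  have dd : dfb (fun w => g (w + h *: delta_mx 0 i)) w.
    by apply: (@differentiable_comp R E E R^o (fun w => w + h *: delta_mx 0 i) g) => //; case: ds.
  split => // j.
  have E1 : (fun t : R => t^-1 *: ((g (t *: delta_mx 0 j + w + h *: delta_mx 0 i) : R^o) - g (w + h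
    *: delta_mx 0 i)))
     = (fun t : R => t^-1 *: ((g (t *: delta_mx 0 j + (w + h *: delta_mx 0 i)) : R^o) - g (w + h *:
       delta_mx 0 i))).
    by apply: funext => t; rewrite addrA.
  by rewrite /partial /derive /= E1.
have A1 : exists2 w : E, (`|w 0 0 - z 0 0| < r1 /\ `|w 0 1 - z 0 1| < r1) /\ (`|w 0 0 - z 0 0| < r2
  /\ `|w 0 1 - z 0 1| < r2) & D = h * h * pd 1 (pd 0 f) w.
  (* [D] is the increment of [g] in the first direction; the mean value theorem is applied to [g]
     and then to [pd 0 f] in the second direction. *)
  pose g w := f (w + h *: delta_mx 0 1) - f w.
  have dg a : 0 <= a <= h -> dfb g (p a 0) /\
     pd 0 g (p a 0) = pd 0 f (p a h) - pd 0 f (p a 0).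
    move=> ah.
    have E1 : p a 0 + h *: delta_mx 0 1 = p a h by rewrite /p scale0r addr0.
    have [|k1 k2] := sh f 1 (p a 0); first by rewrite E1; apply: df; apply: inU.
    have k3 : dfb f (p a 0) by apply: df; apply: inU.
    split; first exact: differentiableB.
    by rewrite -E1 -k2; exact: partialB.
  have [|t /andP[t0 t1]] := @seg_MVT g (p 0 0) (h *: delta_mx 0 0).
    by move=> t /sc t01; rewrite pE0 add0r; have [] := dg _ t01.
  rewrite !mxE /= mulr1 mulr0 mul0r addr0 pE0 add0r.
  have th : 0 <= t * h <= h by apply: sc; rewrite !ltW.
  have [_ ->] := dg _ th.
  have [|s /andP[s0 s1]] := @seg_MVT (pd 0 f) (p (t * h) 0) (h *: delta_mx 0 1).
    by move=> s /sc s01; rewrite pE1 add0r; apply: d0; apply: inU.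
  rewrite !mxE /= mulr1 mulr0 mul0r add0r pE1 add0r.
  have -> : p (t * h) 0 + h *: delta_mx 0 1 = p (t * h) h by rewrite /p scale0r addr0.
  move=> -> gE.
  have shh : 0 <= s * h <= h by apply: sc; rewrite !ltW.
  exists (p (t * h) (s * h)).
    rewrite p0 p1 !(addrC (z 0 _)) !addrK.
    move: th shh => /andP[a1 a2] /andP[b1 b2].
    by rewrite !ger0_norm //; split; split; exact: le_lt_trans hr1 || exact: le_lt_trans hr2.
  rewrite -mulrA -gE /g /D.
  have -> : p 0 0 + h *: delta_mx 0 0 = p h 0 by rewrite /p !scale0r !addr0.
  have -> : p h 0 + h *: delta_mx 0 1 = p h h by rewrite /p scale0r addr0.
  have -> : p 0 0 + h *: delta_mx 0 1 = p 0 h by rewrite /p !scale0r !addr0.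
  by rewrite opprB; ring.
have A2 : exists2 w : E, (`|w 0 0 - z 0 0| < r1 /\ `|w 0 1 - z 0 1| < r1) /\ (`|w 0 0 - z 0 0| < r2
  /\ `|w 0 1 - z 0 1| < r2) & D = h * h * pd 0 (pd 1 f) w.
  pose g w := f (w + h *: delta_mx 0 0) - f w.
  have dg a : 0 <= a <= h -> dfb g (p 0 a) /\
     pd 1 g (p 0 a) = pd 1 f (p h a) - pd 1 f (p 0 a).
    move=> ah.
    have E1 : p 0 a + h *: delta_mx 0 0 = p h a by rewrite /p scale0r addr0 addrAC.
    have [|k1 k2] := sh f 0 (p 0 a); first by rewrite E1; apply: df; apply: inU.
    have k3 : dfb f (p 0 a) by apply: df; apply: inU.
    split; first exact: differentiableB.
    by rewrite -E1 -k2; exact: partialB.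
  have [|t /andP[t0 t1]] := @seg_MVT g (p 0 0) (h *: delta_mx 0 1).
    by move=> t /sc t01; rewrite pE1 add0r; have [] := dg _ t01.
  rewrite !mxE /= mulr1 mulr0 mul0r add0r pE1 add0r.
  have th : 0 <= t * h <= h by apply: sc; rewrite !ltW.
  have [_ ->] := dg _ th.
  have [|s /andP[s0 s1]] := @seg_MVT (pd 1 f) (p 0 (t * h)) (h *: delta_mx 0 0).
    by move=> s /sc s01; rewrite pE0 add0r; apply: d1; apply: inU.
  rewrite !mxE /= mulr1 mulr0 mul0r addr0 pE0 add0r.
  have -> : p 0 (t * h) + h *: delta_mx 0 0 = p h (t * h) by rewrite /p scale0r addr0 addrAC.
  move=> -> gE.
  have shh : 0 <= s * h <= h by apply: sc; rewrite !ltW.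
  exists (p (s * h) (t * h)).
    rewrite p0 p1 !(addrC (z 0 _)) !addrK.
    move: th shh => /andP[a1 a2] /andP[b1 b2].
    by rewrite !ger0_norm //; split; split; exact: le_lt_trans hr1 || exact: le_lt_trans hr2.
  rewrite -mulrA -gE /g /D.
  have -> : p 0 0 + h *: delta_mx 0 1 = p 0 h by rewrite /p !scale0r !addr0.
  have -> : p 0 h + h *: delta_mx 0 0 = p h h by rewrite /p scale0r addr0 addrAC.
  have -> : p 0 0 + h *: delta_mx 0 0 = p h 0 by rewrite /p !scale0r !addr0.
  by rewrite opprB; ring.
have [w1 [_ [w10 w11]] D1] := A1; have [w2 [[w20 w21] _] D2] := A2.
have hn0 : h * h != 0 by rewrite mulf_neq0 // gt_eqF.
have EE : pd 1 (pd 0 f) w1 = pd 0 (pd 1 f) w2.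
  by move: D2; rewrite D1; apply: mulfI.
have k2 := H2 _ w10 w11; have k1 := H1 _ w20 w21.
rewrite EE in k2; move: k1 k2.
move: (pd 0 (pd 1 f) z) (pd 1 (pd 0 f) z) (pd 0 (pd 1 f) w2) => a b m k1 k2.
apply: (le_trans (ler_distD m _ _)); rewrite [leRHS]splitr (distrC m).
by apply: lerD; apply: ltW.
Qed.

(** * Slices parallel to the axes, and primitives of closed forms *)

Definition pt (x y : R) : E := \row_(j < 2) (if j == 0 then x else y).

Lemma pt0 x y : pt x y 0 0 = x. Proof. by rewrite mxE. Qed.
Lemma pt1 x y : pt x y 0 1 = y. Proof. by rewrite mxE. Qed.
Lemma ptE (w : E) : pt (w 0 0) (w 0 1) = w.
Proof. by apply: rowP2; rewrite ?pt0 ?pt1. Qed.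

Lemma line0 x y t : pt x y + t *: delta_mx 0 0 = pt (x + t) y.
Proof. by apply: rowP2; rewrite !mxE /= ?mulr1 ?mulr0 ?addr0. Qed.
Lemma line1 x y t : pt x y + t *: delta_mx 0 1 = pt x (y + t).
Proof. by apply: rowP2; rewrite !mxE /= ?mulr1 ?mulr0 ?addr0. Qed.

Lemma is_derive_pt0 (f : E -> R) (x y d : R) : is_derive x 1 (fun x => f (pt x y)) d ->
  is_derive (pt x y) (delta_mx 0 0) (f : E -> R^o) d.
Proof.
have H : (fun h : R => h^-1 *: (((fun x => f (pt x y)) (h *: 1 + x) : R^o) - f (pt x y)))
       = (fun h : R => h^-1 *: ((f (h *: delta_mx 0 0 + pt x y) : R^o) - f (pt x y))).
  by apply: funext => h; rewrite [_ + pt x y]addrC line0 (addrC x) -[h *: 1]/(h * 1) mulr1.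
case; rewrite /derivable /derive /= H => dH dE.
by apply: DeriveDef.
Qed.

Lemma is_derive_pt1 (f : E -> R) (x y d : R) : is_derive y 1 (fun y => f (pt x y)) d ->
  is_derive (pt x y) (delta_mx 0 1) (f : E -> R^o) d.
Proof.
have H : (fun h : R => h^-1 *: (((fun y => f (pt x y)) (h *: 1 + y) : R^o) - f (pt x y)))
       = (fun h : R => h^-1 *: ((f (h *: delta_mx 0 1 + pt x y) : R^o) - f (pt x y))).
  by apply: funext => h; rewrite [_ + pt x y]addrC line1 (addrC y) -[h *: 1]/(h * 1) mulr1.
case; rewrite /derivable /derive /= H => dH dE.
by apply: DeriveDef.
Qed.

Lemma is_derive_pt0_inv (f : E -> R) (x y : R) : derivable (f : E -> R^o) (pt x y) (delta_mx 0 0) ->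
  is_derive x 1 (fun x => f (pt x y)) (pd 0 f (pt x y)).
Proof.
move=> df.
have := @is_derive_line R R^o f (pt 0 y) (delta_mx 0 0) x.
rewrite line0 add0r => /(_ df).
by congr (is_derive _ _ _ _); apply: funext => t; rewrite line0 add0r.
Qed.

Lemma is_derive_pt1_inv (f : E -> R) (x y : R) : derivable (f : E -> R^o) (pt x y) (delta_mx 0 1) ->
  is_derive y 1 (fun y => f (pt x y)) (pd 1 f (pt x y)).
Proof.
move=> df.
have := @is_derive_line R R^o f (pt x 0) (delta_mx 0 1) y.
rewrite line1 add0r => /(_ df).
by congr (is_derive _ _ _ _); apply: funext => t; rewrite line1 add0r.
Qed.

Lemma MVTu (f df : R -> R) (a b : R) :
  (forall x, Num.min a b <= x <= Num.max a b -> is_derive x 1 f (df x)) ->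
  exists2 c, Num.min a b <= c <= Num.max a b & f b - f a = df c * (b - a).
Proof.
wlog ab : a b / a <= b => [hw|].
  move=> H; have [ab|ba] := orP (le_total a b); first exact: hw.
  have [|c cab E1] := hw b a ba; first by move=> x; rewrite minC maxC; exact: H.
  exists c; first by rewrite minC maxC.
  by rewrite -opprB E1 -mulrN opprB.
rewrite min_l // max_r // => H.
have [||c cab ->] := @MVT_segment R f df a b ab.
- by move=> x; rewrite in_itv /= => /andP[h1 h2]; apply: H; rewrite !ltW.
- apply: derivable_within_continuous => t; rewrite in_itv /= => tab.
  by have := H t tab; case.
by exists c => //; move: cab; rewrite in_itv.
Qed.

Lemma norm_row2 (h : E) e : 0 <= e ->
  `|h| <= e <-> `|h 0 0| <= e /\ `|h 0 1| <= e.
Proof.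
move=> e0; rewrite /Num.Def.normr /= mx_normrE.
split=> [H|[H0 H1]].
  by split; apply: le_trans H; [exact: (le_bigmax (0:R) (fun i : 'I_1 * 'I_2 => `|h i.1 i.2|)
    (0,0))|exact: (le_bigmax (0:R) (fun i : 'I_1 * 'I_2 => `|h i.1 i.2|) (0,1))].
apply: bigmax_le => // -[i j] _ /=; rewrite ord1.
by elim/ord2_ind: j.
Qed.

Lemma entry_le_norm (h : E) : `|h 0 0| <= `|h| /\ `|h 0 1| <= `|h|.
Proof. exact/norm_row2. Qed.

Lemma diff2_eps (f : E -> R) (z : E) al be :
  (forall e, 0 < e -> \forall h \near (0 : E),
     `|f (h + z) - f z - (h 0 0 * al + h 0 1 * be)| <= e * `|h|) ->
  [/\ dfb f z, pd 0 f z = al & pd 1 f z = be].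
Proof.
move=> H.
pose L (v : E) : R^o := v 0 0 * al + v 0 1 * be.
have lL : linear L.
  by move=> k u v; rewrite /L !mxE /= -[k *: _]/(k * _); ring.
pose LL : {linear E -> R^o} := HB.pack L (GRing.isLinear.Build R E R^o _ L lL).
have [df dfE] : is_diff z (f : E -> R^o) LL.
  apply: is_diff_eps => //.
  move=> w; apply: (@continuousD R R^o E (fun v => v 0 0 * al) (fun v => v 0 1 * be));
  apply: (@continuousM R E (fun v => v 0 _) (cst _));
  by [exact: differentiable_continuous (diff_coord _ _)|exact: cst_continuous].
split=> //; rewrite /partial deriveE // dfE /= /L !mxE /=;
by rewrite !(mul1r, mul0r) ?addr0 ?add0r.
Qed.

Lemma diff2_eps_inv (f : E -> R) (z : E) : dfb f z ->
  forall e, 0 < e -> \forall h \near (0 : E),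
     `|f (h + z) - f z - (h 0 0 * pd 0 f z + h 0 1 * pd 1 f z)| <= e * `|h|.
Proof.
move=> df e e0; apply: filterS (diff_eps df e0) => h.
by rewrite (diff_partial _ df).
Qed.

(** The increment is split along an L-shaped path with corner [pt (z 0 0) (z 0 1 + h 0 1)]; the mean
    value theorem on each leg and continuity of the partials at [z] bound the error. *)
Lemma C1_diff U (f : E -> R) (g : 'I_2 -> E -> R) (z : E) : open U -> U z ->
  (forall i w, U w -> is_derive w (delta_mx 0 i) (f : E -> R^o) (g i w)) ->
  (forall i, {for z, continuous (g i : E -> R^o)}) ->
  dfb f z.
Proof.
move=> oU Uz H cg.
suff [] : [/\ dfb f z, pd 0 f z = g 0 z & pd 1 f z = g 1 z] by [].
apply: diff2_eps.
move=> e e0; have e20 : 0 < e / 2 by rewrite divr_gt0.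
have := cg 0 => /cvgrPdist_lt/(_ _ e20)/near2P[r1 r10 H1].
have := cg 1 => /cvgrPdist_lt/(_ _ e20)/near2P[r2 r20 H2].
have [r3 r30 H3] := nbhs2P oU Uz.
have m0 : 0 < Num.min (Num.min r1 r2) r3 by rewrite !lt_min r10 r20.
apply/near2P; exists (Num.min (Num.min r1 r2) r3) => // h.
rewrite !mxE !subr0 !lt_min => /andP[/andP[h01 h02] h03] /andP[/andP[h11 h12] h13].
have zE : z = pt (z 0 0) (z 0 1) by rewrite ptE.
have hzE : h + z = pt (z 0 0 + h 0 0) (z 0 1 + h 0 1).
  by apply: rowP2; rewrite ?pt0 ?pt1 mxE addrC.
have inU x y : `|x| <= `|h 0 0| -> `|y| <= `|h 0 1| -> U (pt (z 0 0 + x) (z 0 1 + y)).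
  move=> hx hy; apply: H3; rewrite ?pt0 ?pt1 addrC addKr.
    exact: le_lt_trans hx h03.
  exact: le_lt_trans hy h13.
have btw (s t u : R) : Num.min s (s + t) <= u <= Num.max s (s + t) -> `|u - s| <= `|t|.
  case: (leP 0 t) => t0.
    rewrite min_l ?max_r ?lerDl // => /andP[a b].
    by rewrite !ger0_norm ?subr_ge0 // lerBlDl.
  rewrite min_r ?max_l ?gerDl ?(ltW t0) // => /andP[a b].
  by rewrite !ler0_norm ?subr_le0 ?(ltW t0) // opprB lerBlDr -lerBlDl opprK.
have dU i w : U w -> pd i f w = g i w by move=> Uw; apply: derive_val; exact: H.
have [|c0 /btw c0h E0] := @MVTu (fun x => f (pt x (z 0 1 + h 0 1))) (fun x => g 0 (pt x (z 0 1 + h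
  0 1))) (z 0 0) (z 0 0 + h 0 0).
  move=> x /btw xh.
  have Ux : U (pt x (z 0 1 + h 0 1)).
    by have := @inU (x - z 0 0) (h 0 1); rewrite (addrC (z 0 0)) subrK; apply.
  rewrite -dU //; apply: is_derive_pt0_inv; by case: (H 0 _ Ux).
have [|c1 /btw c1h E1] := @MVTu (fun y => f (pt (z 0 0) y)) (fun y => g 1 (pt (z 0 0) y)) (z 0 1)
  (z 0 1 + h 0 1).
  move=> x /btw xh.
  have Ux : U (pt (z 0 0) x).
    by have := @inU 0 (x - z 0 1); rewrite addr0 (addrC (z 0 1)) subrK; apply; rewrite ?normr0.
  rewrite -dU //; apply: is_derive_pt1_inv; by case: (H 1 _ Ux).
have -> : f (h + z) - f z - (h 0 0 * g 0 z + h 0 1 * g 1 z) = h 0 0 * (g 0 (pt c0 (z 0 1 + h 0 1))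
  - g 0 z) + h 0 1 * (g 1 (pt (z 0 0) c1) - g 1 z).
  have fz : f z = f (pt (z 0 0) (z 0 1)) by rewrite ptE.
  rewrite hzE fz.
  have -> : f (pt (z 0 0 + h 0 0) (z 0 1 + h 0 1)) =
      (f (pt (z 0 0 + h 0 0) (z 0 1 + h 0 1)) - f (pt (z 0 0) (z 0 1 + h 0 1)))
      + (f (pt (z 0 0) (z 0 1 + h 0 1)) - f (pt (z 0 0) (z 0 1))) + f (pt (z 0 0) (z 0 1)) by ring.
  by rewrite E0 E1; ring.
have [hn0 hn1] := entry_le_norm h.
apply: (le_trans (ler_normD _ _)); rewrite !normrM.
have k1 : `|g 0 (pt c0 (z 0 1 + h 0 1)) - g 0 z| <= e / 2.
  rewrite distrC; apply/ltW/H1; rewrite ?pt0 ?pt1; first exact: le_lt_trans c0h h01.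
  by rewrite addrC addKr.
have k2 : `|g 1 (pt (z 0 0) c1) - g 1 z| <= e / 2.
  rewrite distrC; apply/ltW/H2; rewrite ?pt0 ?pt1 ?subrr ?normr0 //.
  exact: le_lt_trans c1h h12.
have -> : e * `|h| = `|h| * (e / 2) + `|h| * (e / 2) by field.
by apply: lerD; apply: ler_pM.
Qed.

Lemma antiderivative (f : R -> R) (a u : R) : a < u ->
  (forall x, a <= x <= u -> {for x, continuous f}) ->
  exists F, forall x, a < x < u -> is_derive x 1 F (f x).
Proof.
move=> au cf.
exists (fun x => (\int[@lebesgue_measure R]_(t in `[a, x]) f t)%R) => x /andP[ax xu].
have [||dF FE] := @continuous_FTC1_closed R f a x u xu _ ax.
- apply: continuous_compact_integrable; first exact: segment_compact.
  apply: continuous_in_subspaceT => y; rewrite inE /= in_itv /=; exact: cf.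
- by apply: cf; rewrite !ltW.
by apply: DeriveDef; [exact: dF|exact: etrans (esym (derive1E _ _)) FE].
Qed.

Lemma is_derive_quad (f : R -> R) (x c K : R) :
  (\forall h \near (0 : R), `|f (x + h) - f x - h * c| <= K * h ^+ 2) ->
  is_derive x 1 f c.
Proof.
move=> H.
have cl : (fun h : R => h^-1 *: ((f (h *: 1 + x) : R^o) - f x)) @ 0^' --> (c : R^o).
  apply/cvgrPdist_le => e e0.
  have [r /= r0 Hr] := (nbhs_ballP _ _).1 H.
  (* [K] has no prescribed sign, so 1 + |K| replaces it to keep the radius positive. *)
  apply/nbhs_ballP; exists (Num.min r (e / (1 + `|K|))) => /=.
    by rewrite lt_min r0 divr_gt0 // ltr_pwDl.
  move=> h /=; rewrite /ball /= sub0r normrN lt_min => /andP[hr he] h0.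
  have := Hr h; rewrite /ball /= sub0r normrN => /(_ hr) Hh.
  have -> : c - h^-1 *: ((f (h *: 1 + x) : R^o) - f x) = - (h^-1 * (f (x + h) - f x - h * c)).
    rewrite -[h *: 1]/(h * 1) mulr1 (addrC h) -[_ *: _]/(_ * _) [in RHS]mulrBr mulKf //.
    by rewrite opprB.
  rewrite normrN normrM normfV ler_pdivrMl ?normr_gt0 //.
  apply: (le_trans Hh); apply: (@le_trans _ _ ((1 + `|K|) * `|h| ^+ 2)).
    rewrite real_normK ?num_real // ler_wpM2r ?sqr_ge0 //.
    by apply: (le_trans (ler_norm _)); rewrite lerDr.
  rewrite expr2 mulrCA ler_wpM2l //.
  by rewrite mulrC -ler_pdivlMr ?ltr_pwDl // ltW.
by apply: DeriveDef; [apply/cvg_ex; exists c|apply/cvg_lim].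
Qed.

Definition box (z : E) (r : R) : set E :=
  [set w | `|w 0 0 - z 0 0| < r /\ `|w 0 1 - z 0 1| < r].

Lemma open_box z r : open (box z r).
Proof.
have [r0|r0] := ltP 0 r.
  suff -> : box z r = ball z r by exact: ball_open.
  by apply/seteqP; split=> w; rewrite /box /= ball2 // distrC (distrC (z 0 1)).
suff -> : box z r = set0 by exact: open0.
rewrite -subset0 => w [] h _; have := lt_le_trans h r0; by rewrite ltNge normr_ge0.
Qed.

Lemma box_center z r : 0 < r -> box z r z.
Proof. by move=> r0; split; rewrite subrr normr0. Qed.

Lemma box_nbhs (z : E) (U : set E) : open U -> U z -> exists2 r, 0 < r & box z r `<=` U.
Proof.
by move=> oU Uz; have [r r0 H] := nbhs2P oU Uz; exists r => // w []; exact: H.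
Qed.

Lemma box_near (z : E) (P : E -> Prop) :
  (\forall w \near z, P w) -> exists2 r, 0 < r & forall w, box z r w -> P w.
Proof. by move/near2P => [r r0 H]; exists r => // w []; exact: H. Qed.

Definition cbox (z : E) (r : R) : set E :=
  [set w | `|w 0 0 - z 0 0| <= r /\ `|w 0 1 - z 0 1| <= r].

Lemma compact_cbox z r : compact (cbox z r).
Proof.
have -> : cbox z r = [set v : E | forall i, `[z 0 i - r, z 0 i + r]%classic (v ord0 i)].
  apply/seteqP; split=> w /=.
    by move=> [h0 h1]; apply: ord2_ind; rewrite /= in_itv /= -ler_distl.
  move=> H; have := H 0; have := H 1; rewrite /= !in_itv /= -!ler_distl.
  by move=> h1 h0; split.
apply: (@rV_compact R^o 2 (fun i => `[z 0 i - r, z 0 i + r]%classic)) => i.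
exact: segment_compact.
Qed.

Lemma box_le z r r' : r <= r' -> box z r `<=` box z r'.
Proof. by move=> rr w [h0 h1]; split; exact: lt_le_trans rr. Qed.

Lemma btw_dist (x0 r s t u : R) : `|s - x0| < r -> `|t - x0| < r ->
  Num.min s t <= u <= Num.max s t -> `|u - x0| < r.
Proof.
rewrite !ltr_distl ge_min le_max => /andP[a1 a2] /andP[b1 b2].
by move=> /andP[/orP[] c1 /orP[] c2]; apply/andP; split; lra.
Qed.

Lemma local_bound (f : E -> R) z : {for z, continuous (f : E -> R^o)} ->
  \forall w \near z, `|f w| <= `|f z| + 1.
Proof.
move=> /cvgrPdist_lt/(_ _ ltr01); apply: filterS => w.
rewrite distrC => H; rewrite -lerBlDl; apply/ltW; apply: le_lt_trans H.
by apply: le_trans (lerB_dist _ _) _.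
Qed.

Lemma between_dist (x h s : R) : Num.min x (x + h) <= s <= Num.max x (x + h) -> `|s - x| <= `|h|.
Proof.
case: (leP 0 h) => h0.
  rewrite min_l ?max_r ?lerDl // => /andP[c1 c2].
  by rewrite !ger0_norm ?subr_ge0 //; lra.
rewrite min_r ?max_l ?gerDl ?(ltW h0) // => /andP[c1 c2].
by rewrite !ler0_norm ?subr_le0 ?(ltW h0) //; lra.
Qed.

(* The primitive is built by integrating along a horizontal segment and then a
   vertical one; its partial derivative in the first variable is controlled by a
   local bound on the second derivative, so that no differentiation under the
   integral sign is needed. *)
Lemma primitive U (a b : E -> R) (z0 : E) : open U -> U z0 ->
  (forall k, C k U a) -> (forall k, C k U b) ->
  (forall z, U z -> pd 1 a z = pd 0 b z) ->
  exists V v, [/\ open V, V z0, V `<=` U, forall k, C k V v &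
    forall z, V z -> pd 0 v z = a z /\ pd 1 v z = b z].
Proof.
move=> oU Uz0 Ca Cb ab.
have [r1 r10 H1] := box_nbhs oU Uz0.
have cbb : {for z0, continuous (pd 0 (pd 0 b) : E -> R^o)}.
  by have [_ /(_ 0)[_ /(_ 0) H]] := Cb 2%N; exact: H.
have [r2 r20 H2] := box_near (local_bound cbb).
set K := `|pd 0 (pd 0 b) z0| + 1 in H2.
pose rr := Num.min r1 r2; pose r := rr / 2.
have rr0 : 0 < rr by rewrite lt_min r10.
have r0 : 0 < r by rewrite divr_gt0.
have rlt : r < rr by rewrite /r ltr_pdivrMr // mulr2n mulrDr mulr1 ltrDl.
have inU : box z0 rr `<=` U.
  have rle : rr <= r1 by rewrite /rr ge_min lexx.
  by move=> w /(box_le rle) ?; apply: H1.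
have bK w : box z0 rr w -> `|pd 0 (pd 0 b) w| <= K.
  have rle : rr <= r2 by rewrite /rr ge_min lexx orbT.
  by move=> /(box_le rle) ?; apply: H2.
set x0 := z0 0 0; set y0 := z0 0 1.
have Upt (x y : R) : `|x - x0| < rr -> `|y - y0| < rr -> box z0 rr (pt x y).
  by move=> hx hy; split; rewrite ?pt0 ?pt1.
have cont_pt0 (f : E -> R) (x y : R) : dfb f (pt x y) ->
    {for x, continuous (fun x => f (pt x y))}.
  move=> df; apply: differentiable_continuous.
  apply/derivable1_diffP; case: (@is_derive_pt0_inv f x y) => //.
  exact: diff_derivable.
have cont_pt1 (f : E -> R) (x y : R) : dfb f (pt x y) ->
    {for y, continuous (fun y => f (pt x y))}.
  move=> df; apply: differentiable_continuous.
  apply/derivable1_diffP; case: (@is_derive_pt1_inv f x y) => //.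
  exact: diff_derivable.
have da w : U w -> dfb a w by case: (Ca 1%N) => + _; apply.
have db w : U w -> dfb b w by case: (Cb 1%N) => + _; apply.
have db0 w : U w -> dfb (pd 0 b) w by case: (Cb 2%N) => _ /(_ 0)[+ _]; apply.
have small (c x : R) : c - r <= x <= c + r -> `|x - c| < rr.
  by move=> H; apply: le_lt_trans rlt; rewrite ler_distl.
have y0rr : `|y0 - y0| < rr by rewrite subrr normr0.
have x0rr : `|x0 - x0| < rr by rewrite subrr normr0.
have [|x /small hx|A HA] := @antiderivative (fun x => a (pt x y0)) (x0 - r) (x0 + r).
- by rewrite ltrD2l gtrN.
- by apply: cont_pt0; apply/da/inU/Upt.
(* The vertical integrals are normalised to vanish at height [y0], where the horizontal integral [A]
   is taken; outside the box a dummy function is chosen. *)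
have : forall x, exists B : R -> R, `|x - x0| < rr -> B y0 = 0 /\
    forall y, y0 - r < y < y0 + r -> is_derive y 1 B (b (pt x y)).
  move=> x; have [hx|hx] := boolP (`|x - x0| < rr); last by exists (fun=> 0).
  have [|y /small hy|B HB] := @antiderivative (fun y => b (pt x y)) (y0 - r) (y0 + r).
  - by rewrite ltrD2l gtrN.
  - by apply: cont_pt1; apply/db/inU/Upt.
  exists (fun y => B y - B y0) => _; split; first by rewrite subrr.
  move=> y hy; have := is_deriveB (HB y hy) (is_derive_cst (B y0) y 1).
  by rewrite subr0.
move=> /choice[B HB].
pose v (w : E) := A (w 0 0) + B (w 0 0) (w 0 1).
have open_r w : box z0 r w -> (x0 - r < w 0 0 < x0 + r) /\ (y0 - r < w 0 1 < y0 + r).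
  by move=> [h0 h1]; rewrite -!ltr_distl.
have Vrr w : box z0 r w -> box z0 rr w by exact/box_le/ltW.
have v1 w : box z0 r w -> is_derive w (delta_mx 0 1) (v : E -> R^o) (b w).
  move=> Vw; have [[wx _] [_ wy]] := (Vrr _ Vw, open_r _ Vw).
  rewrite -[w]ptE; apply: is_derive_pt1.
  have [_ HB1] := HB _ wx.
  have := is_deriveD (is_derive_cst (A (w 0 0)) (w 0 1) 1) (HB1 _ wy).
  rewrite add0r; congr (is_derive _ _ _ _).
  by apply: funext => y; rewrite /v pt0 pt1.
have v0 w : box z0 r w -> is_derive w (delta_mx 0 0) (v : E -> R^o) (a w).
  move=> Vw; have [[wx wy] [wx' wy']] := (Vrr _ Vw, open_r _ Vw).
  rewrite -[w]ptE; apply: is_derive_pt0.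
  set x := w 0 0 in wx wx' *; set y := w 0 1 in wy wy' *.
  suff dB : is_derive x 1 (fun x => B x y) (a (pt x y) - a (pt x y0)).
    have := is_deriveD (HA _ wx') dB.
    rewrite addrCA subrr addr0; congr (is_derive _ _ _ _).
    by apply: funext => t; rewrite /v pt0 pt1.
  have [d /= d0 Hd] : exists2 d, 0 < d & forall h : R, `|h| < d -> `|x + h - x0| < rr.
    exists (rr - `|x - x0|); first by rewrite subr_gt0.
    move=> h hd; rewrite addrAC; apply: le_lt_trans (ler_normD _ _) _.
    by rewrite -ltrBrDl.
  apply: (@is_derive_quad _ _ _ (K * `|y - y0|)).
  apply/nbhs_ballP; exists d => //= h; rewrite /ball /= sub0r normrN => /Hd hh.
  have [B0 HB1] := HB _ wx; have [Bh0 HBh] := HB _ hh.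
  (* [Psi] is [h] times the error of the difference quotient of [B] at height [t]. It vanishes at
     [y0]. Closedness of the form replaces [pd 1 a] by [pd 0 b], so the derivative of [Psi] is a
     first-order Taylor remainder of [b] in the horizontal direction, at most [K * h ^ 2]. *)
  pose Psi t := B (x + h) t - B x t - h * (a (pt x t) - a (pt x y0)).
  have btw t : Num.min y0 y <= t <= Num.max y0 y -> y0 - r < t < y0 + r.
    by rewrite -ltr_distl; apply: btw_dist; rewrite ?subrr ?normr0 // ltr_distl.
  have tiny t : y0 - r < t < y0 + r -> `|t - y0| < rr.
    by move=> /andP[t1 t2]; apply: small; rewrite !ltW.
  have [t /btw ht|c /btw hc] := @MVTu Psi (fun t => b (pt (x + h) t) - b (pt x t) - h * pd 0 b (pt
    x t)) y0 y.
    have Ut : U (pt x t) by apply/inU/Upt => //; exact: tiny.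
    have ha : is_derive t 1 (fun t => a (pt x t)) (pd 0 b (pt x t)).
      by rewrite -ab //; apply: is_derive_pt1_inv; apply: diff_derivable; exact: da.
    have h1 := is_deriveB (HBh _ ht) (HB1 _ ht).
    have h2 := is_deriveB ha (is_derive_cst (a (pt x y0)) t 1).
    have := is_deriveB h1 (is_deriveZ h h2).
    by rewrite subr0.
  have -> : Psi y - Psi y0 = B (x + h) y - B x y - h * (a (pt x y) - a (pt x y0)).
    by rewrite /Psi B0 Bh0 !subrr mulr0 !subr0.
  move=> ->; rewrite normrM [K * _]mulrC -mulrA [leRHS]mulrC.
  apply: ler_wpM2r => //.
  have mid s : Num.min x (x + h) <= s <= Num.max x (x + h) -> `|s - x0| < rr.
    exact: btw_dist.
  have [s /mid hs|s hs] := @MVTu (fun s => b (pt s c)) (fun s => pd 0 b (pt s c)) x (x + h).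
    by apply: is_derive_pt0_inv; apply: diff_derivable; apply/db/inU/Upt => //; exact: tiny.
  have -> : x + h - x = h by ring.
  move=> ->.
  have mid2 s' : Num.min x s <= s' <= Num.max x s -> `|s' - x0| < rr.
    by apply: btw_dist => //; exact: mid.
  have [s' /mid2 hs'|s' /mid2 hs'] := @MVTu (fun s => pd 0 b (pt s c)) (fun s => pd 0 (pd 0 b) (pt
    s c)) x s.
    by apply: is_derive_pt0_inv; apply: diff_derivable; apply/db0/inU/Upt => //; exact: tiny.
  move=> E1; rewrite [X in X - _]mulrC -mulrBr E1.
  rewrite !normrM mulrCA; apply: ler_pM => //; rewrite ?mulr_ge0 //.
    by apply: bK; apply: Upt => //; exact: tiny.
  rewrite -[h ^+ 2]ger0_norm ?sqr_ge0 // expr2 normrM; apply: ler_wpM2l => //.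
  have : `|s - x| <= `|h| by exact: between_dist.
  by [].
exists (box z0 r), v; split.
- exact: open_box.
- exact: box_center.
- by move=> w /Vrr /inU.
- pose g (i : 'I_2) := if i == 0 then a else b.
  have vg i w : box z0 r w -> is_derive w (delta_mx 0 i) (v : E -> R^o) (g i w).
    by elim/ord2_ind: i => Vw; [exact: v0|exact: v1].
  have Cg k i : C k (box z0 r) (g i).
    apply: (@Cn_sub _ _ _ U); first by move=> w /Vrr/inU.
    by elim/ord2_ind: i; [exact: Ca|exact: Cb].
  have dv w : box z0 r w -> dfb v w.
    move=> Vw; exact: (C1_diff (g:=g) (@open_box z0 r) Vw vg (fun i => Cg 0%N i w Vw)).
  have Cv k : C k.+1 (box z0 r) v.
    apply: (@Cn_step _ _ _ _ _ g) => //; first exact: open_box.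
    by move=> i w Vw; apply: derive_val; exact: vg.
  by move=> k; apply: CnS.
- by move=> w Vw; split; apply: derive_val; [exact: v0|exact: v1].
Qed.

End MixedPartialsAndPrimitives.

(** * The inverse function theorem in the plane *)

Section InverseFunction.
Variable R : realType.
Local Notation E := 'rV[R]_2.
Local Notation pd i f := (partial (V := R^o) i f).
Local Notation dfb f z := (differentiable (f : E -> R^o) z).
Local Notation C k U f := (Cn (V := R^o) k U f).

Lemma open_setI_preim (S T : topologicalType) (U : set S) (W : set T) (f : S -> T) :
  open U -> (forall z, U z -> {for z, continuous f}) -> open W ->
  open (U `&` f @^-1` W).
Proof.
move=> oU cf oW; rewrite openE => z [Uz Wfz].
apply: filterI; first exact: open_nbhs_nbhs.
by apply: (cf z Uz); apply: open_nbhs_nbhs.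
Qed.

Lemma cont_row2 (s : E -> E) z :
  (forall j, {for z, continuous (fun w => s w 0 j : R^o)}) -> {for z, continuous s}.
Proof.
move=> cs.
have -> : s = (fun w => s w 0 0 *: (delta_mx 0 0 : E) + s w 0 1 *: (delta_mx 0 1 : E)).
  by apply: funext => w; rewrite -rowE.
apply: (@continuousD R E _ (fun w => s w 0 0 *: (delta_mx 0 0 : E)) (fun w => s w 0 1 *: (delta_mx
  0 1 : E)));
by apply: continuousZr_tmp; exact: cs.
Qed.

Lemma norm_diff2 (z w : E) e : 0 <= e ->
  `|z - w| <= e <-> `|z 0 0 - w 0 0| <= e /\ `|z 0 1 - w 0 1| <= e.
Proof. by move=> e0; rewrite norm_row2 // !mxE. Qed.

Lemma convex_lt (u v r t : R) : 0 <= t <= 1 -> u < r -> v < r -> (1 - t) * u + t * v < r.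
Proof.
move=> /andP[t0 t1] ur vr; apply: (@le_lt_trans _ _ (Num.max u v)); last by rewrite gt_max ur.
have : u <= Num.max u v by rewrite le_max lexx.
have : v <= Num.max u v by rewrite le_max lexx orbT.
by move: (Num.max u v) => m *; nra.
Qed.

Lemma box_convex (z0 : E) r (z h : E) (t : R) : 0 <= t <= 1 -> box z0 r z -> box z0 r (z + h) ->
  box z0 r (z + t *: h).
Proof.
move=> t01 [a0 a1] []; rewrite !mxE => b0 b1.
have /andP[t0 t1] := t01; have t1' : 0 <= 1 - t by rewrite subr_ge0.
split; rewrite !mxE.
  have -> : z 0 0 + t * h 0 0 - z0 0 0 = (1 - t) * (z 0 0 - z0 0 0) + t * (z 0 0 + h 0 0 - z0 0 0)
    by ring.
  apply: le_lt_trans (ler_normD _ _) _; rewrite !normrM (ger0_norm t0) (ger0_norm t1').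
  exact: convex_lt.
have -> : z 0 1 + t * h 0 1 - z0 0 1 = (1 - t) * (z 0 1 - z0 0 1) + t * (z 0 1 + h 0 1 - z0 0 1) by
  ring.
apply: le_lt_trans (ler_normD _ _) _; rewrite !normrM (ger0_norm t0) (ger0_norm t1').
exact: convex_lt.
Qed.

Definition jac (s : E -> E) (z : E) : R :=
  pd 0 (fun w => s w 0 0) z * pd 1 (fun w => s w 0 1) z -
  pd 1 (fun w => s w 0 0) z * pd 0 (fun w => s w 0 1) z.

(** Near [z0] the map [id - s] is a contraction of ratio one half. This gives injectivity and, on a
    closed square, solutions of [s z = w]. Cramer's rule then expresses the partials of the inverse
    through those of [s], which bootstraps its smoothness. *)
Lemma inverse_function_id U (s : E -> E) (z0 : E) : open U -> U z0 ->
  (forall k j, C k U (fun w => s w 0 j)) ->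
  (forall i j, pd i (fun w => s w 0 j) z0 = (i == j)%:R) ->
  exists V W t, [/\ open V /\ open W, V z0 /\ V `<=` U,
    forall z, V z -> W (s z) /\ t (s z) = z,
    forall w, W w -> V (t w) /\ s (t w) = w &
    (forall z, V z -> jac s z != 0) /\ forall k j, C k W (fun w => t w 0 j)].
Proof.
move=> oU Uz0 Cs s1.
have cont_pd i j : {for z0, continuous (pd i (fun w => s w 0 j) : E -> R^o)}.
  by have [_ /(_ i) H] := Cs 1%N j; exact: H.
(* Two partial derivatives control each entry, so a tolerance of one quarter for each gives the
   Lipschitz constant one half. *)
have e4 : 0 < (4^-1 : R) by rewrite invr_gt0.
have Hn i j : \forall z \near z0, `|pd i (fun w => s w 0 j) z - (i == j)%:R| <= 4^-1.
  have := cont_pd i j => /cvgrPdist_le/(_ _ e4); apply: filterS => z.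
  by rewrite s1 distrC.
have Hall : \forall z \near z0, U z /\ (forall i j, `|pd i (fun w => s w 0 j) z - (i == j)%:R| <=
  4^-1).
  apply: filterI; first exact: open_nbhs_nbhs.
  apply: filterS (filterI (filterI (Hn 0 0) (Hn 0 1)) (filterI (Hn 1 0) (Hn 1 1))) => w [[h00 h01]
    [h10 h11]] i j.
  by elim/ord2_ind: i; elim/ord2_ind: j.
have [r r0 Hr] := box_near Hall.
have ds w j : box z0 r w -> dfb (fun w => s w 0 j) w.
  by move=> /Hr[Uw _]; case: (Cs 1%N j) => + _; apply.
have key z h j : box z0 r z -> box z0 r (z + h) ->
    `|s (z + h) 0 j - s z 0 j - h 0 j| <= 2^-1 * `|h|.
  move=> Bz Bzh.
  have [t t01|t t01 ->] := @seg_MVT R (fun w => s w 0 j) z h.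
    by apply: ds; exact: (box_convex t01 Bz Bzh).
  have /Hr[_ Ht] : box z0 r (z + t *: h).
    by apply: box_convex => //; case/andP: t01 => *; rewrite !ltW.
  have [h0 h1] := entry_le_norm h.
  have -> : h 0 j = h 0 0 * (0 == j)%:R + h 0 1 * (1 == j)%:R.
    by elim/ord2_ind: j {Ht}; rewrite /= !(mulr1, mulr0) ?addr0 ?add0r.
  have := Ht 0 j; have := Ht 1 j.
  move: (pd 0 _ _) (pd 1 _ _) ((0 == j)%:R) ((1 == j)%:R) => p0 p1 d0 d1 Hp1 Hp0.
  have -> : h 0 0 * p0 + h 0 1 * p1 - (h 0 0 * d0 + h 0 1 * d1) = h 0 0 * (p0 - d0) + h 0 1 * (p1 -
    d1) by ring.
  apply: le_trans (ler_normD _ _) _; rewrite !normrM.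
  have -> : 2^-1 * `|h| = `|h| * 4^-1 + `|h| * 4^-1 by field.
  by apply: lerD; apply: ler_pM.
have keyz z z' : box z0 r z -> box z0 r z' -> `|(z' - s z') - (z - s z)| <= 2^-1 * `|z' - z|.
  move=> Bz Bz'; have zE : z' = z + (z' - z) by rewrite addrC subrK.
  apply/norm_row2; first by rewrite mulr_ge0.
  have := @key z (z' - z) _ Bz; rewrite -zE => H.
  have := H 0 Bz'; have := H 1 Bz'.
  rewrite !mxE => H1 H0; split.
    by rewrite (_ : _ - _ - _ = - (s z' 0 0 - s z 0 0 - (z' 0 0 - z 0 0))) ?normrN //; ring.
  by rewrite (_ : _ - _ - _ = - (s z' 0 1 - s z 0 1 - (z' 0 1 - z 0 1))) ?normrN //; ring.
have expand z z' : box z0 r z -> box z0 r z' -> `|z' - z| <= 2 * `|s z' - s z|.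
  move=> Bz Bz'; have := keyz _ _ Bz Bz'.
  have E1 : z' - z = (z' - s z' - (z - s z)) + (s z' - s z).
    by apply/rowP => j; rewrite !mxE; ring.
  have := ler_normD (z' - s z' - (z - s z)) (s z' - s z); rewrite -E1.
  lra.
pose rho := r / 2; have rho0 : 0 < rho by rewrite divr_gt0.
have rhor : rho < r by rewrite /rho ltr_pdivrMr // mulr2n mulrDr mulr1 ltrDl.
pose B : set E := cbox z0 rho.
have BE z : B z <-> `|z - z0| <= rho by rewrite norm_diff2 // ltW.
have Bbox z : B z -> box z0 r z.
  by move=> [h0 h1]; split; exact: le_lt_trans rhor.
have Bz0 : B z0 by apply/BE; rewrite subrr normr0 ltW.
have surj w : `|s z0 - w| < rho / 8 -> exists2 z, box z0 rho z & s z = w.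
  move=> hw; pose f z := z - s z + w.
  have fB : set_fun B B f.
    move=> z Bz; apply/BE.
    have -> : f z - z0 = (z - s z - (z0 - s z0)) - (s z0 - w).
      by apply/rowP => j; rewrite !mxE; ring.
    have := keyz _ _ (Bbox _ Bz0) (Bbox _ Bz).
    move/BE: Bz => Bz.
    have := ler_normB (z - s z - (z0 - s z0)) (s z0 - w).
    move: `|z - _ - _| `|_ - _ - (_ - _)| `|z - z0| `|s z0 - w| hw Bz => *; lra.
  have cf z : B z -> {for z, continuous (fun z => `|f z - z|)}.
    move=> /Bbox Bz.
    have cs' : {for z, continuous s} by apply: cont_row2 => j; apply: differentiable_continuous;
      exact: ds.
    have -> : (fun z => `|f z - z|) = (fun z => `|w - s z|).
      by apply: funext => x; congr (`|_|); rewrite /f; apply/rowP => j; rewrite !mxE; ring.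
    apply: continuous_comp; last exact: norm_continuous.
    have cw : {for z, continuous (fun=> w : E)} := @cst_continuous E E w z.
    exact: (cvgB cw cs').
  have [|||z /set_mem Bz zmin] := @EVT_min_rV R 2 (fun z => `|f z - z|) B.
  - by exists z0.
  - exact: compact_cbox.
  - by apply: continuous_in_subspaceT => z /set_mem; exact: cf.
  have zE : f z = z.
    apply/eqP; rewrite -subr_eq0 -normr_le0.
    have fz := fB z Bz.
    have := zmin (f z) (mem_set fz).
    have -> : f (f z) - f z = (f z - s (f z)) - (z - s z).
      by rewrite {2}/f {3}/f; apply/rowP => j; rewrite !mxE; ring.
    have := keyz _ _ (Bbox _ Bz) (Bbox _ fz).
    by move: `|f z - z| `|_ - _| => *; lra.
  have sz : s z = w.
    by move: zE => /(congr1 (fun u => z - u + w)); rewrite /f => /rowP H; apply/rowP => j;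
      have := H j; rewrite !mxE; lra.
  exists z => //.
  have := expand _ _ (Bbox _ Bz0) (Bbox _ Bz); rewrite sz => Hz.
  have /norm_diff2 : `|z - z0| <= rho / 4.
    by apply: le_trans Hz _; rewrite distrC; move: hw; lra.
  case; first by rewrite divr_ge0 // ltW.
  by move=> h0 h1; split; [apply: le_lt_trans h0 _|apply: le_lt_trans h1 _]; lra.
pose W : set E := [set w | `|s z0 - w| < rho / 8].
have oW : open W.
  have -> : W = ball (s z0) (rho / 8) by rewrite -ball_normE.
  exact: ball_open.
have : forall w, exists z, W w -> box z0 rho z /\ s z = w.
  move=> w; have [Ww|nW] := pselect (W w); last by exists 0.
  by have [z Bz zE] := surj w Ww; exists z.
move=> /choice[t Ht].
pose V := box z0 rho `&` s @^-1` W.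
have boxr z : box z0 rho z -> box z0 r z by exact/box_le/ltW.
have cs z : box z0 rho z -> {for z, continuous s}.
  move=> /boxr Bz; apply: cont_row2 => j.
  by apply: differentiable_continuous; exact: ds.
have oV : open V by apply: open_setI_preim => //; exact: open_box.
have inj z z' : box z0 r z -> box z0 r z' -> s z = s z' -> z = z'.
  move=> Bz Bz' ss; have := expand _ _ Bz' Bz; rewrite ss subrr normr0 mulr0 normr_le0.
  by rewrite subr_eq0 => /eqP.
have ts z : V z -> t (s z) = z.
  move=> [Bz Wz]; have [Bt st] := Ht _ Wz.
  by apply: inj; rewrite ?st //; exact: boxr.
have st w : W w -> V (t w) /\ s (t w) = w.
  by move=> Ww; have [Bt st] := Ht _ Ww; split => //; split => //=; rewrite st.
have jac0 z : V z -> jac s z != 0.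
  move=> [/boxr/Hr[_ H] _]; rewrite /jac.
  have := H 0 0; have := H 0 1; have := H 1 0; have := H 1 1; rewrite /= !subr0.
  move: (pd 0 _ _) (pd 1 _ _) (pd 1 _ _) (pd 0 _ _) => a d b c.
  rewrite !ler_norml => /andP[d1 d2] /andP[b1 b2] /andP[c1 c2] /andP[a1 a2].
  by rewrite gt_eqF //; nra.
(* The displacements of [w] and of [t w] satisfy the linearised equation up to a small multiple of
   the displacement of [w], thanks to [expand]; the adjugate divided by the Jacobian solves it. *)
have dt w : W w -> [/\ forall j, dfb (fun w => t w 0 j) w,
   pd 0 (fun w => t w 0 0) w = pd 1 (fun w => s w 0 1) (t w) / jac s (t w),
   pd 1 (fun w => t w 0 0) w = - pd 1 (fun w => s w 0 0) (t w) / jac s (t w),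
   pd 0 (fun w => t w 0 1) w = - pd 0 (fun w => s w 0 1) (t w) / jac s (t w) &
   pd 1 (fun w => t w 0 1) w = pd 0 (fun w => s w 0 0) (t w) / jac s (t w)].
  move=> Ww; have [Vt stw] := st _ Ww.
  have Bt : box z0 r (t w) by apply: boxr; case: Vt.
  set z := t w in Vt stw Bt *.
  have := jac0 z Vt; rewrite /jac.
  have D0 := diff2_eps_inv (@ds z 0 Bt); have D1 := diff2_eps_inv (@ds z 1 Bt).
  move: D0 D1.
  move: (pd 0 (fun w => s w 0 0) z) (pd 1 (fun w => s w 0 0) z) (pd 0 (fun w => s w 0 1) z) (pd 1
    (fun w => s w 0 1) z) => a b c d D0 D1.
  set J := a * d - b * c => J0.
  have tcont : forall e, 0 < e -> \forall k \near (0 : E), W (k + w) /\ (`|t (k + w) - z| < e /\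
    `|t (k + w) - z| <= 2 * `|k|).
    move=> e e0.
    have near1 : \forall k \near (0 : E), W (k + w).
      have : \forall w' \near w, W w' by apply: open_nbhs_nbhs.
      by rewrite (near_shift 0 w) /=; apply: filterS => h; rewrite /= subr0.
    have near2 : \forall k \near (0 : E), `|k| < e / 2.
      by apply/nbhs0_lt; rewrite divr_gt0.
    apply: filterS2 near1 near2 => k Wk ke; split => //.
    have [Vk sk] := st _ Wk.
    have Bk : box z0 r (t (k + w)) by apply: boxr; case: Vk.
    have := expand _ _ Bt Bk; rewrite sk stw addrK => H; split => //.
    by apply: le_lt_trans H _; rewrite mulrC -ltr_pdivlMr.
  pose Q e (k : E) := exists R0 R1 : R,
     [/\ `|R0| <= e * `|k|, `|R1| <= e * `|k|,
        k 0 0 = R0 + (a * (t (k + w) - z) 0 0 + b * (t (k + w) - z) 0 1) &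
        k 0 1 = R1 + (c * (t (k + w) - z) 0 0 + d * (t (k + w) - z) 0 1)].
  have main e : 0 < e -> \forall k \near (0 : E), Q e k.
    move=> e0; have e20 : 0 < e / 2 by rewrite divr_gt0.
    have /nbhs_ballP[d0 /= d00 Hd0] := D0 _ e20.
    have /nbhs_ballP[d1 /= d10 Hd1] := D1 _ e20.
    have dm : 0 < Num.min d0 d1 by rewrite lt_min d00.
    apply: filterS (tcont _ dm) => k [Wk [+ tk]]; rewrite lt_min => /andP[k0 k1].
    have [_ sk] := st _ Wk.
    set h := t (k + w) - z in tk k0 k1 *.
    have hz : h + z = t (k + w) by rewrite /h subrK.
    have bh (dd : R) : `|h| < dd -> ball (0 : E) dd h by rewrite -ball_normE /= sub0r normrN.
    have kw j : (k + w) 0 j - w 0 j = k 0 j by rewrite mxE addrK.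
    have := Hd0 _ (bh _ k0); have := Hd1 _ (bh _ k1); rewrite hz sk stw !kw.
    move=> H1 H0.
    have he : e / 2 * `|h| <= e * `|k|.
      have -> : e * `|k| = e / 2 * (2 * `|k|) by field.
      by apply: ler_wpM2l => //; exact: ltW.
    exists (k 0 0 - (h 0 0 * a + h 0 1 * b)), (k 0 1 - (h 0 0 * c + h 0 1 * d)); split.
    - exact: le_trans H0 he.
    - exact: le_trans H1 he.
    - by rewrite /h !mxE; ring.
    - by rewrite /h !mxE; ring.
  have bnd (x y R0 R1 u e : R) : `|R0| <= (e * `|J| / (1 + `|x| + `|y|)) * u -> `|R1| <= (e * `|J|
    / (1 + `|x| + `|y|)) * u ->
     0 <= u -> 0 < e -> `|(x * R0 + y * R1) / J| <= e * u.
    move=> H0 H1 u0 e0.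
    rewrite normrM normfV ler_pdivrMr ?normr_gt0 //.
    apply: le_trans (ler_normD _ _) _; rewrite !normrM.
    have n0 : 0 < 1 + `|x| + `|y| by rewrite -addrA ltr_pwDl // addr_ge0.
    have -> : e * u * `|J| = (1 + `|x| + `|y|) * (e * `|J| / (1 + `|x| + `|y|) * u) by field;
      rewrite gt_eqF.
    set q := e * `|J| / _ * u in H0 H1 *.
    have q0 : 0 <= q by exact: le_trans H0.
    have := ler_wpM2l (normr_ge0 x) H0; have := ler_wpM2l (normr_ge0 y) H1.
    by move=> G1 G0; rewrite !mulrDl mul1r -addrA ler_wpDl // lerD.
  have epos (x y e : R) : 0 < e -> 0 < e * `|J| / (1 + `|x| + `|y|).
    by move=> e0; rewrite divr_gt0 ?mulr_gt0 ?normr_gt0 // -addrA ltr_pwDl // addr_ge0.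
  have [|d00 p00 p10] := @diff2_eps R (fun w => t w 0 0) w (d / J) (- b / J).
    move=> e e0; apply: filterS (main _ (epos d (- b) e e0)) => k [R0 [R1 [H0 H1 k0 k1]]].
    have -> : t (k + w) 0 0 - t w 0 0 - (k 0 0 * (d / J) + k 0 1 * (- b / J)) = - ((d * R0 + - b *
      R1) / J).
      by rewrite k0 k1 !mxE /J; field.
    by rewrite normrN; exact: bnd H0 H1 (normr_ge0 _) e0.
  have [|d11 p01 p11] := @diff2_eps R (fun w => t w 0 1) w (- c / J) (a / J).
    move=> e e0; apply: filterS (main _ (epos (- c) a e e0)) => k [R0 [R1 [H0 H1 k0 k1]]].
    have -> : t (k + w) 0 1 - t w 0 1 - (k 0 0 * (- c / J) + k 0 1 * (a / J)) = - ((- c * R0 + a *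
      R1) / J).
      by rewrite k0 k1 !mxE /J; field.
    by rewrite normrN; exact: bnd H0 H1 (normr_ge0 _) e0.
  by split=> //; apply: ord2_ind.
exists V, W, t; split => //.
- split; last by move=> z [/boxr/Hr[]].
  split; first exact: box_center.
  by rewrite /= /W /= subrr normr0 divr_gt0.
- by move=> z Vz; split; [case: Vz|exact: ts].
split => //.
have Cp k i j : C k V (pd i (fun w => s w 0 j)).
  by apply: (@Cn_sub _ _ _ U) => [z [/boxr/Hr[]] //|]; have [_ H] := Cs k.+1 j; exact: H.
have CJ k : C k V (fun z => (jac s z)^-1).
  apply: C_V => //; rewrite /jac; apply: C_B => //; apply: C_M => //.
(* The partials of [t] are smooth functions on [V] composed with [t], so class [k] of [t] implies
   class [k.+1]. *)
elim=> [|k IH] j.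
  by move=> w Ww; apply: differentiable_continuous; have [H _ _ _ _] := dt w Ww.
have CC g : C k V g -> C k W (fun w => g (t w)).
  by move=> Cg; apply: (@C_comp _ _ W V g t) => // w /st[].
pose g0 (i j : 'I_2) z := if (i == 0) then (if j == 0 then pd 1 (fun w => s w 0 1) z / jac s z else
  - pd 0 (fun w => s w 0 1) z / jac s z)
  else (if j == 0 then - pd 1 (fun w => s w 0 0) z / jac s z else pd 0 (fun w => s w 0 0) z / jac s
    z).
apply: (@Cn_step _ _ _ _ _ (fun i w => g0 i j (t w))) => //.
- by move=> w Ww; have [H _ _ _ _] := dt w Ww.
- move=> i w Ww; have [_ H0 H1 H2 H3] := dt w Ww.
  by elim/ord2_ind: i; elim/ord2_ind: j; rewrite /g0 /=.
- move=> i; apply: CC.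
  by elim/ord2_ind: i; elim/ord2_ind: j; rewrite /g0 /=; apply: C_M => //; apply: C_N.
Qed.

Lemma C_lin k U (f g : E -> R) (al be : R) : open U -> C k U f -> C k U g ->
  C k U (fun w => al * f w + be * g w).
Proof.
by move=> oU Hf Hg; apply: C_D => //; apply: C_M => //; exact: C_cst.
Qed.

Lemma partial_lin i (f g : E -> R) (al be : R) z : dfb f z -> dfb g z ->
  pd i (fun w => al * f w + be * g w) z = al * pd i f z + be * pd i g z.
Proof.
move=> df dg; have dc c : dfb (fun=> c) z := differentiable_cst (c : R^o) z.
rewrite partialD; try exact: differentiableM.
by rewrite !partialM // !partialC !mul0r !add0r.
Qed.

(** Following [s] by the inverse [l] of its differential at [z0] reduces to the normalised case; [l]
    is linear and injective, so the conclusions transfer back. *)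
Theorem inverse_function U (s : E -> E) (z0 : E) : open U -> U z0 ->
  (forall k j, C k U (fun w => s w 0 j)) -> jac s z0 != 0 ->
  exists V W t, [/\ open V /\ open W, V z0 /\ V `<=` U,
    forall z, V z -> W (s z) /\ t (s z) = z,
    forall w, W w -> V (t w) /\ s (t w) = w &
    (forall z, V z -> jac s z != 0) /\ forall k j, C k W (fun w => t w 0 j)].
Proof.
move=> oU Uz0 Cs; rewrite /jac.
move Ea : (pd 0 (fun w => s w 0 0) z0) => a.
move Eb : (pd 1 (fun w => s w 0 0) z0) => b.
move Ec : (pd 0 (fun w => s w 0 1) z0) => c.
move Ed : (pd 1 (fun w => s w 0 1) z0) => d.
set J := a * d - b * c => J0.
pose l (w : E) := pt (d / J * w 0 0 + (- b / J) * w 0 1) (- c / J * w 0 0 + a / J * w 0 1).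
pose p z := l (s z).
have p0 : (fun w => p w 0 0) = (fun w => d / J * s w 0 0 + (- b / J) * s w 0 1).
  by apply: funext => w; rewrite pt0.
have p1 : (fun w => p w 0 1) = (fun w => - c / J * s w 0 0 + a / J * s w 0 1).
  by apply: funext => w; rewrite pt1.
have ds j z : U z -> dfb (fun w => s w 0 j) z by case: (Cs 1%N j) => + _; apply.
have pp0 i z : U z -> pd i (fun w => p w 0 0) z = d / J * pd i (fun w => s w 0 0) z + (- b / J) *
  pd i (fun w => s w 0 1) z.
  by move=> Uz; rewrite p0 partial_lin //; exact: ds.
have pp1 i z : U z -> pd i (fun w => p w 0 1) z = - c / J * pd i (fun w => s w 0 0) z + a / J * pd
  i (fun w => s w 0 1) z.
  by move=> Uz; rewrite p1 partial_lin //; exact: ds.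
have Cp k j : C k U (fun w => p w 0 j).
  by elim/ord2_ind: j; rewrite ?p0 ?p1; apply: C_lin.
have pI i j : pd i (fun w => p w 0 j) z0 = (i == j)%:R.
  elim/ord2_ind: j; rewrite ?pp0 ?pp1 //; elim/ord2_ind: i; rewrite ?Ea ?Eb ?Ec ?Ed /J /=; field;
    exact: J0.
have [V [W [t [[oV oW] [Vz0 VU] h1 h2 [h3 h4]]]]] := inverse_function_id oU Uz0 Cp pI.
have Cl k j : C k setT (fun w => l w 0 j).
  elim/ord2_ind: j.
    have -> : (fun w => l w 0 0) = (fun w => d / J * w 0 0 + (- b / J) * w 0 1) by apply: funext =>
      w; rewrite pt0.
    by apply: C_lin; [exact: openT|exact: C_coord|exact: C_coord].
  have -> : (fun w => l w 0 1) = (fun w => - c / J * w 0 0 + a / J * w 0 1) by apply: funext => w;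
    rewrite pt1.
  by apply: C_lin; [exact: openT|exact: C_coord|exact: C_coord].
have linj u v : l u = l v -> u = v.
  move=> luv; have E0 := congr1 (fun x : E => x 0 0) luv;
    have E1 := congr1 (fun x : E => x 0 1) luv.
  move: E0 E1; rewrite /= !pt0 !pt1 => E0 E1.
  have F (x : E) : x 0 0 = a * (d / J * x 0 0 + - b / J * x 0 1) + b * (- c / J * x 0 0 + a / J * x
    0 1).
    by rewrite /J; field; exact: J0.
  have G (x : E) : x 0 1 = c * (d / J * x 0 0 + - b / J * x 0 1) + d * (- c / J * x 0 0 + a / J * x
    0 1).
    by rewrite /J; field; exact: J0.
  by apply: rowP2; [rewrite F (F v) E0 E1|rewrite G (G v) E0 E1].
exists V, (l @^-1` W), (fun w => t (l w)).
have oL : open (l @^-1` W).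
  rewrite -[l @^-1` W]setTI; apply: open_setI_preim => //; first exact: openT.
  by move=> z _; apply: cont_row2 => j; exact: (Cl 0%N).
split.
- by split.
- by split.
- by move=> z /h1.
- move=> w Ww; have [Vt pt] := h2 (l w) Ww.
  by split => //; exact: linj.
split.
  move=> z Vz; apply: contraNneq (h3 z Vz) => js.
  rewrite /jac !pp0 ?pp1; try exact: VU.
  move: js; rewrite /jac.
  move: (pd 0 _ z) (pd 1 _ z) (pd 1 _ z) (pd 0 _ z) => x y u v xy.
  apply/eqP; transitivity ((v * u - y * x) / J); last by rewrite xy mul0r.
  by rewrite /J; field; exact: J0.
move=> k j; apply: (@C_comp R k _ W (fun w => t w 0 j) l) => //.
by move=> i; apply: (@Cn_sub _ _ _ setT).
Qed.

End InverseFunction.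

(** * Complex differentiability and unique continuation *)

Section HolomorphicFunctions.
Variable R : realType.
Local Notation E := 'rV[R]_2.
Local Notation pd i f := (partial (V := R^o) i f).
Local Notation dfb f z := (differentiable (f : E -> R^o) z).
Local Notation C k U f := (Cn (V := R^o) k U f).
Local Notation Re := complex.Re.
Local Notation Im := complex.Im.
Local Notation cx := (R[i]).

(** * Real and imaginary parts, and the rules of complex differentiation *)

Lemma cplx_eq (x y : cx) : Re x = Re y -> Im x = Im y -> x = y.
Proof. by case: x y => [a b] [c d] /= -> ->. Qed.

Lemma cReM (x y : cx) : Re (x * y) = Re x * Re y - Im x * Im y.
Proof. by case: x y => [a b] [c d]. Qed.
Lemma cImM (x y : cx) : Im (x * y) = Re x * Im y + Im x * Re y.
Proof. by case: x y => [a b] [c d]. Qed.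
Lemma cReD (x y : cx) : Re (x + y) = Re x + Re y.
Proof. by case: x y => [a b] [c d]. Qed.
Lemma cImD (x y : cx) : Im (x + y) = Im x + Im y.
Proof. by case: x y => [a b] [c d]. Qed.
Lemma cReN (x : cx) : Re (- x) = - Re x.
Proof. by case: x. Qed.
Lemma cImN (x : cx) : Im (- x) = - Im x.
Proof. by case: x. Qed.
Lemma cReV (x : cx) : Re x^-1 = Re x / (Re x ^+ 2 + Im x ^+ 2).
Proof. by case: x. Qed.
Lemma cImV (x : cx) : Im x^-1 = - Im x / (Re x ^+ 2 + Im x ^+ 2).
Proof. by case: x => a b /=; rewrite mulNr. Qed.
Lemma cRei : Re ('i : cx) = 0. Proof. by []. Qed.
Lemma cImi : Im ('i : cx) = 1. Proof. by []. Qed.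
Lemma cRe0 : Re (0 : cx) = 0. Proof. by []. Qed.
Lemma cIm0 : Im (0 : cx) = 0. Proof. by []. Qed.
Lemma cRe1 : Re (1 : cx) = 1. Proof. by []. Qed.
Lemma cIm1 : Im (1 : cx) = 0. Proof. by []. Qed.
Lemma cRen n : Re (n%:R : cx) = n%:R.
Proof. by elim: n => // n IH; rewrite !mulrSr cReD IH. Qed.
Lemma cImn n : Im (n%:R : cx) = 0.
Proof. by elim: n => // n IH; rewrite !mulrSr cImD IH addr0. Qed.
Definition cE := (cReM, cImM, cReD, cImD, cReN, cImN, cRei, cImi, cRe0, cIm0, cRe1, cIm1, cRen,
  cImn).

Lemma sqr_i : ('i : cx) ^+ 2 = -1.
Proof. by apply: cplx_eq; rewrite expr2 !cE; ring. Qed.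

Lemma normsq_eq0 (x : cx) : (Re x ^+ 2 + Im x ^+ 2 == 0) = (x == 0).
Proof.
apply/eqP/eqP => [|->]; last by rewrite cRe0 cIm0 expr0n /= addr0.
move/eqP; rewrite paddr_eq0 ?sqr_ge0 // !sqrf_eq0 => /andP[/eqP a /eqP b].
exact: cplx_eq.
Qed.

Definition cdiff (f : E -> cx) z := dfb (fun w => Re (f w)) z /\ dfb (fun w => Im (f w)) z.

Lemma cpartial_near i (f g : E -> cx) z : (\forall w \near z, f w = g w) ->
  cpartial i f z = cpartial i g z.
Proof.
move=> fg; rewrite /cpartial; congr Complex; apply: near_partial;
by apply: filterS fg => w ->.
Qed.

Lemma dz_near (f g : E -> cx) z : (\forall w \near z, f w = g w) -> dz f z = dz g z.
Proof. by move=> fg; rewrite /dz !(cpartial_near _ fg). Qed.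

Lemma cdiff_near (f g : E -> cx) z : (\forall w \near z, f w = g w) -> cdiff f z -> cdiff g z.
Proof.
move=> fg [d1 d2]; split; [apply: near_differentiable d1|apply: near_differentiable d2];
by apply: filterS fg => w ->.
Qed.

Lemma cdiffC (c : cx) z : cdiff (fun=> c) z.
Proof. by split; exact: differentiable_cst. Qed.
Lemma cpartialC i (c : cx) z : cpartial i (fun=> c) z = 0.
Proof. by rewrite /cpartial !partialC. Qed.

Lemma cdiffD (f g : E -> cx) z : cdiff f z -> cdiff g z -> cdiff (fun w => f w + g w) z.
Proof.
move=> [a b] [c d]; split.
  have -> : (fun w => Re (f w + g w)) = (fun w => Re (f w) + Re (g w)) by apply: funext => w;
    rewrite cReD.
  exact: differentiableD.
have -> : (fun w => Im (f w + g w)) = (fun w => Im (f w) + Im (g w)) by apply: funext => w;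
  rewrite cImD.
exact: differentiableD.
Qed.

Lemma cpartialD i (f g : E -> cx) z : cdiff f z -> cdiff g z ->
  cpartial i (fun w => f w + g w) z = cpartial i f z + cpartial i g z.
Proof.
move=> [a b] [c d]; apply: cplx_eq; rewrite !cE /=.
  have -> : (fun w => Re (f w + g w)) = (fun w => Re (f w) + Re (g w)) by apply: funext => w;
    rewrite cReD.
  by rewrite partialD.
have -> : (fun w => Im (f w + g w)) = (fun w => Im (f w) + Im (g w)) by apply: funext => w;
  rewrite cImD.
by rewrite partialD.
Qed.

Lemma cdiffM (f g : E -> cx) z : cdiff f z -> cdiff g z -> cdiff (fun w => f w * g w) z.
Proof.
move=> [a b] [c d]; split.
  have -> : (fun w => Re (f w * g w)) = (fun w => Re (f w) * Re (g w) - Im (f w) * Im (g w)) by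
    apply: funext => w; rewrite cReM.
  by apply: differentiableB; exact: differentiableM.
have -> : (fun w => Im (f w * g w)) = (fun w => Re (f w) * Im (g w) + Im (f w) * Re (g w)) by
  apply: funext => w; rewrite cImM.
by apply: differentiableD; exact: differentiableM.
Qed.

Lemma cpartialM i (f g : E -> cx) z : cdiff f z -> cdiff g z ->
  cpartial i (fun w => f w * g w) z = cpartial i f z * g z + f z * cpartial i g z.
Proof.
move=> [a b] [c d]; apply: cplx_eq; rewrite !cE /=.
  have -> : (fun w => Re (f w * g w)) = (fun w => Re (f w) * Re (g w) - Im (f w) * Im (g w)) by
    apply: funext => w; rewrite cReM.
  by rewrite partialB ?partialM //; [ring|exact: differentiableM|exact: differentiableM].
have -> : (fun w => Im (f w * g w)) = (fun w => Re (f w) * Im (g w) + Im (f w) * Re (g w)) by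
  apply: funext => w; rewrite cImM.
by rewrite partialD ?partialM //; [ring|exact: differentiableM|exact: differentiableM].
Qed.

Lemma diff_sqr (f : E -> R) z : dfb f z -> dfb (fun w => f w ^+ 2) z.
Proof.
move=> df; have -> : (fun w => f w ^+ 2) = (fun w => f w * f w) by apply: funext => w;
  rewrite expr2.
exact: differentiableM.
Qed.

Lemma cdiff_neq0 (f : E -> cx) z : cdiff f z -> f z != 0 -> \forall w \near z, f w != 0.
Proof.
move=> [a b] fz.
have : {for z, continuous (fun w => Re (f w) ^+ 2 + Im (f w) ^+ 2 : R^o)}.
  by apply: differentiable_continuous; apply: differentiableD; exact: diff_sqr.
have n0 : Re (f z) ^+ 2 + Im (f z) ^+ 2 != 0 by rewrite normsq_eq0.
have np : 0 < Re (f z) ^+ 2 + Im (f z) ^+ 2 by rewrite lt0r n0 addr_ge0 ?sqr_ge0.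
move=> /cvgrPdist_lt/(_ _ np); apply: filterS => w.
rewrite -normsq_eq0; apply: contraTneq => ->.
by rewrite subr0 gtr0_norm // ltxx.
Qed.

Lemma cdiffV (f : E -> cx) z : cdiff f z -> f z != 0 -> cdiff (fun w => (f w)^-1) z.
Proof.
move=> [a b] fz.
have n0 : Re (f z) ^+ 2 + Im (f z) ^+ 2 != 0 by rewrite normsq_eq0.
have dn : dfb (fun w => Re (f w) ^+ 2 + Im (f w) ^+ 2) z.
  by apply: differentiableD; exact: diff_sqr.
split.
  have -> : (fun w => Re (f w)^-1) = (fun w => Re (f w) / (Re (f w) ^+ 2 + Im (f w) ^+ 2)) by
    apply: funext => w; rewrite cReV.
  by apply: differentiableM => //; exact: differentiableV.
have -> : (fun w => Im (f w)^-1) = (fun w => - Im (f w) / (Re (f w) ^+ 2 + Im (f w) ^+ 2)) by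
  apply: funext => w; rewrite cImV.
by apply: differentiableM; [exact: differentiableN|exact: differentiableV].
Qed.

(** Obtained by differentiating the product of [f] and its inverse, which is constant near [z]. *)
Lemma cpartialV i (f : E -> cx) z : cdiff f z -> f z != 0 ->
  cpartial i (fun w => (f w)^-1) z = - cpartial i f z / f z ^+ 2.
Proof.
move=> df fz; have := cpartialM i df (cdiffV df fz).
rewrite (@cpartial_near i _ (fun=> 1)) ?cpartialC => [H|].
  apply: (mulfI fz); rewrite [RHS](_ : _ = - (cpartial i f z / f z)); last by field.
  by apply/eqP; rewrite -addr_eq0 addrC -H.
by apply: filterS (cdiff_neq0 df fz) => w fw; rewrite mulfV.
Qed.

(* [cder f z d]: [f] is complex differentiable at [z], with derivative [d]. *)
Definition cder (f : E -> cx) z (d : cx) :=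
  [/\ cdiff f z, cpartial 0 f z = d & cpartial 1 f z = 'i * d].

Lemma cder_dz f z d : cder f z d -> dz f z = d.
Proof.
move=> [_ h0 h1]; rewrite /dz h0 h1.
have -> : d - 'i * ('i * d) = d * (1 - 'i ^+ 2) by ring.
by rewrite sqr_i opprK mulfK // pnatr_eq0.
Qed.

Lemma cder_near f g z d : (\forall w \near z, f w = g w) -> cder f z d -> cder g z d.
Proof.
move=> fg [df h0 h1]; split; first exact: cdiff_near df.
- by rewrite -h0; symmetry; exact: cpartial_near.
- by rewrite -h1; symmetry; exact: cpartial_near.
Qed.

Lemma cder_eq f z d d' : cder f z d -> d = d' -> cder f z d'.
Proof. by move=> ? <-. Qed.

Lemma cderC c z : cder (fun=> c) z 0.
Proof. by split; rewrite ?cpartialC ?mulr0 //; exact: cdiffC. Qed.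

Lemma cderD f g z a b : cder f z a -> cder g z b -> cder (fun w => f w + g w) z (a + b).
Proof.
move=> [df f0 f1] [dg g0 g1]; split; first exact: cdiffD.
- by rewrite cpartialD // f0 g0.
- by rewrite cpartialD // f1 g1 mulrDr.
Qed.

Lemma cderM f g z a b : cder f z a -> cder g z b ->
  cder (fun w => f w * g w) z (a * g z + f z * b).
Proof.
move=> [df f0 f1] [dg g0 g1]; split; first exact: cdiffM.
- by rewrite cpartialM // f0 g0.
- by rewrite cpartialM // f1 g1; ring.
Qed.

Lemma cderN f z a : cder f z a -> cder (fun w => - f w) z (- a).
Proof.
move=> H; have -> : (fun w => - f w) = (fun w => -1 * f w).
  by apply: funext => w; rewrite mulN1r.
by apply: cder_eq (cderM (cderC (-1) z) H) _; rewrite mul0r add0r mulN1r.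
Qed.

Lemma cderB f g z a b : cder f z a -> cder g z b -> cder (fun w => f w - g w) z (a - b).
Proof. by move=> Hf Hg; apply: cderD => //; exact: cderN. Qed.

Lemma cderV f z a : cder f z a -> f z != 0 -> cder (fun w => (f w)^-1) z (- a / f z ^+ 2).
Proof.
move=> [df f0 f1] fz; split; first exact: cdiffV.
- by rewrite cpartialV // f0.
- by rewrite cpartialV // f1; ring.
Qed.

Lemma cder_div f g z a b : cder f z a -> cder g z b -> g z != 0 ->
  cder (fun w => f w / g w) z ((a * g z - f z * b) / g z ^+ 2).
Proof.
move=> Hf Hg gz; apply: cder_eq (cderM Hf (cderV Hg gz)) _.
by field.
Qed.

(** [chol k] asks for [k] successive complex derivatives, and [chol 0] for nothing. Requiring all
    [k] in [hol] makes holomorphy stable under [dz] by definition, without recourse to an integral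
    formula. *)
Fixpoint chol k (U : set E) (f : E -> cx) : Prop :=
  if k is k'.+1 then (forall z, U z -> cder f z (dz f z)) /\ chol k' U (dz f) else True.
Definition hol (U : set E) f := forall k, chol k U f.

Lemma hol_cder U f z : hol U f -> U z -> cder f z (dz f z).
Proof. by move=> /(_ 1%N)[H _]; exact: H. Qed.

Lemma hol_dz U f : hol U f -> hol U (dz f).
Proof. by move=> H k; have [] := H k.+1. Qed.

Lemma hol_iter U f k : hol U f -> hol U (iter k (@dz R) f).
Proof. by move=> H; elim: k => //= k IH; exact: hol_dz. Qed.

Lemma chol_ext k U f g : open U -> (forall z, U z -> f z = g z) -> chol k U f -> chol k U g.
Proof.
move=> oU; elim: k f g => [//|k IH] f g fg [df Hf].
have fgd z : U z -> dz f z = dz g z.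
  by move=> Uz; apply: dz_near; exact: (open_near oU Uz fg).
split; last exact: IH Hf.
move=> z Uz; rewrite -fgd //; apply: cder_near (df z Uz); exact: (open_near oU Uz fg).
Qed.

Lemma hol_ext U f g : open U -> (forall z, U z -> f z = g z) -> hol U f -> hol U g.
Proof. by move=> oU fg Hf k; exact: chol_ext (Hf k). Qed.

Lemma chol_sub k U V f : V `<=` U -> chol k U f -> chol k V f.
Proof.
move=> sV; elim: k f => //= k IH f [df Hf]; split; last exact: IH.
by move=> z /sV; exact: df.
Qed.

Lemma hol_sub U V f : V `<=` U -> hol U f -> hol V f.
Proof. by move=> sV H k; exact: chol_sub (H k). Qed.

Lemma cholS k U f : chol k.+1 U f -> chol k U f.
Proof. by elim: k f => // k IH f [df Hf]; split => //; exact: IH. Qed.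

Lemma chol_step k U f g : open U -> (forall z, U z -> cder f z (g z)) -> chol k U g ->
  chol k.+1 U f.
Proof.
move=> oU df Hg; split.
  by move=> z Uz; rewrite (cder_dz (df z Uz)); exact: df.
by apply: chol_ext Hg => // z Uz; rewrite (cder_dz (df z Uz)).
Qed.

Lemma holC U c : open U -> hol U (fun=> c).
Proof.
move=> oU k; elim: k c => // k IH c.
by apply: (@chol_step _ _ _ (fun=> 0)) => // z _; exact: cderC.
Qed.

Lemma cholD k U f g : open U -> chol k U f -> chol k U g -> chol k U (fun w => f w + g w).
Proof.
move=> oU; elim: k f g => [//|k IH] f g [df Hf] [dg Hg].
apply: (@chol_step _ _ _ (fun w => dz f w + dz g w)) => //; last exact: (IH _ _ Hf Hg).
by move=> z Uz; apply: cderD; [exact: df|exact: dg].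
Qed.

Lemma holD U f g : open U -> hol U f -> hol U g -> hol U (fun w => f w + g w).
Proof. by move=> oU Hf Hg k; exact: cholD. Qed.

Lemma cholM k U f g : open U -> chol k U f -> chol k U g -> chol k U (fun w => f w * g w).
Proof.
move=> oU; elim: k f g => [//|k IH] f g Hf Hg.
have [df Hf'] := Hf; have [dg Hg'] := Hg.
apply: (@chol_step _ _ _ (fun w => dz f w * g w + f w * dz g w)) => //.
  by move=> z Uz; apply: cderM; [exact: df|exact: dg].
by apply: cholD => //; [exact: (IH _ _ Hf' (cholS Hg))|exact: (IH _ _ (cholS Hf) Hg')].
Qed.

Lemma holM U f g : open U -> hol U f -> hol U g -> hol U (fun w => f w * g w).
Proof. by move=> oU Hf Hg k; exact: cholM. Qed.

Lemma holN U f : open U -> hol U f -> hol U (fun w => - f w).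
Proof.
move=> oU Hf; apply: (hol_ext oU _ (holM oU (holC (-1) oU) Hf)) => z _.
by rewrite mulN1r.
Qed.

Lemma holB U f g : open U -> hol U f -> hol U g -> hol U (fun w => f w - g w).
Proof. by move=> oU Hf Hg; apply: holD => //; exact: holN. Qed.

Lemma holV U f : open U -> (forall z, U z -> f z != 0) -> hol U f -> hol U (fun w => (f w)^-1).
Proof.
move=> oU f0 Hf; elim=> // k IH.
apply: (@chol_step _ _ _ (fun w => - dz f w * ((f w)^-1 * (f w)^-1))) => //.
  move=> z Uz; apply: cder_eq (cderV (hol_cder Hf Uz) (f0 z Uz)) _.
  by rewrite expr2 invfM.
by apply: cholM => //; [exact: (holN oU (hol_dz Hf))|exact: cholM].
Qed.

(** The Cauchy-Riemann equations pass to [cpartial 0 f] by equality of mixed partials, and induction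
    produces all complex derivatives. *)
Lemma hol_smooth U (f : E -> cx) : open U ->
  (forall k, C k U (fun w => Re (f w))) -> (forall k, C k U (fun w => Im (f w))) ->
  (forall z, U z -> cpartial 1 f z = 'i * cpartial 0 f z) -> hol U f.
Proof.
move=> oU + + + k; elim: k f => // k IH f Cr Ci CR.
have df z : U z -> cder f z (cpartial 0 f z).
  move=> Uz; split => //; last exact: CR.
  by split; [case: (Cr 1%N) => + _; apply|case: (Ci 1%N) => + _; apply].
apply: (@chol_step _ _ _ (cpartial 0 f)) => //.
have C0r l i : C l U (pd i (fun w => Re (f w))) by have [_ H] := Cr l.+1; exact: H.
have C0i l i : C l U (pd i (fun w => Im (f w))) by have [_ H] := Ci l.+1; exact: H.
apply: IH => [l|l|z Uz]; [exact: C0r|exact: C0i|].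
have Sr := mixed_partial oU (Cr 2%N) Uz.
have Si := mixed_partial oU (Ci 2%N) Uz.
have CRr : forall w, U w -> pd 1 (fun w => Re (f w)) w = - pd 0 (fun w => Im (f w)) w.
  by move=> w Uw; have /(congr1 (@complex.Re R)) := CR w Uw; rewrite !cE /= mul0r sub0r mul1r.
have CRi : forall w, U w -> pd 1 (fun w => Im (f w)) w = pd 0 (fun w => Re (f w)) w.
  by move=> w Uw; have /(congr1 (@complex.Im R)) := CR w Uw; rewrite !cE /= mul0r add0r mul1r.
apply: cplx_eq; rewrite !cE /=.
  rewrite mul0r sub0r mul1r -Sr (near_partial _ (open_near oU Uz CRr)).
  apply: partialN; by case: (C0i 1%N 0) => + _; apply.
rewrite mul0r add0r mul1r.
exact: (etrans (esym Si) (near_partial 0 (open_near oU Uz CRi))).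
Qed.

(** * Squared moduli, flat points and the maximum principle *)

Definition nsq (x : cx) : R := Re x ^+ 2 + Im x ^+ 2.

Lemma nsqM x y : nsq (x * y) = nsq x * nsq y.
Proof. by rewrite /nsq !cE; ring. Qed.

Lemma nsq_ge0 x : 0 <= nsq x.
Proof. by rewrite addr_ge0 ?sqr_ge0. Qed.

Lemma nsq_eq0 x : (nsq x == 0) = (x == 0).
Proof. exact: normsq_eq0. Qed.

Lemma nsqV x : nsq x^-1 = (nsq x)^-1.
Proof.
have [->|x0] := eqVneq x 0; first by rewrite invr0 /nsq /= expr0n /= addr0 invr0.
have n0 : nsq x != 0 by rewrite nsq_eq0.
by apply: (mulfI n0); rewrite -nsqM !mulfV // /nsq /= expr1n expr0n addr0.
Qed.

Lemma nsqX x n : nsq (x ^+ n) = nsq x ^+ n.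
Proof.
elim: n => [|n IH]; first by rewrite !expr0 /nsq /= expr1n expr0n addr0.
by rewrite !exprS nsqM IH.
Qed.

Lemma sqrRe_le x : Re x ^+ 2 <= nsq x. Proof. by rewrite lerDl sqr_ge0. Qed.
Lemma sqrIm_le x : Im x ^+ 2 <= nsq x. Proof. by rewrite lerDr sqr_ge0. Qed.

Definition zeta (z0 w : E) : cx := Complex (w 0 0 - z0 0 0) (w 0 1 - z0 0 1).

Lemma Re_zeta z0 w : Re (zeta z0 w) = w 0 0 - z0 0 0. Proof. by []. Qed.
Lemma Im_zeta z0 w : Im (zeta z0 w) = w 0 1 - z0 0 1. Proof. by []. Qed.

Lemma cder_zeta z0 w : cder (zeta z0) w 1.
Proof.
have d j : dfb (fun w => w 0 j - z0 0 j) w.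
  by apply: differentiableB; [exact: diff_coord|exact: differentiable_cst].
have p i j : pd i (fun w => w 0 j - z0 0 j) w = (i == j)%:R.
  rewrite partialB ?partial_coord ?partialC ?subr0 //; exact: diff_coord.
split; first by split; exact: d.
- by rewrite /cpartial /= !p.
- by rewrite /cpartial /= !p mulr1.
Qed.

Lemma hol_zeta U z0 : open U -> hol U (zeta z0).
Proof.
move=> oU [|k] //.
by apply: (@chol_step k U (zeta z0) (fun=> 1)) => // [z _|]; [exact: cder_zeta|exact: holC].
Qed.

Lemma zeta_eq0 z0 w : (zeta z0 w == 0) = (w == z0).
Proof.
apply/eqP/eqP => [[a b]|->]; last by rewrite /zeta !subrr.
by apply: rowP2; [move/eqP: a|move/eqP: b]; rewrite subr_eq0 => /eqP.
Qed.

Lemma cder_partials f z d : cder f z d ->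
  [/\ pd 0 (fun w => Re (f w)) z = Re d, pd 0 (fun w => Im (f w)) z = Im d,
      pd 1 (fun w => Re (f w)) z = - Im d & pd 1 (fun w => Im (f w)) z = Re d].
Proof.
move=> [_ h0 h1]; move: h0 h1 => /[dup] /(congr1 (@complex.Re R)) a /(congr1 (@complex.Im R)) b.
move=> /[dup] /(congr1 (@complex.Re R)) + /(congr1 (@complex.Im R)).
by rewrite !cE !mul0r !mul1r sub0r add0r => c e; split.
Qed.

Lemma cder_cont_nsq f z d : cder f z d -> {for z, continuous (fun w => nsq (f w) : R^o)}.
Proof.
move=> [[a b] _ _]; apply: differentiable_continuous.
by apply: differentiableD; exact: diff_sqr.
Qed.

(** Induction on [N] through [dz f]: the mean value theorem along the segment from [z0], applied to
    the real and imaginary parts separately, gains one factor [nsq (zeta z0 w)] at the cost of a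
    factor 2. *)
Lemma hol_taylor_bound U f z0 N : open U -> U z0 -> hol U f ->
  (forall k, iter k (@dz R) f z0 = 0) ->
  exists K r, [/\ 0 <= K, 0 < r & forall w, box z0 r w -> U w /\ nsq (f w) <= K * nsq (zeta z0 w)
    ^+ N].
Proof.
move=> oU Uz0; elim: N f => [|N IH] f Hf f0.
  have := local_bound (cder_cont_nsq (hol_cder Hf Uz0)).
  have : \forall w \near z0, U w by exact: open_nbhs_nbhs.
  move=> H1 H2; have [r r0 Hr] := box_near (filterI H1 H2).
  exists (`|nsq (f z0)| + 1), r; split => // w /Hr[Uw]; split => //.
  by rewrite expr0 mulr1; apply: le_trans (ler_norm _) _.
have [|K [r [K0 r0 Hr]]] := IH (dz f) (hol_dz Hf).
  by move=> k; have := f0 k.+1; rewrite iterSr.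
exists (2 * K), r; split => //; first by rewrite mulr_ge0.
move=> w Bw; have [Uw _] := Hr w Bw; split => //.
have wE : w = z0 + (w - z0) by rewrite addrC subrK.
have seg t : 0 <= t <= 1 -> box z0 r (z0 + t *: (w - z0)).
  by move=> t01; apply: box_convex => //; [exact: box_center|rewrite -wE].
have df t : 0 <= t <= 1 -> cder f (z0 + t *: (w - z0)) (dz f (z0 + t *: (w - z0))).
  by move=> t01; apply: (hol_cder Hf); have [] := Hr _ (seg t t01).
have [Ref0 Imf0] : Re (f z0) = 0 /\ Im (f z0) = 0 by have /= -> := f0 0%N.
have zt t : zeta z0 (z0 + t *: (w - z0)) = t%:C%C * zeta z0 w.
  by apply: cplx_eq; rewrite !cE /= !mxE; ring.
have bound t x : 0 < t < 1 -> (x = Re (zeta z0 w * dz f (z0 + t *: (w - z0))) \/ x = Im (zeta z0 w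
  * dz f (z0 + t *: (w - z0)))) ->
   x ^+ 2 <= K * nsq (zeta z0 w) ^+ N.+1.
  move=> /andP[t0 t1] Hx.
  have : x ^+ 2 <= nsq (zeta z0 w * dz f (z0 + t *: (w - z0))).
    by case: Hx => ->; [exact: sqrRe_le|exact: sqrIm_le].
  move/le_trans; apply; rewrite nsqM exprS mulrCA ler_wpM2l ?nsq_ge0 //.
  have t01 : 0 <= t <= 1 by rewrite !ltW.
  have [_ /le_trans] := Hr _ (seg t t01); apply.
  rewrite ler_wpM2l // zt nsqM exprMn ler_piMl ?exprn_ge0 ?nsq_ge0 //.
  rewrite exprn_ile1 ?nsq_ge0 // /nsq /= expr0n addr0.
  by rewrite expr_le1 // ltW.
have h j : (w - z0) 0 j = w 0 j - z0 0 j by rewrite !mxE.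
have [t t01|t t01] := @seg_MVT R (fun w => Re (f w)) z0 (w - z0).
  by have [[]] := df t t01.
have t01' : 0 <= t <= 1 by case/andP: t01 => *; rewrite !ltW.
have [-> _ -> _] := cder_partials (df t t01').
rewrite -wE Ref0 subr0 => Re_w.
have [s s01|s s01] := @seg_MVT R (fun w => Im (f w)) z0 (w - z0).
  by have [[]] := df s s01.
have s01' : 0 <= s <= 1 by case/andP: s01 => *; rewrite !ltW.
have [_ -> _ ->] := cder_partials (df s s01').
rewrite -wE Imf0 subr0 => Im_w.
have B1 := bound t (Re (f w)) t01; have B2 := bound s (Im (f w)) s01.
rewrite -mulrA mulr_natl mulr2n /nsq; apply: lerD.
  by apply: B1; left; rewrite Re_w cReM Re_zeta Im_zeta !h mulrN.
by apply: B2; right; rewrite Im_w cImM Re_zeta Im_zeta !h.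
Qed.

(** [h'] vanishes at the maximum; if its derivative there were positive, [h] would increase strictly
    to the right of 0. *)
Lemma second_derivative_max (h h' : R -> R) (d r : R) : 0 < r ->
  (forall t : R, `|t| < r -> is_derive t 1 h (h' t)) -> is_derive (0 : R) 1 h' d ->
  (forall t : R, `|t| < r -> h t <= h 0) -> d <= 0.
Proof.
move=> r0 dh dh' hmax.
have h'0 : h' 0 = 0.
  have nr : - r < r by rewrite gtrN.
  have := @derive1_at_max R h (- r) r 0 (ltW nr).
  have i0 : 0 \in `](- r), r[ by rewrite in_itv /= oppr_lt0 r0.
  move=> /(_ _ i0) H.
  have : is_derive (0 : R) 1 h 0.
    apply: H => t; rewrite in_itv /= => /andP[t1 t2].
      by case: (dh t); rewrite // ltr_norml t1.
    by apply: hmax; rewrite ltr_norml t1.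
  move=> [_ e2]; have [|_ e1] := dh 0; first by rewrite normr0.
  by rewrite -e1 e2.
rewrite leNgt; apply/negP => d0.
case: dh' => /cvg_ex[l Hl] dE.
have lE : l = d by rewrite -dE; symmetry; apply: cvg_lim.
move: Hl; rewrite lE => /cvgrPdist_lt/(_ _ d0)/nbhs_ballP[s /= s0 Hs].
pose t := Num.min r s / 2.
have m0 : 0 < Num.min r s by rewrite lt_min r0.
have t0 : 0 < t by rewrite divr_gt0.
have tm : t < Num.min r s by rewrite /t ltr_pdivrMr // mulr2n mulrDr mulr1 ltrDl.
move: (tm); rewrite lt_min => /andP[tr ts].
have [x||c] := @MVT R h h' 0 t t0.
- rewrite in_itv /= => /andP[x0 xt]; apply: dh; rewrite ger0_norm ?ltW //.
  exact: lt_trans tr.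
- apply: derivable_within_continuous => x; rewrite in_itv /= => /andP[x0 xt].
  by case: (dh x) => //; rewrite ger0_norm //; exact: le_lt_trans tr.
rewrite in_itv /= subr0 => /andP[c0 ct] E1.
have hc : 0 < h' c.
  have := Hs c; rewrite /ball /= sub0r normrN gtr0_norm // => /(_ (lt_trans ct ts)).
  rewrite gt_eqF // => /(_ isT).
  rewrite -[c *: 1]/(c * 1) mulr1 addr0 h'0 subr0 -[_ *: _]/(c^-1 * h' c).
  rewrite ltr_distlC => /andP[+ _]; rewrite subrr => H.
  by move: H; rewrite pmulr_rgt0 // invr_gt0.
have := hmax t; rewrite gtr0_norm // => /(_ tr); rewrite leNgt -subr_gt0 E1.
by rewrite mulr_gt0.
Qed.

Lemma pd2_max (v : E -> R) i w r : 0 < r ->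
  (forall z, box w r z -> dfb v z) -> dfb (pd i v) w ->
  (forall z, box w r z -> v z <= v w) -> pd i (pd i v) w <= 0.
Proof.
move=> r0 dv ddv vmax.
have inb t : `|t| < r -> box w r (w + t *: delta_mx 0 i).
  by move=> tr; split; rewrite !mxE /= addrAC subrr add0r; elim/ord2_ind: i {ddv};
    rewrite /= ?mulr1 ?mulr0 ?normr0.
apply: (@second_derivative_max (fun t => v (w + t *: delta_mx 0 i)) (fun t => pd i v (w + t *:
  delta_mx 0 i)) _ r r0).
- by move=> t tr; apply: is_derive_line; apply: diff_derivable; exact: dv (inb t tr).
- have := @is_derive_line R R^o (pd i v) w (delta_mx 0 i) 0.
  by rewrite scale0r addr0; apply; exact: diff_derivable.
- by move=> t tr; rewrite scale0r addr0; apply: vmax; exact: inb.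
Qed.

Lemma laplace_nsq V g w : open V -> V w -> hol V g ->
  [/\ forall z, V z -> dfb (fun w => nsq (g w)) z,
      forall i, dfb (pd i (fun w => nsq (g w))) w &
      pd 0 (pd 0 (fun w => nsq (g w))) w + pd 1 (pd 1 (fun w => nsq (g w))) w
      = 4 * nsq (dz g w)].
Proof.
move=> oV Vw Hg.
have dg z : V z -> cder g z (dz g z) by exact: hol_cder.
have dg1 z : V z -> cder (dz g) z (dz (dz g) z) by apply: hol_cder; exact: hol_dz.
have dR z : V z -> dfb (fun w => Re (g w)) z by move=> /dg[[]].
have dI z : V z -> dfb (fun w => Im (g w)) z by move=> /dg[[]].
have dR1 z : V z -> dfb (fun w => Re (dz g w)) z by move=> /dg1[[]].
have dI1 z : V z -> dfb (fun w => Im (dz g w)) z by move=> /dg1[[]].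
have p i z : V z -> pd i (fun w => nsq (g w)) z = 2 * (Re (g z) * pd i (fun w => Re (g w)) z + Im
  (g z) * pd i (fun w => Im (g w)) z).
  move=> Vz; have -> : (fun w => nsq (g w)) = (fun w => Re (g w) * Re (g w) + Im (g w) * Im (g w)).
    by apply: funext => u; rewrite /nsq !expr2.
  rewrite partialD; try by apply: differentiableM; [try exact: dR|try exact: dR]; exact: dI.
  by rewrite !partialM; [ring|exact: dI|exact: dI|exact: dR|exact: dR].
have p0 : forall z, V z -> 2 * (Re (g z) * Re (dz g z) + Im (g z) * Im (dz g z)) = pd 0 (fun w =>
  nsq (g w)) z.
  by move=> z Vz; rewrite p //; have [-> -> _ _] := cder_partials (dg z Vz).
have p1 : forall z, V z -> 2 * (Im (g z) * Re (dz g z) - Re (g z) * Im (dz g z)) = pd 1 (fun w =>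
  nsq (g w)) z.
  by move=> z Vz; rewrite p //; have [_ _ -> ->] := cder_partials (dg z Vz); ring.
have d2 f : dfb f w -> dfb (fun w => 2 * f w) w.
  by move=> df; apply: differentiableM => //; exact: differentiable_cst.
have pd2 i f : dfb f w -> pd i (fun w => 2 * f w) w = 2 * pd i f w.
  by move=> df; rewrite partialM // ?partialC ?mul0r ?add0r //; exact: differentiable_cst.
have D0 : dfb (fun z => Re (g z) * Re (dz g z) + Im (g z) * Im (dz g z)) w.
  by apply: differentiableD; apply: differentiableM; [exact: dR|exact: dR1|exact: dI|exact: dI1].
have D1 : dfb (fun z => Im (g z) * Re (dz g z) - Re (g z) * Im (dz g z)) w.
  by apply: differentiableB; apply: differentiableM; [exact: dI|exact: dR1|exact: dR|exact: dI1].
split.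
- move=> z Vz; apply: differentiableD; apply: diff_sqr; [exact: dR|exact: dI].
- elim/ord2_ind.
    by apply: near_differentiable (open_near oV Vw p0) _; exact: d2.
  by apply: near_differentiable (open_near oV Vw p1) _; exact: d2.
rewrite -(near_partial 0 (open_near oV Vw p0)) -(near_partial 1 (open_near oV Vw p1)).
rewrite !pd2 // partialD; try by apply: differentiableM; [exact: dR|exact: dR1].
  rewrite partialB; try by apply: differentiableM; [exact: dI|exact: dR1].
    rewrite !partialM; try by [exact: dR|exact: dR1|exact: dI|exact: dI1].
    have [-> -> -> ->] := cder_partials (dg w Vw).
    have [-> -> -> ->] := cder_partials (dg1 w Vw).
    by rewrite /nsq; move: (dz g w) (dz (dz g) w) (g w) => a b c;
      move: (Re a) (Im a) (Re b) (Im b) (Re c) (Im c) => *; ring.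
  by apply: differentiableM; [exact: dR|exact: dI1].
by apply: differentiableM; [exact: dI|exact: dI1].
Qed.

Lemma eps_continuous (v : E -> R) (z : E) : {for z, continuous (v : E -> R^o)} ->
  forall e, 0 < e -> \forall w \near z, `|v z - v w| <= e.
Proof. by move=> /cvgrPdist_le H e e0; exact: H. Qed.

Lemma continuous_eps (v : E -> R) (z : E) :
  (forall e, 0 < e -> \forall w \near z, `|v z - v w| <= e) ->
  {for z, continuous (v : E -> R^o)}.
Proof.
move=> H A /nbhs_ballP[e /= e0 He].
have e20 : 0 < e / 2 by rewrite divr_gt0.
apply: (@filterS E (nbhs z) (nbhs_filter z) _ _ _ (H _ e20)) => w Hw.
apply: He; rewrite -ball_normE /=; apply: le_lt_trans Hw _.
by rewrite ltr_pdivrMr // mulr2n mulrDr mulr1 ltrDl.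
Qed.

Lemma nsq0 : nsq (0 : cx) = 0. Proof. by apply/eqP; rewrite nsq_eq0. Qed.

Lemma holX (U : set E) f n : open U -> hol U f -> hol U (fun w => f w ^+ n).
Proof.
move=> oU Hf; elim: n => [|n IH].
  by apply: (@hol_ext U (fun=> 1) _ oU) (holC 1 oU) => z _; rewrite expr0.
by apply: (@hol_ext U _ _ oU) (holM oU Hf IH) => z _; rewrite exprS.
Qed.

(** With [h] taken to be [zeta] and [e] positive, the Laplacian is strictly positive, which excludes
    interior maxima outright. *)
Lemma laplace_addl (V : set E) g h w e : open V -> V w -> hol V g -> hol V h ->
  let v := fun w => nsq (g w) + e * nsq (h w) in
  [/\ forall z, V z -> dfb v z, forall i, dfb (pd i v) w &
      pd 0 (pd 0 v) w + pd 1 (pd 1 v) w = 4 * (nsq (dz g w) + e * nsq (dz h w))].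
Proof.
move=> oV Vw Hg Hh v.
have [dg ddg Lg] := laplace_nsq oV Vw Hg; have [dh ddh Lh] := laplace_nsq oV Vw Hh.
have vE : v = (fun w => 1 * nsq (g w) + e * nsq (h w)) by apply: funext => x; rewrite mul1r.
have pE i z : V z -> 1 * pd i (fun w => nsq (g w)) z + e * pd i (fun w => nsq (h w)) z = pd i v z.
  by move=> Vz; rewrite vE partial_lin //; [exact: dg|exact: dh].
have dlin (p q : E -> R) z : dfb p z -> dfb q z -> dfb (fun w => 1 * p w + e * q w) z.
  by move=> dp dq; apply: differentiableD; apply: differentiableM => //; exact: differentiable_cst.
split.
- by move=> z Vz; rewrite vE; apply: dlin; [exact: dg|exact: dh].
- by move=> i; apply: near_differentiable (open_near oV Vw (pE i)) _; exact: dlin.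
rewrite -(near_partial 0 (open_near oV Vw (pE 0))) -(near_partial 1 (open_near oV Vw (pE 1))).
rewrite (partial_lin 0 1 e (ddg 0) (ddh 0)) (partial_lin 1 1 e (ddg 1) (ddh 1)).
have alg (a b c d x y : R) : a + c = 4 * x -> b + d = 4 * y ->
    1 * a + e * b + (1 * c + e * d) = 4 * (x + e * y).
  move=> h1 h2; transitivity (a + c + e * (b + d)); first by ring.
  by rewrite h1 h2; ring.
exact: alg Lg Lh.
Qed.

(** On the boundary of the square [nsq zeta] is at least [r ^ 2], so [f / zeta ^ N] satisfies the
    bound there, and the maximum principle carries it inside. The singularity at [z0] is harmless
    because [f] is flat at that point. *)
Lemma hol_max_bound (U : set E) f z0 r K N : open U -> hol U f -> 0 < r -> 0 <= K ->
  cbox z0 r `<=` U -> (forall w, cbox z0 r w -> nsq (f w) <= K) ->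
  (forall k, iter k (@dz R) f z0 = 0) ->
  forall w, cbox z0 r w -> nsq (f w) <= K / (r ^+ 2) ^+ N * nsq (zeta z0 w) ^+ N.
Proof.
move=> oU Hf r0 K0 rU fK f0 w Bw.
have r2 : 0 < (r ^+ 2) ^+ N by rewrite !exprn_gt0.
have fz0 : f z0 = 0 by have := f0 0%N.
have Bz0 : cbox z0 r z0 by split; rewrite subrr normr0 ltW.
have Uz0 := rU _ Bz0.
have [wz|wz] := eqVneq w z0.
  by rewrite wz fz0 nsq0 mulr_ge0 ?divr_ge0 ?exprn_ge0 ?nsq_ge0 // ltW.
have zw : 0 < nsq (zeta z0 w) by rewrite lt0r nsq_eq0 zeta_eq0 wz nsq_ge0.
rewrite -ler_pdivrMr ?exprn_gt0 //.
pose g w := f w / zeta z0 w ^+ N.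
have gE x : nsq (g x) = nsq (f x) / nsq (zeta z0 x) ^+ N.
  by rewrite /g nsqM nsqV nsqX.
rewrite -gE; apply/ler_addgt0Pr => e0 e00.
(* On the square [nsq zeta] is at most [2 * r ^ 2], so the perturbation [e * nsq zeta] contributes
   at most [e0]. *)
pose e := e0 / (2 * r ^+ 2).
have r20 : 0 < 2 * r ^+ 2 by rewrite mulr_gt0 // exprn_gt0.
have ep : 0 < e by rewrite divr_gt0.
have eE : e0 = e * (2 * r ^+ 2) by rewrite /e divfK // gt_eqF.
pose v w := nsq (g w) + e * nsq (zeta z0 w).
pose V := U `&` [set x | zeta z0 x != 0].
have oV : open V.
  have -> : V = U `&` (fun x => nsq (zeta z0 x)) @^-1` [set x : R | 0 < x].
    apply/seteqP; split=> x [Ux] /=; rewrite lt0r nsq_eq0 nsq_ge0 andbT; by split.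
  apply: open_setI_preim => //.
  by move=> z _; exact: cder_cont_nsq (cder_zeta z0 z).
have Hg : hol V g.
  apply: holM => //; first by apply: hol_sub Hf => x [].
  apply: holV => //; first by move=> x [_ zx]; rewrite expf_neq0.
  by apply: holX => //; exact: hol_zeta.
have zle x : cbox z0 r x -> nsq (zeta z0 x) <= 2 * r ^+ 2.
  move=> [h0 h1]; rewrite /nsq Re_zeta Im_zeta mulr_natl mulr2n.
  by apply: lerD; rewrite -real_normK ?num_real // lerXn2r ?nnegrE // ltW.
have cv x : cbox z0 r x -> {for x, continuous (v : E -> R^o)}.
  move=> Bx; have [xz|xz] := eqVneq x z0; last first.
    have Vx : V x by split; [exact: rU|rewrite /= zeta_eq0].
    have [dv _ _] := laplace_addl e oV Vx Hg (hol_zeta z0 oV).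
    by apply: differentiable_continuous; exact: dv.
  (* One order more than [N] forces [v] to tend to 0 at [z0], where the quotient has the value 0
     because [f z0 = 0]. *)
  rewrite xz; have [K' [r' [K'0 r'0 H']]] := hol_taylor_bound N.+1 oU Uz0 Hf f0.
  have v0 : v z0 = 0.
    have zz : zeta z0 z0 = 0 by apply/eqP; rewrite zeta_eq0.
    by rewrite /v gE fz0 zz nsq0 mul0r mulr0 addr0.
  apply: continuous_eps => d d0; rewrite v0.
  have Kp : 0 < K' + e + 1 by rewrite ltr_wpDl // addr_ge0 // ltW.
  have d1 : 0 < d / (K' + e + 1) by rewrite divr_gt0.
  have N2 := eps_continuous (cder_cont_nsq (cder_zeta z0 z0)) d1.
  have N1 : \forall w \near z0, box z0 r' w by apply: open_nbhs_nbhs; split;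
    [exact: open_box|exact: box_center].
  apply: filterS2 N1 N2 => y By.
  have zz : zeta z0 z0 = 0 by apply/eqP; rewrite zeta_eq0.
  rewrite zz nsq0 !sub0r !normrN ger0_norm ?nsq_ge0 // => zd.
  have ve : v y <= (K' + e + 1) * nsq (zeta z0 y).
    rewrite /v !mulrDl mul1r; apply: ler_wpDr; first exact: nsq_ge0.
    rewrite lerD2r gE; have [yz|yz] := eqVneq y z0.
      by rewrite yz fz0 nsq0 mul0r mulr_ge0 // nsq_ge0.
    have zy : 0 < nsq (zeta z0 y) by rewrite lt0r nsq_eq0 zeta_eq0 yz nsq_ge0.
    rewrite ler_pdivrMr ?exprn_gt0 // -mulrA -exprS.
    by have [] := H' y By.
  rewrite ger0_norm; last by rewrite /v addr_ge0 ?nsq_ge0 // mulr_ge0 ?nsq_ge0 // ltW.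
  by apply: le_trans ve _; rewrite mulrC -ler_pdivlMr.
have [|||x /set_mem Bx vmax] := @EVT_max_rV R 2 v (cbox z0 r).
- by exists z0.
- exact: compact_cbox.
- by apply: continuous_in_subspaceT => x /set_mem; exact: cv.
have vx : v x <= K / (r ^+ 2) ^+ N + e0.
  have RHS0 : 0 <= K / (r ^+ 2) ^+ N by rewrite divr_ge0 // ltW.
  have [xz|xz] := eqVneq x z0.
    have zz : zeta z0 z0 = 0 by apply/eqP; rewrite zeta_eq0.
    by rewrite xz /v gE fz0 zz nsq0 mul0r mulr0 addr0 addr_ge0 // ltW.
  have Vx : V x by split; [exact: rU|rewrite /= zeta_eq0].
  (* An interior maximum away from [z0] would have nonpositive second partials, against the positive
     Laplacian. Only [z0] and the boundary remain. *)
  have [bd|bd] := boolP ((`|x 0 0 - z0 0 0| < r) && (`|x 0 1 - z0 0 1| < r)).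
    exfalso; have bx : box z0 r x by apply/andP.
    have [dv ddv Lv] := laplace_addl e oV Vx Hg (hol_zeta z0 oV).
    have [s s0 Hs] := box_nbhs (openI oV (@open_box R z0 r)) (conj Vx bx).
    have M i : pd i (pd i v) x <= 0.
      apply: (pd2_max s0); [by move=> y /Hs[Vy _]; exact: dv|exact: ddv|].
      move=> y /Hs[_ [b0 b1]]; apply: vmax; apply/mem_set; by split; exact: ltW.
    have := lerD (M 0) (M 1); rewrite addr0 Lv (cder_dz (cder_zeta z0 x)).
    apply/negP; rewrite -ltNge mulr_gt0 // ltr_wpDl ?nsq_ge0 //.
    by rewrite /nsq /= expr1n expr0n /= addr0 mulr1.
  have zr : r ^+ 2 <= nsq (zeta z0 x).
    rewrite /nsq Re_zeta Im_zeta; move: bd; rewrite negb_and -!leNgt => /orP[] b.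
      apply: ler_wpDr; first exact: sqr_ge0.
      by rewrite -[leRHS]real_normK ?num_real // lerXn2r ?nnegrE // ltW.
    apply: ler_wpDl; first exact: sqr_ge0.
    by rewrite -[leRHS]real_normK ?num_real // lerXn2r ?nnegrE // ltW.
  have r2p : 0 < r ^+ 2 by rewrite exprn_gt0.
  rewrite /v; apply: lerD; last by rewrite eE ler_wpM2l ?zle // ltW.
  rewrite gE; apply: ler_pM; rewrite ?nsq_ge0 ?invr_ge0 ?exprn_ge0 ?nsq_ge0 //; first exact: fK.
  rewrite lef_pV2 ?posrE ?exprn_gt0 //; last exact: lt_le_trans zr.
  by rewrite lerXn2r ?nnegrE // ltW // (lt_le_trans r2p).
apply: le_trans (le_trans (vmax w (mem_set Bw)) vx).
by rewrite lerDl mulr_ge0 ?nsq_ge0 // ltW.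
Qed.

(* The maximum principle is applied to [f / zeta ^+ N] for all [N]. *)
Theorem hol_unique_continuation (U : set E) f z0 : open U -> U z0 -> hol U f ->
  (forall k, iter k (@dz R) f z0 = 0) -> \forall w \near z0, f w = 0.
Proof.
move=> oU Uz0 Hf f0.
have [K [r' [K0 r'0 H]]] := hol_taylor_bound 0 oU Uz0 Hf f0.
pose r := r' / 2; have r0 : 0 < r by rewrite divr_gt0.
have rr : r < r' by rewrite /r ltr_pdivrMr // mulr2n mulrDr mulr1 ltrDl.
have sB w : cbox z0 r w -> box z0 r' w by move=> [h0 h1]; split; exact: le_lt_trans rr.
have B N := @hol_max_bound U f z0 r K N oU Hf r0 K0.
have {}B N w : cbox z0 r w -> nsq (f w) <= K / (r ^+ 2) ^+ N * nsq (zeta z0 w) ^+ N.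
  apply: B => //; first by move=> x /sB/H[].
  by move=> x /sB/H[]; rewrite expr0 mulr1.
have r20 : 0 < r / 2 by rewrite divr_gt0.
have : \forall w \near z0, box z0 (r / 2) w by apply: open_nbhs_nbhs; split;
  [exact: open_box|exact: box_center].
apply: filterS => w [b0 b1]; apply/eqP; rewrite -nsq_eq0 eq_le nsq_ge0 andbT.
have Bw : cbox z0 r w by split; apply/ltW; [apply: lt_trans b0 _|apply: lt_trans b1 _]; lra.
(* Halving the side makes [nsq zeta] at most half of [r ^ 2], so the bound decays like
   [K / 2 ^ N]. *)
have zle : nsq (zeta z0 w) <= r ^+ 2 / 2.
  have sq (x : R) : `|x| < r / 2 -> x ^+ 2 <= r ^+ 2 / 4.
    move=> h; rewrite -real_normK ?num_real //.
    have -> : r ^+ 2 / 4 = (r / 2) ^+ 2 by field.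
    by rewrite lerXn2r ?nnegrE // ltW.
  by rewrite /nsq Re_zeta Im_zeta; have := sq _ b0; have := sq _ b1; lra.
have N1 N : nsq (f w) <= K / 2 ^+ N.
  apply: le_trans (B N w Bw) _; rewrite -mulrA ler_wpM2l // mulrC -expr_div_n -exprVn.
  rewrite lerXn2r ?nnegrE ?divr_ge0 ?nsq_ge0 ?sqr_ge0 //.
  by rewrite ler_pdivrMr ?exprn_gt0 // mulrC.
rewrite leNgt; apply/negP => f_gt0.
have := archi_boundP (divr_ge0 K0 (ltW f_gt0)).
set N := Num.bound _ => HN.
have := N1 N; rewrite leNgt => /negP; apply.
rewrite ltr_pdivrMr ?exprn_gt0 // mulrC -ltr_pdivrMr //.
apply: lt_trans HN _; rewrite -natrX ltr_nat; exact: ltn_expl.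
Qed.

End HolomorphicFunctions.

(** * Leading coefficients at a zero of the Hopf differential *)

Section UmbilicAsymptotics.
Variable R : realType.
Local Notation E := 'rV[R]_2.
Local Notation C k U f := (Cn (V := R^o) k U f).
Local Notation Re := complex.Re.
Local Notation Im := complex.Im.
Local Notation cx := (R[i]).

Let CC : numFieldType := (cx : numFieldType).

(** * Limits at 0 along the positive half-line *)

Lemma near_right0 (P : R -> Prop) :
  (\forall t \near 0^'+, P t) <-> exists2 r : R, 0 < r & forall t, 0 < t < r -> P t.
Proof.
split=> [H|[r r0 H]].
  have [r /= r0 Hr] := (nbhs_ballP _ _).1 H.
  exists r => // t /andP[t0 tr]; apply: Hr => //.
  by rewrite -ball_normE /= sub0r normrN gtr0_norm.
apply/nbhs_ballP; exists r => //= t; rewrite -ball_normE /= sub0r normrN => tr t0.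
by apply: H; rewrite t0 -(gtr0_norm t0).
Qed.

Definition lim0 (u : R -> cx) (l : cx) :=
  ((u : R -> CC) t @[t --> 0^'+] --> (l : CC)).

Lemma lim0_parts u (a b : R) :
  Re (u t) @[t --> 0^'+] --> a -> Im (u t) @[t --> 0^'+] --> b -> lim0 u (Complex a b).
Proof.
move=> Ha Hb; apply/cvgrPdist_lt => -[e e'] /[dup] e0; rewrite ltcE /= => /andP[/eqP e'0 ep].
have e2 : 0 < e / 2 by rewrite divr_gt0.
move/cvgrPdist_lt: Ha => /(_ _ e2) Ha; move/cvgrPdist_lt: Hb => /(_ _ e2) Hb.
apply: filterS2 Ha Hb => t Ha Hb.
rewrite normc_def ltcE /= e'0 eqxx /=.
have -> : e = Num.sqrt (e ^+ 2) by rewrite sqrtr_sqr gtr0_norm.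
rewrite ltr_sqrt ?exprn_gt0 // !cE /=.
case: (u t) Ha Hb => x y /= Ha Hb.
have A : (a - x) ^+ 2 < (e / 2) ^+ 2 by rewrite -real_normK ?num_real // ltrXn2r ?nnegrE // ltW.
have B : (b - y) ^+ 2 < (e / 2) ^+ 2 by rewrite -real_normK ?num_real // ltrXn2r ?nnegrE // ltW.
apply: (lt_le_trans (ltrD A B)).
have -> : (e / 2) ^+ 2 + (e / 2) ^+ 2 = e ^+ 2 / 2 by field.
by rewrite ler_pdivrMr // ler_peMr ?sqr_ge0 // ler1n.
Qed.

Lemma lim0D u v a b : lim0 u a -> lim0 v b -> lim0 (fun t => u t + v t) (a + b).
Proof. exact: cvgD. Qed.
Lemma lim0N u a : lim0 u a -> lim0 (fun t => - u t) (- a).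
Proof. exact: cvgN. Qed.
Lemma lim0M u v a b : lim0 u a -> lim0 v b -> lim0 (fun t => u t * v t) (a * b).
Proof. exact: cvgM. Qed.
Lemma lim0C c : lim0 (fun=> c) c.
Proof. exact: cvg_cst. Qed.
Lemma lim0V u a : a != 0 -> lim0 u a -> lim0 (fun t => (u t)^-1) a^-1.
Proof. by move=> a0 H; exact: cvgV. Qed.

Lemma lim0_near u v l : (\forall t \near 0^'+, u t = v t) -> lim0 u l -> lim0 v l.
Proof. by move=> uv; apply: cvg_trans; exact: near_eq_cvg. Qed.

Lemma lim0_unique u a b : lim0 u a -> lim0 u b -> a = b.
Proof. by move=> Ha Hb; exact: (cvg_unique (@norm_hausdorff CC CC) Ha Hb). Qed.

Lemma lim0_neq0 u a : lim0 u a -> a != 0 -> \forall t \near 0^'+, u t != 0.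
Proof.
move=> Ha a0; have na : 0 < `|a : CC| by rewrite normr_gt0.
move: Ha; rewrite /lim0 => /cvgrPdist_lt/(_ _ na) Ha; apply: filterS Ha => t.
by apply: contraTneq => ->; rewrite subr0 ltxx.
Qed.

Lemma lim0_t : lim0 (fun t : R => t%:C%C) 0.
Proof.
apply: lim0_parts => /=; last exact: cvg_cst.
apply/cvgrPdist_lt => e e0; apply/near_right0; exists e => // t /andP[t0 te].
by rewrite sub0r normrN gtr0_norm.
Qed.

(** Subtracting the expected term [L / k.+1 * t ^ k.+1] from [h] reduces the claim to the mean value
    theorem for [H]. *)
Lemma lhopital_pow (h h' : R -> R) (L r : R) k : 0 < r ->
  (forall t : R, 0 <= t < r -> is_derive t 1 h (h' t)) -> h 0 = 0 ->
  h' t / t ^+ k @[t --> 0^'+] --> L ->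
  h t / t ^+ k.+1 @[t --> 0^'+] --> L / k.+1%:R.
Proof.
move=> r0 dh h0 HL; apply/cvgrPdist_le => e e0.
move/cvgrPdist_le: HL => /(_ _ e0)/near_right0[s s0 Hs].
apply/near_right0; exists (Num.min r s); first by rewrite lt_min r0.
move=> t /andP[t0]; rewrite lt_min => /andP[tr ts].
pose H x := h x - L / k.+1%:R * x ^+ k.+1.
pose H' x := h' x - L * x ^+ k.
have dH x : 0 <= x < r -> is_derive x 1 H (H' x).
  move=> xr; have d1 := dh x xr.
  have d2 : is_derive x 1 (fun y : R => y ^+ k.+1) (k.+1%:R * x ^+ k).
    apply: DeriveDef; first exact: exprn_derivable.
    by rewrite exp_derive -[_ *: 1]/(_ * 1) mulr1.
  have := is_deriveB d1 (is_deriveZ (L / k.+1%:R) d2).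
  have -> : h' x - L / k.+1%:R *: (k.+1%:R * x ^+ k) = H' x.
    by rewrite /H' -[_ *: _]/(_ * _) mulrA divfK // pnatr_eq0.
  exact.
have [x||c] := @MVT R H H' 0 t t0.
- rewrite in_itv /= => /andP[x0 xt]; apply: dH; rewrite ltW //=.
  exact: lt_trans tr.
- apply: derivable_within_continuous => x; rewrite in_itv /= => /andP[x0 xt].
  by case: (dH x) => //; rewrite x0 /=; exact: le_lt_trans tr.
rewrite in_itv /= => /andP[c0 ct].
have -> : H 0 = 0 by rewrite /H h0 expr0n mulr0 subr0.
rewrite !subr0 => HE.
have tk : 0 < t ^+ k.+1 by rewrite exprn_gt0.
have ck : 0 < c ^+ k by rewrite exprn_gt0.
have -> : L / k.+1%:R - h t / t ^+ k.+1 = - (H t / t ^+ k.+1).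
  by rewrite /H mulrBl mulfK ?gt_eqF // opprB.
rewrite normrN normrM normfV (gtr0_norm tk) ler_pdivrMr //.
rewrite HE normrM (gtr0_norm t0) exprSr mulrA ler_wpM2r ?(ltW t0) //.
have := Hs c; rewrite c0 (lt_trans ct ts) => /(_ isT).
have -> : L - h' c / c ^+ k = - (H' c / c ^+ k) by rewrite /H' mulrBl mulfK ?gt_eqF // opprB.
rewrite normrN normrM normfV (gtr0_norm ck) ler_pdivrMr // => /le_trans; apply.
by rewrite ler_wpM2l ?(ltW e0) // lerXn2r ?nnegrE // ltW.
Qed.

Definition ray (z0 : E) (t : R) : E := z0 + t *: delta_mx 0 0.

Lemma ray_near (z0 : E) (P : E -> Prop) : (\forall z \near z0, P z) ->
  exists2 r : R, 0 < r & forall t, 0 <= t < r -> P (ray z0 t).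
Proof.
move=> /near2P[r r0 H]; exists r => // t /andP[t0 tr]; apply: H; rewrite /ray !mxE /=.
  by rewrite mulr1 addrAC subrr add0r ger0_norm.
by rewrite mulr0 addr0 subrr normr0.
Qed.

Lemma ray0 z0 : ray z0 0 = z0. Proof. by rewrite /ray scale0r addr0. Qed.

Lemma cder_ray f z0 t d : cder f (ray z0 t) d ->
  is_derive t 1 (fun t => Re (f (ray z0 t))) (Re d) /\
  is_derive t 1 (fun t => Im (f (ray z0 t))) (Im d).
Proof.
move=> fd; have [<- <- _ _] := cder_partials fd; have [[a b] _ _] := fd.
split.
  exact: (@is_derive_line R R^o (fun w => Re (f w)) z0 (delta_mx 0 0) t (diff_derivable a)).
exact: (@is_derive_line R R^o (fun w => Im (f w)) z0 (delta_mx 0 0) t (diff_derivable b)).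
Qed.

Lemma ray_cont U f z0 : open U -> U z0 -> hol U f -> lim0 (fun t => f (ray z0 t)) (f z0).
Proof.
move=> oU Uz0 Hf.
have fd : cder f (ray z0 0) (dz f z0) by rewrite ray0; exact: hol_cder.
have [[dR _] [dI _]] := cder_ray fd.
have cR := differentiable_continuous ((derivable1_diffP _ _).1 dR).
have cI := differentiable_continuous ((derivable1_diffP _ _).1 dI).
have -> : f z0 = Complex (Re (f z0)) (Im (f z0)) by apply: cplx_eq.
apply: lim0_parts.
  by have := cvg_at_right_filter cR; rewrite ray0.
by have := cvg_at_right_filter cI; rewrite ray0.
Qed.

(** Passing from a derivative to the function one order below raises the vanishing order by one and
    divides the leading coefficient by the new order. Hence [i] applications of [lhopital_pow] lead
    from the derivative of order [n] to that of order [n - i]. *)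
Lemma ray_taylor U f z0 n : open U -> U z0 -> hol U f ->
  (forall k, (k < n)%N -> iter k (@dz R) f z0 = 0) ->
  forall i, (i <= n)%N ->
  lim0 (fun t => iter (n - i) (@dz R) f (ray z0 t) / t%:C%C ^+ i)
       (iter n (@dz R) f z0 / (i`!)%:R).
Proof.
move=> oU Uz0 Hf f0.
have [r r0 Hr] : exists2 r : R, 0 < r & forall t, 0 <= t < r -> U (ray z0 t).
  by apply: ray_near; exact: open_nbhs_nbhs.
have CXr (t : R) i : t%:C%C ^+ i = (t ^+ i)%:C%C :> cx by rewrite -rmorphXn.
have divr (x : cx) (t : R) : x / t%:C%C = Complex (Re x / t) (Im x / t).
  have [->|t0] := eqVneq t 0.
    by have -> : 0%:C%C = 0 :> cx by []; rewrite !invr0 !mulr0.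
  apply: cplx_eq; rewrite !cE cReV cImV /= expr0n /= addr0 oppr0 mul0r mulr0 ?subr0 ?add0r ?addr0;
    field; exact: t0.
have parts u (l : cx) : lim0 u l -> Re (u t) @[t --> 0^'+] --> Re l /\ Im (u t) @[t --> 0^'+] -->
  Im l.
  move=> Hu; split; apply/cvgrPdist_lt => e e0.
    have ec : 0 < (e%:C%C : CC) by rewrite ltcR.
    move: Hu; rewrite /lim0 => /cvgrPdist_lt/(_ _ ec) Hu; apply: filterS Hu => t.
    move=> h; rewrite -ltcR; apply: le_lt_trans h.
    by have := normc_ge_Re (l - u t); rewrite !cE.
  have ec : 0 < (e%:C%C : CC) by rewrite ltcR.
  move: Hu; rewrite /lim0 => /cvgrPdist_lt/(_ _ ec) Hu; apply: filterS Hu => t.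
  move=> h; rewrite -ltcR; apply: le_lt_trans h.
  (* The imaginary part is the real part of the product with [- 'i], which has the same modulus. *)
  have := normc_ge_Re (- 'i * (l - u t)); rewrite normrM normrN.
  have -> : `|('i : cx)| = 1 by rewrite normc_def /= expr0n expr1n add0r sqrtr1.
  by rewrite mul1r !cE oppr0 mul0r sub0r mulN1r opprK.
elim=> [|i IH] ilen.
  rewrite subn0 fact0 divr1.
  apply: lim0_near (ray_cont oU Uz0 (hol_iter n Hf)).
  by apply: nearW => t; rewrite expr0 divr1.
have {}IH := IH (ltnW ilen).
pose g := iter (n - i.+1) (@dz R) f.
have gS : iter (n - i) (@dz R) f = dz g.
  by rewrite /g -iterS; congr iter; rewrite -subSn // subSS.
rewrite gS in IH.
have Hg : hol U g by exact: hol_iter.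
have g0 : g z0 = 0 by apply: f0; rewrite ltn_subrL; case: (n) ilen.
have [IR II] := parts _ _ IH.
have dg t : 0 <= t < r -> cder g (ray z0 t) (dz g (ray z0 t)) by move=> /Hr; exact: hol_cder.
have i1 : (i.+1)%:R != 0 :> cx by rewrite pnatr_eq0.
have i2 : (i`!)%:R != 0 :> cx by rewrite pnatr_eq0 -lt0n fact_gt0.
have -> : iter n (@dz R) f z0 / (i.+1`!)%:R = Complex (Re (iter n (@dz R) f z0 / (i`!)%:R) /
  i.+1%:R) (Im (iter n (@dz R) f z0 / (i`!)%:R) / i.+1%:R).
  rewrite -divr factS natrM -[i.+1%:R%:C%C]/(real_complex R i.+1%:R) rmorph_nat.
  by rewrite invfM [X in _ * X]mulrC mulrA.
apply: lim0_parts.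
  have : Re (g (ray z0 t)) / t ^+ i.+1 @[t --> 0^'+] --> Re (iter n (@dz R) f z0 / (i`!)%:R) /
    i.+1%:R.
    apply: (@lhopital_pow (fun t => Re (g (ray z0 t))) (fun t => Re (dz g (ray z0 t))) (Re (iter n
      (@dz R) f z0 / (i`!)%:R)) r i r0).
    - by move=> t /dg/cder_ray[].
    - by rewrite ray0 g0.
    - apply: cvg_trans IR; apply: near_eq_cvg; apply: nearW => t.
      by rewrite CXr divr.
  by apply: cvg_trans; apply: near_eq_cvg; apply: nearW => t; rewrite CXr divr.
have : Im (g (ray z0 t)) / t ^+ i.+1 @[t --> 0^'+] --> Im (iter n (@dz R) f z0 / (i`!)%:R) /
  i.+1%:R.
  apply: (@lhopital_pow (fun t => Im (g (ray z0 t))) (fun t => Im (dz g (ray z0 t))) (Im (iter n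
    (@dz R) f z0 / (i`!)%:R)) r i r0).
  - by move=> t /dg/cder_ray[].
  - by rewrite ray0 g0.
  - apply: cvg_trans II; apply: near_eq_cvg; apply: nearW => t.
    by rewrite CXr divr.
by apply: cvg_trans; apply: near_eq_cvg; apply: nearW => t; rewrite CXr divr.
Qed.

#[local] Opaque lim0.
Arguments lim0C c : clear implicits.

Lemma ffact_natS n j : (n ^_ j.+1)%:R = (n ^_ j)%:R * (n%:R - j%:R) :> cx.
Proof.
rewrite ffactnSr natrM; have [jn|nj] := leqP j n; first by rewrite natrB.
by rewrite ffact_small // !mul0r.
Qed.

Lemma lim0_ext (u v : R -> cx) l : (forall t, 0 < t -> u t = v t) -> lim0 u l -> lim0 v l.
Proof. by move=> uv; apply: lim0_near; apply/near_right0; exists 1 => // t /andP[/uv]. Qed.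

(** Near a zero of order [n] the function behaves like [a z ^ n / n!], for which the quotient in
    question is exactly the falling factorial. *)
Lemma ray_ratio (U : set E) q z0 n : open U -> U z0 -> hol U q ->
  (forall k, (k < n)%N -> iter k (@dz R) q z0 = 0) -> iter n (@dz R) q z0 != 0 ->
  forall j, lim0 (fun t => t%:C%C ^+ j * iter j (@dz R) q (ray z0 t) / q (ray z0 t)) (n ^_ j)%:R.
Proof.
move=> oU Uz0 Hq q0 qn j.
set a := iter n _ q z0 in qn.
have T := ray_taylor oU Uz0 Hq q0; rewrite -/a in T.
have den : lim0 (fun t => (q (ray z0 t) / t%:C%C ^+ n)^-1) (a / (n`!)%:R)^-1.
  apply: lim0V; last by have := T n (leqnn n); rewrite subnn.
  by rewrite mulf_neq0 // invr_neq0 // pnatr_eq0 -lt0n fact_gt0.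
have tn0 (t : R) : 0 < t -> t%:C%C != 0 :> cx by move=> t0;
  rewrite -[0]/(0%:C%C) (inj_eq (@complexI R)) gt_eqF.
have fn0 i : (i`!)%:R != 0 :> cx by rewrite pnatr_eq0 -lt0n fact_gt0.
have [jn|nj] := leqP j n.
  have Tj := T (n - j)%N (leq_subr j n); rewrite (subKn jn) in Tj.
  have := lim0M Tj den.
  have -> : a / (n - j)`!%:R * (a / n`!%:R)^-1 = (n ^_ j)%:R.
    rewrite -(ffact_fact jn) natrM; apply/eqP.
    have := fn0 (n - j)%N; have : (n ^_ j)%:R != 0 :> cx by rewrite pnatr_eq0 -lt0n ffact_gt0.
    move: qn ((n - j)`!%:R) ((n ^_ j)%:R) => qn u v v0 u0; apply/eqP; field.
    by rewrite u0 qn v0.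
  apply: lim0_ext => t /tn0 t0.
  rewrite invf_div.
  have -> : t%:C%C ^+ n = t%:C%C ^+ (n - j) * t%:C%C ^+ j :> cx by rewrite -exprD subnK.
  have p0 : t%:C%C ^+ (n - j) != 0 :> cx by rewrite expf_neq0.
  move: (t%:C%C ^+ (n - j)) (t%:C%C ^+ j) p0 (iter j _ _ _) (q _) => p s p0 A B.
  have -> : A / p * (p * s / B) = s * A / B * (p / p) by ring.
  by rewrite divff // mulr1.
(* Beyond order [n] it is enough that the derivative stays bounded: the surplus power [t ^ (j - n)]
   makes the quotient tend to 0. *)
have -> : (n ^_ j)%:R = 0 :> cx by rewrite ffact_small.
have jc := ray_cont oU Uz0 (hol_iter j Hq).
have tj : lim0 (fun t : R => t%:C%C ^+ (j - n)) 0.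
  rewrite -(subnSK nj); elim: (j - n.+1)%N => [|m IH].
    have Et (t : R) : 0 < t -> t%:C%C = t%:C%C ^+ 1 :> cx by rewrite expr1.
    exact: (lim0_ext Et (@lim0_t)).
  have Et (t : R) : 0 < t -> t%:C%C * t%:C%C ^+ m.+1 = t%:C%C ^+ m.+2 :> cx by rewrite [RHS]exprS.
  have := lim0M (@lim0_t) IH; rewrite mul0r => L; exact: (lim0_ext Et L).
have := lim0M (lim0M tj jc) den; rewrite !mul0r.
apply: lim0_ext => t /tn0 t0.
have -> : t%:C%C ^+ j = t%:C%C ^+ (j - n) * t%:C%C ^+ n :> cx by rewrite -exprD subnK // ltnW.
rewrite invf_div.
move: (t%:C%C ^+ (j - n)) (t%:C%C ^+ n) (iter j _ _ _) (q _) => p s A B; ring.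
Qed.

(** * Jets of the entropy coefficients near a zero of [q] *)

Section Coefficient.
Variables (U : set E) (q k gam e2 e3 e4 : E -> cx) (z0 : E) (n : nat) (b : cx).
Hypotheses (oU : open U) (Uz0 : U z0) (Hq : hol U q) (Hk : hol U k).
Hypothesis n1 : (1 <= n)%N.
Hypothesis q0 : forall k, (k < n)%N -> iter k (@dz R) q z0 = 0.
Hypothesis qn : iter n (@dz R) q z0 != 0.
Let Om := [set z | U z /\ q z != 0].
Hypothesis gamE : forall z, Om z -> gam z = dz q z / (2 * q z).
Hypothesis e2E : forall z, Om z ->
  e2 z = dz gam z - 3 / 2 * gam z ^+ 2 + 2 * gam z * k z - dz k z - k z ^+ 2 / 2.
Hypothesis e3E : forall z, Om z -> e3 z = dz e2 z - 2 * gam z * e2 z.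
Hypothesis e4E : forall z, Om z -> e4 z = dz e3 z - 3 * gam z * e3 z.
Hypothesis e4b : forall z, Om z -> e4 z = b * e2 z ^+ 2.

Let qs j := iter j (@dz R) q.
Let ks j := iter j (@dz R) k.

(* [P2], ..., [P4] express the entropy coefficients through the jets of [gam] and
   [k], and [G0], ..., [G3] the jet of [gam] through the quotients [q^(j) / q].
   These polynomials are weighted homogeneous, so that [t ^+ 2 * e2] and
   [t ^+ 4 * e4] converge as [t] tends to [0] along the ray [z0 + t]: there
   [t ^+ j * q^(j) / q] tends to the falling factorial [n ^_ j], and
   [t ^+ j.+1 * k^(j)] to [0]. *)
Let P2 (g0 g1 k0 k1 : cx) : cx := g1 - 3 / 2 * g0 ^+ 2 + 2 * g0 * k0 - k1 - k0 ^+ 2 / 2.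
Let P2' (g0 g1 g2 k0 k1 k2 : cx) : cx :=
  g2 - 3 * g0 * g1 + 2 * g1 * k0 + 2 * g0 * k1 - k2 - k0 * k1.
Let P2'' (g0 g1 g2 g3 k0 k1 k2 k3 : cx) : cx :=
  g3 - 3 * g1 ^+ 2 - 3 * g0 * g2 + 2 * g2 * k0 + 4 * g1 * k1 + 2 * g0 * k2 - k3 - k1 ^+ 2 - k0 * k2.
Let P3 (g0 g1 g2 k0 k1 k2 : cx) := P2' g0 g1 g2 k0 k1 k2 - 2 * g0 * P2 g0 g1 k0 k1.
Let P4 (g0 g1 g2 g3 k0 k1 k2 k3 : cx) : cx :=
  P2'' g0 g1 g2 g3 k0 k1 k2 k3 - 2 * g1 * P2 g0 g1 k0 k1 - 2 * g0 * P2' g0 g1 g2 k0 k1 k2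
  - 3 * g0 * P3 g0 g1 g2 k0 k1 k2.

Let G0 (r1 : cx) : cx := r1 / 2.
Let G1 (r1 r2 : cx) : cx := (r2 - r1 ^+ 2) / 2.
Let G2 (r1 r2 r3 : cx) : cx := (r3 - 3 * r1 * r2 + 2 * r1 ^+ 3) / 2.
Let G3 (r1 r2 r3 r4 : cx) : cx :=
  (r4 - 4 * r3 * r1 - 3 * r2 ^+ 2 + 12 * r2 * r1 ^+ 2 - 6 * r1 ^+ 4) / 2.

Let oOm : open Om.
Proof.
have -> : Om = U `&` (fun x => nsq (q x)) @^-1` [set x : R | 0 < x].
  by apply/seteqP; split=> x [Ux] /=; rewrite lt0r nsq_eq0 nsq_ge0 andbT; split.
apply: open_setI_preim => // z Uz; exact: cder_cont_nsq (hol_cder Hq Uz).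
Qed.

Let r_ j z : cx := qs j z / q z.

(** The derivative of [q^(j) / q] is a polynomial in quotients of the same kind, so the jet of [gam]
    up to order 3 is polynomial in [r_ 1], ..., [r_ 4]. *)
Let dr j z : Om z -> cder (r_ j) z (r_ j.+1 z - r_ j z * r_ 1 z).
Proof.
move=> [Uz qz]; have d1 := hol_cder (hol_iter j Hq) Uz; have d2 := hol_cder Hq Uz.
apply: cder_eq (cder_div d1 d2 qz) _; rewrite /r_ /qs /=.
by move: (dz (iter _ _ _) z) (iter _ _ _ z) (dz q z) (q z) qz => a c d e e0; field.
Qed.

Let dk j z : Om z -> cder (ks j) z (ks j.+1 z).
Proof. by move=> [Uz _]; exact: hol_cder (hol_iter j Hk) Uz. Qed.

Let dz_on (f g : E -> cx) z d : Om z -> (forall w, Om w -> f w = g w) -> cder g z d -> dz f z = d.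
Proof.
move=> Oz fg dg; apply: cder_dz; apply: cder_near dg.
by apply: (open_near oOm Oz) => w Ow; rewrite fg.
Qed.

Let gam0 z : Om z -> gam z = G0 (r_ 1 z).
Proof. by move=> Oz; rewrite gamE // /G0 /r_ /qs /= invfM [X in _ * X]mulrC mulrA. Qed.

Let cderZ (c : cx) (f : E -> cx) z d : cder f z d -> cder (fun w => c * f w) z (c * d).
Proof. by move=> df; apply: cder_eq (cderM (cderC c z) df) _; rewrite mul0r add0r. Qed.

Let cderdiv2 (f : E -> cx) z d : cder f z d -> cder (fun w => f w / 2) z (d / 2).
Proof. by move=> df; apply: cder_eq (cderM df (cderC _ z)) _; rewrite mulr0 addr0. Qed.

Let cderXn m (f : E -> cx) z d : cder f z d -> cder (fun w => f w ^+ m) z (m%:R * f z ^+ m.-1 * d).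
Proof.
move=> df; elim: m => [|m IH].
  have -> : (fun w => f w ^+ 0) = fun=> 1 by apply: funext => w; rewrite expr0.
  by apply: cder_eq (cderC 1 z) _; rewrite !mul0r.
have -> : (fun w => f w ^+ m.+1) = (fun w => f w * f w ^+ m) by apply: funext => w; rewrite exprS.
apply: cder_eq (cderM df IH) _; case: m {IH} => [|m] /=; first by rewrite !expr0; ring.
by rewrite mulrSr [f z ^+ m.+1]exprS; ring.
Qed.

Let d_gam0 z : Om z -> cder (fun w => G0 (r_ 1 w)) z (G1 (r_ 1 z) (r_ 2 z)).
Proof.
move=> Oz; apply: cder_eq; first exact: cderdiv2 (dr 1 Oz).
by rewrite /G1 expr2.
Qed.

Let d_gam1 z : Om z -> cder (fun w => G1 (r_ 1 w) (r_ 2 w)) z (G2 (r_ 1 z) (r_ 2 z) (r_ 3 z)).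
Proof.
move=> Oz; apply: cder_eq.
  by apply: cderdiv2; apply: cderB; [exact: dr|apply: cderXn; exact: dr].
by rewrite /G2; move: (r_ 1 z) (r_ 2 z) (r_ 3 z) => a c d /=; field.
Qed.

Let d_gam2 z : Om z -> cder (fun w => G2 (r_ 1 w) (r_ 2 w) (r_ 3 w)) z
  (G3 (r_ 1 z) (r_ 2 z) (r_ 3 z) (r_ 4 z)).
Proof.
move=> Oz; apply: cder_eq.
  apply: cderdiv2; apply: cderD; last by apply: cderZ; apply: cderXn; exact: dr.
  by apply: cderB; [exact: dr|apply: cderM; [apply: cderZ; exact: dr|exact: dr]].
by rewrite /G3; move: (r_ 1 z) (r_ 2 z) (r_ 3 z) (r_ 4 z) => a c d e /=; field.
Qed.

Let g0 w := G0 (r_ 1 w).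
Let g1 w := G1 (r_ 1 w) (r_ 2 w).
Let g2 w := G2 (r_ 1 w) (r_ 2 w) (r_ 3 w).
Let g3 w := G3 (r_ 1 w) (r_ 2 w) (r_ 3 w) (r_ 4 w).

Let e2_jet z : Om z -> e2 z = P2 (g0 z) (g1 z) (ks 0 z) (ks 1 z).
Proof. by move=> Oz; rewrite e2E // gam0 // (dz_on Oz gam0 (d_gam0 Oz)). Qed.

Let d_e2 z : Om z -> cder (fun w => P2 (g0 w) (g1 w) (ks 0 w) (ks 1 w)) z
  (P2' (g0 z) (g1 z) (g2 z) (ks 0 z) (ks 1 z) (ks 2 z)).
Proof.
move=> Oz; have h0 : cder g0 z (g1 z) := d_gam0 Oz; have h1 : cder g1 z (g2 z) := d_gam1 Oz.
have K0 := dk 0 Oz; have K1 := dk 1 Oz.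
apply: cder_eq.
  apply: cderB; last by apply: cderdiv2; apply: cderXn; exact: K0.
  apply: cderB; last exact: K1.
  apply: cderD; last by apply: cderM; [apply: cderZ; exact: h0|exact: K0].
  by apply: cderB; [exact: h1|apply: cderZ; apply: cderXn; exact: h0].
by rewrite /P2'; move: (g0 z) (g1 z) (g2 z) (ks 0 z) (ks 1 z) (ks 2 z) => a c d e f h /=; field.
Qed.

Let d_e2' z : Om z -> cder (fun w => P2' (g0 w) (g1 w) (g2 w) (ks 0 w) (ks 1 w) (ks 2 w)) z
  (P2'' (g0 z) (g1 z) (g2 z) (g3 z) (ks 0 z) (ks 1 z) (ks 2 z) (ks 3 z)).
Proof.
move=> Oz; have h0 : cder g0 z (g1 z) := d_gam0 Oz; have h1 : cder g1 z (g2 z) := d_gam1 Oz.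
have h2 : cder g2 z (g3 z) := d_gam2 Oz.
have K0 := dk 0 Oz; have K1 := dk 1 Oz; have K2 := dk 2 Oz.
apply: cder_eq.
  apply: cderB; last by apply: cderM; [exact: K0|exact: K1].
  apply: cderB; last exact: K2.
  apply: cderD; last by apply: cderM; [apply: cderZ; exact: h0|exact: K1].
  apply: cderD; last by apply: cderM; [apply: cderZ; exact: h1|exact: K0].
  by apply: cderB; [exact: h2|apply: cderM; [apply: cderZ; exact: h0|exact: h1]].
by rewrite /P2''; move: (g0 z) (g1 z) (g2 z) (g3 z) (ks 0 z) (ks 1 z) (ks 2 z) (ks 3 z) => a c d e
  f h i j /=; ring.
Qed.

Let e3_jet z : Om z -> e3 z = P3 (g0 z) (g1 z) (g2 z) (ks 0 z) (ks 1 z) (ks 2 z).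
Proof. by move=> Oz; rewrite e3E // (dz_on Oz e2_jet (d_e2 Oz)) gam0 // e2_jet. Qed.

Let e4_jet z : Om z -> e4 z = P4 (g0 z) (g1 z) (g2 z) (g3 z) (ks 0 z) (ks 1 z) (ks 2 z) (ks 3 z).
Proof.
move=> Oz; rewrite e4E // gam0 // e3_jet //.
have d3 : cder (fun w => P3 (g0 w) (g1 w) (g2 w) (ks 0 w) (ks 1 w) (ks 2 w)) z
   (P2'' (g0 z) (g1 z) (g2 z) (g3 z) (ks 0 z) (ks 1 z) (ks 2 z) (ks 3 z)
    - ((2 * g1 z) * P2 (g0 z) (g1 z) (ks 0 z) (ks 1 z) + 2 * g0 z * P2' (g0 z) (g1 z) (g2 z) (ks 0
      z) (ks 1 z) (ks 2 z))).
  apply: cderB; first exact: d_e2'.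
  by apply: cderM; [apply: cderZ; exact: d_gam0|exact: d_e2].
by rewrite (dz_on Oz e3_jet d3) /P4 opprD !addrA.
Qed.

Let hom2 (t a0 a1 b0 b1 : cx) : t ^+ 2 * P2 a0 a1 b0 b1 = P2 (t * a0) (t ^+ 2 * a1) (t * b0) (t ^+
  2 * b1).
Proof. by rewrite /P2; field. Qed.

Let hom4 (t a0 a1 a2 a3 b0 b1 b2 b3 : cx) : t ^+ 4 * P4 a0 a1 a2 a3 b0 b1 b2 b3 =
  P4 (t * a0) (t ^+ 2 * a1) (t ^+ 3 * a2) (t ^+ 4 * a3) (t * b0) (t ^+ 2 * b1) (t ^+ 3 * b2) (t ^+
    4 * b3).
Proof. by rewrite /P4 /P3 /P2 /P2' /P2''; field. Qed.

Let hG0 (t r1 : cx) : G0 (t * r1) = t * G0 r1.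
Proof. by rewrite /G0 mulrA. Qed.
Let hG1 (t r1 r2 : cx) : G1 (t * r1) (t ^+ 2 * r2) = t ^+ 2 * G1 r1 r2.
Proof. by rewrite /G1; field. Qed.
Let hG2 (t r1 r2 r3 : cx) : G2 (t * r1) (t ^+ 2 * r2) (t ^+ 3 * r3) = t ^+ 3 * G2 r1 r2 r3.
Proof. by rewrite /G2; field. Qed.
Let hG3 (t r1 r2 r3 r4 : cx) :
  G3 (t * r1) (t ^+ 2 * r2) (t ^+ 3 * r3) (t ^+ 4 * r4) = t ^+ 4 * G3 r1 r2 r3 r4.
Proof. by rewrite /G3; field. Qed.

Let tR j (t : R) : cx := t%:C%C ^+ j * qs j (ray z0 t) / q (ray z0 t).
Let tK j (t : R) : cx := t%:C%C ^+ j.+1 * ks j (ray z0 t).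

Let limB (u v : R -> cx) a c : lim0 u a -> lim0 v c -> lim0 (fun t => u t - v t) (a - c).
Proof. by move=> Hu Hv; exact: (lim0D Hu (lim0N Hv)). Qed.

Let limX (u : R -> cx) a m : lim0 u a -> lim0 (fun t => u t ^+ m) (a ^+ m).
Proof.
move=> Hu; elim: m => [|m IH].
  have Et (t : R) : 0 < t -> 1 = u t ^+ 0 by rewrite expr0.
  by rewrite expr0; exact: (lim0_ext Et (lim0C 1)).
have Et (t : R) : 0 < t -> u t * u t ^+ m = u t ^+ m.+1 by rewrite [RHS]exprS.
by rewrite exprS; exact: (lim0_ext Et (lim0M Hu IH)).
Qed.

Let limK j : lim0 (tK j) 0.
Proof.
have H := ray_cont oU Uz0 (hol_iter j Hk).
have := lim0M (limX (m := j.+1) (@lim0_t)) H.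
by rewrite exprS mul0r mul0r.
Qed.

Let nn : cx := n%:R.

Let limR j : lim0 (tR j) (n ^_ j)%:R := @ray_ratio U q z0 n oU Uz0 Hq q0 qn j.

Let limG0 u1 l1 : lim0 u1 l1 -> lim0 (fun t => G0 (u1 t)) (G0 l1).
Proof. by move=> L1; exact: (lim0M L1 (lim0C _)). Qed.

Let limG1 u1 u2 l1 l2 : lim0 u1 l1 -> lim0 u2 l2 ->
  lim0 (fun t => G1 (u1 t) (u2 t)) (G1 l1 l2).
Proof. by move=> L1 L2; exact: (lim0M (limB L2 (limX (m := 2) L1)) (lim0C _)). Qed.

Let limG2 u1 u2 u3 l1 l2 l3 : lim0 u1 l1 -> lim0 u2 l2 -> lim0 u3 l3 ->
  lim0 (fun t => G2 (u1 t) (u2 t) (u3 t)) (G2 l1 l2 l3).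
Proof.
move=> L1 L2 L3; exact: (lim0M (lim0D (limB L3 (lim0M (lim0M (lim0C _) L1) L2))
  (lim0M (lim0C _) (limX (m := 3) L1))) (lim0C _)).
Qed.

Let limG3 u1 u2 u3 u4 l1 l2 l3 l4 : lim0 u1 l1 -> lim0 u2 l2 -> lim0 u3 l3 -> lim0 u4 l4 ->
  lim0 (fun t => G3 (u1 t) (u2 t) (u3 t) (u4 t)) (G3 l1 l2 l3 l4).
Proof.
move=> L1 L2 L3 L4.
exact: (lim0M (limB (lim0D (limB (limB L4 (lim0M (lim0M (lim0C _) L3) L1))
  (lim0M (lim0C _) (limX (m := 2) L2))) (lim0M (lim0M (lim0C _) L2) (limX (m := 2) L1)))
  (lim0M (lim0C _) (limX (m := 4) L1))) (lim0C _)).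
Qed.

Section LimP.
Variables (a0 a1 a2 a3 b0 b1 b2 b3 : R -> cx) (A0 A1 A2 A3 B0 B1 B2 B3 : cx).
Hypotheses (La0 : lim0 a0 A0) (La1 : lim0 a1 A1) (La2 : lim0 a2 A2) (La3 : lim0 a3 A3).
Hypotheses (Lb0 : lim0 b0 B0) (Lb1 : lim0 b1 B1) (Lb2 : lim0 b2 B2) (Lb3 : lim0 b3 B3).

Let limP2 : lim0 (fun t => P2 (a0 t) (a1 t) (b0 t) (b1 t)) (P2 A0 A1 B0 B1).
Proof.
exact: (limB (limB (lim0D (limB La1 (lim0M (lim0C _) (limX (m := 2) La0)))
  (lim0M (lim0M (lim0C _) La0) Lb0)) Lb1) (lim0M (limX (m := 2) Lb0) (lim0C _))).
Qed.

Let limP2' : lim0 (fun t => P2' (a0 t) (a1 t) (a2 t) (b0 t) (b1 t) (b2 t)) (P2' A0 A1 A2 B0 B1 B2).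
Proof.
exact: (limB (limB (lim0D (lim0D (limB La2 (lim0M (lim0M (lim0C _) La0) La1))
  (lim0M (lim0M (lim0C _) La1) Lb0)) (lim0M (lim0M (lim0C _) La0) Lb1)) Lb2) (lim0M Lb0 Lb1)).
Qed.

Let limP2'' : lim0 (fun t => P2'' (a0 t) (a1 t) (a2 t) (a3 t) (b0 t) (b1 t) (b2 t) (b3 t))
  (P2'' A0 A1 A2 A3 B0 B1 B2 B3).
Proof.
exact: (limB (limB (limB (lim0D (lim0D (lim0D (limB (limB La3 (lim0M (lim0C _) (limX (m := 2) La1)))
  (lim0M (lim0M (lim0C _) La0) La2)) (lim0M (lim0M (lim0C _) La2) Lb0))
  (lim0M (lim0M (lim0C _) La1) Lb1)) (lim0M (lim0M (lim0C _) La0) Lb2)) Lb3)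
  (limX (m := 2) Lb1)) (lim0M Lb0 Lb2)).
Qed.

Let limP3 : lim0 (fun t => P3 (a0 t) (a1 t) (a2 t) (b0 t) (b1 t) (b2 t)) (P3 A0 A1 A2 B0 B1 B2).
Proof. exact: (limB limP2' (lim0M (lim0M (lim0C _) La0) limP2)). Qed.

Lemma limP24 : lim0 (fun t => P2 (a0 t) (a1 t) (b0 t) (b1 t)) (P2 A0 A1 B0 B1) /\
  lim0 (fun t => P4 (a0 t) (a1 t) (a2 t) (a3 t) (b0 t) (b1 t) (b2 t) (b3 t))
    (P4 A0 A1 A2 A3 B0 B1 B2 B3).
Proof.
split; first exact: limP2.
exact: (limB (limB (limB limP2'' (lim0M (lim0M (lim0C _) La1) limP2))
  (lim0M (lim0M (lim0C _) La0) limP2')) (lim0M (lim0M (lim0C _) La0) limP3)).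
Qed.
End LimP.

Theorem umbilic_coefficient : 12 * (nn + 2) ^+ 2 + b * (3 * nn ^+ 2 + 4 * nn) = 0.
Proof.
have n0 : nn != 0 by rewrite pnatr_eq0 -lt0n.
have R1 : (n ^_ 1)%:R = nn by rewrite ffactn1.
have R2 : (n ^_ 2)%:R = nn * (nn - 1) by rewrite ffact_natS R1.
have R3 : (n ^_ 3)%:R = nn * (nn - 1) * (nn - 2) by rewrite ffact_natS R2.
have R4 : (n ^_ 4)%:R = nn * (nn - 1) * (nn - 2) * (nn - 3) by rewrite ffact_natS R3.
have L1 : lim0 (tR 1) nn by rewrite -R1; exact: limR.
have L2 : lim0 (tR 2) (nn * (nn - 1)) by rewrite -R2; exact: limR.
have L3 : lim0 (tR 3) (nn * (nn - 1) * (nn - 2)) by rewrite -R3; exact: limR.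
have L4 : lim0 (tR 4) (nn * (nn - 1) * (nn - 2) * (nn - 3)) by rewrite -R4; exact: limR.
(* The four values are the jet at [z = 1] of the model coefficient [n / (2 z)]. *)
have v0 : G0 nn = nn / 2 by [].
have v1 : G1 nn (nn * (nn - 1)) = - (nn / 2) by move: nn => x; rewrite /G1; field.
have v2 : G2 nn (nn * (nn - 1)) (nn * (nn - 1) * (nn - 2)) = nn by move: nn => x; rewrite /G2;
  field.
have v3 : G3 nn (nn * (nn - 1)) (nn * (nn - 1) * (nn - 2)) (nn * (nn - 1) * (nn - 2) * (nn - 3)) =
  - (3 * nn).
  by move: nn => x; rewrite /G3; field.
have LG0 := limG0 L1; rewrite v0 in LG0.
have LG1 := limG1 L1 L2; rewrite v1 in LG1.
have LG2 := limG2 L1 L2 L3; rewrite v2 in LG2.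
have LG3 := limG3 L1 L2 L3 L4; rewrite v3 in LG3.
have [LP2 LP4] := limP24 LG0 LG1 LG2 LG3 (limK 0) (limK 1) (limK 2) (limK 3).
(* [q] cannot vanish on the ray near 0: by the convention on division [tR 1] would then be 0,
   whereas it tends to [n], which is nonzero. *)
have Onear : \forall t \near 0^'+, Om (ray z0 t) /\ t != 0.
  have [r r0 Hr] : exists2 r : R, 0 < r & forall t, 0 <= t < r -> U (ray z0 t).
    by apply: ray_near; exact: open_nbhs_nbhs.
  have := lim0_neq0 L1 n0 => /near_right0[s s0 Hs].
  apply/near_right0; exists (Num.min r s); first by rewrite lt_min r0.
  move=> t /andP[t0]; rewrite lt_min => /andP[tr ts]; split; last by rewrite gt_eqF.
  split; first by apply: Hr; rewrite (ltW t0).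
  have := Hs t; rewrite t0 ts => /(_ isT); apply: contraNneq => qq.
  by rewrite /tR qq invr0 mulr0.
have key : lim0 (fun t => P4 (G0 (tR 1 t)) (G1 (tR 1 t) (tR 2 t)) (G2 (tR 1 t) (tR 2 t) (tR 3 t))
  (G3 (tR 1 t) (tR 2 t) (tR 3 t) (tR 4 t)) (tK 0 t) (tK 1 t) (tK 2 t) (tK 3 t))
   (b * P2 (nn / 2) (- (nn / 2)) 0 0 ^+ 2).
  apply: (lim0_near _ (lim0M (lim0C b) (limX (m := 2) LP2))).
  apply: filterS Onear => t [Oz t0].
  have rE j : tR j t = t%:C%C ^+ j * r_ j (ray z0 t) by rewrite /tR /r_ mulrA.
  have gE0 : G0 (tR 1 t) = t%:C%C * g0 (ray z0 t) by rewrite rE expr1 hG0.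
  have gE1 : G1 (tR 1 t) (tR 2 t) = t%:C%C ^+ 2 * g1 (ray z0 t) by rewrite !rE expr1 hG1.
  have gE2 : G2 (tR 1 t) (tR 2 t) (tR 3 t) = t%:C%C ^+ 3 * g2 (ray z0 t) by rewrite !rE expr1 hG2.
  have gE3 : G3 (tR 1 t) (tR 2 t) (tR 3 t) (tR 4 t) = t%:C%C ^+ 4 * g3 (ray z0 t) by rewrite !rE
    expr1 hG3.
  rewrite gE0 gE1 gE2 gE3 /tK expr1 -hom2 -hom4 -e2_jet // -e4_jet // e4b //.
  by move: (t%:C%C) (e2 _) => x y; ring.
have := lim0_unique LP4 key.
(* This is [3/2 (n + 2)^2] times [- (3 n^2 + 4 n) / 8], the limit of [t ^ 2 * e2]. *)
have -> : P4 (nn / 2) (- (nn / 2)) nn (- (3 * nn)) 0 0 0 0 = - (3 / 16) * (nn + 2) ^+ 2 * (3 * nn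
  ^+ 2 + 4 * nn).
  by move: nn => x; rewrite /P4 /P3 /P2 /P2' /P2''; field.
have -> : P2 (nn / 2) (- (nn / 2)) 0 0 = - (3 * nn ^+ 2 + 4 * nn) / 8 by move: nn => x;
  rewrite /P2; field.
have m0 : 3 * nn ^+ 2 + 4 * nn != 0.
  by rewrite /nn -natrX -!natrM -natrD pnatr_eq0 -lt0n addn_gt0 !muln_gt0 n1 orbT.
move=> H; apply: (mulfI m0).
(* The factor 64 clears the square of the denominator 8. *)
transitivity (64 * ((b * (- (3 * nn ^+ 2 + 4 * nn) / 8) ^+ 2) - (- (3 / 16) * (nn + 2) ^+ 2 * (3 *
  nn ^+ 2 + 4 * nn)))).
  by move: nn => x; field.
by rewrite -H subrr !mulr0.
Qed.

End Coefficient.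

End UmbilicAsymptotics.

(** * Immersed surfaces in coordinates *)

Section Surfaces.
Variable R : realType.
Local Notation E := 'rV[R]_2.
Local Notation pd i f := (partial (V := R^o) i f).
Local Notation dfb f z := (differentiable (f : E -> R^o) z).
Local Notation C k U f := (Cn (V := R^o) k U f).

Local Notation V3 := 'rV[R]_3.

(** * Vector algebra in dimension three and two by two matrices *)

Lemma ord3_ind (P : 'I_3 -> Prop) : P 0 -> P 1 -> P 2%:R -> forall i, P i.
Proof.
move=> P0 P1 P2 [[|[|[|//]]] Hi].
- by have -> : Ordinal Hi = 0 by exact: val_inj.
- by have -> : Ordinal Hi = 1 by exact: val_inj.
- by have -> : Ordinal Hi = 2%:R by exact: val_inj.
Qed.

Lemma rowP3 (u v : V3) : u 0 0 = v 0 0 -> u 0 1 = v 0 1 -> u 0 2%:R = v 0 2%:R -> u = v.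
Proof. by move=> h0 h1 h2; apply/rowP; apply: ord3_ind. Qed.

Lemma dotE (u v : V3) : dot u v = u 0 0 * v 0 0 + u 0 1 * v 0 1 + u 0 2%:R * v 0 2%:R.
Proof.
rewrite /dot !big_ord_recl big_ord0 addr0 addrA.
by congr (_ + u 0 _ * v 0 _ + u 0 _ * v 0 _); exact: val_inj.
Qed.

Lemma cross0E (u v : V3) : cross u v 0 0 = u 0 1 * v 0 2%:R - u 0 2%:R * v 0 1.
Proof. by rewrite !mxE !add0r. Qed.
Lemma cross1E (u v : V3) : cross u v 0 1 = u 0 2%:R * v 0 0 - u 0 0 * v 0 2%:R.
Proof.
rewrite !mxE.
have -> : 1 + 1 = 2%:R :> 'I_3 by [].
by have -> : 1 + 2%:R = 0 :> 'I_3 by exact: val_inj.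
Qed.
Lemma cross2E (u v : V3) : cross u v 0 2%:R = u 0 0 * v 0 1 - u 0 1 * v 0 0.
Proof.
rewrite !mxE.
have -> : 2%:R + 1 = 0 :> 'I_3 by exact: val_inj.
by have -> : 2%:R + 2%:R = 1 :> 'I_3 by exact: val_inj.
Qed.
Definition v3E := (dotE, cross0E, cross1E, cross2E).

Lemma dotC (u v : V3) : dot u v = dot v u.
Proof. by rewrite !dotE; ring. Qed.
Lemma dotZl a (u v : V3) : dot (a *: u) v = a * dot u v.
Proof. by rewrite !dotE !mxE; ring. Qed.
Lemma dotZr a (u v : V3) : dot u (a *: v) = a * dot u v.
Proof. by rewrite !dotE !mxE; ring. Qed.
Lemma dotDl (u u' v : V3) : dot (u + u') v = dot u v + dot u' v.
Proof. by rewrite !dotE !mxE; ring. Qed.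
Lemma dotDr (u v v' : V3) : dot u (v + v') = dot u v + dot u v'.
Proof. by rewrite !dotE !mxE; ring. Qed.

Lemma dot_ge0 (u : V3) : 0 <= dot u u.
Proof. by rewrite dotE -!expr2 !addr_ge0 ?sqr_ge0. Qed.
Lemma dot_eq0 (u : V3) : dot u u = 0 -> u = 0.
Proof.
rewrite dotE -!expr2 => /eqP; rewrite paddr_eq0 ?addr_ge0 ?sqr_ge0 // paddr_eq0 ?sqr_ge0 //.
rewrite !sqrf_eq0 => /andP[/andP[/eqP h0 /eqP h1] /eqP h2].
by apply: rowP3; rewrite mxE.
Qed.
Lemma lagrange_identity (u v : V3) :
  dot (cross u v) (cross u v) = dot u u * dot v v - dot u v ^+ 2.
Proof. by rewrite !v3E; ring. Qed.
Lemma dot_cross_l (u v : V3) : dot (cross u v) u = 0.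
Proof. by rewrite !v3E; ring. Qed.
Lemma dot_cross_r (u v : V3) : dot (cross u v) v = 0.
Proof. by rewrite !v3E; ring. Qed.

Lemma row_free_cross (u v : V3) : row_free (col_mx u v) -> 0 < dot (cross u v) (cross u v).
Proof.
move=> fr; rewrite lt0r dot_ge0 andbT; apply/eqP => n0.
have ker (a b : R) : a *: u + b *: v = 0 -> a = 0 /\ b = 0.
  move=> ab; have : row_mx a%:M b%:M *m col_mx u v = 0 *m col_mx u v.
    by rewrite mul_row_col !mul_scalar_mx ab mul0mx.
  move/(row_free_inj fr) => /matrixP H.
  have := H 0 (lshift 1 0); have := H 0 (rshift 1 0).
  by rewrite row_mxEl row_mxEr !mxE eqxx.
(* When the Gram determinant vanishes, the combination of [u] and [v] with these coefficients has
   length zero. Independence gives [v = 0], which contradicts independence in turn. *)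
have [vv _] : dot v v = 0 /\ - dot u v = 0.
  apply: ker; apply: dot_eq0; move: n0; rewrite lagrange_identity => n0.
  transitivity (dot v v * (dot u u * dot v v - dot u v ^+ 2)).
    by rewrite !dotE !mxE; ring.
  by rewrite n0 mulr0.
have := ker 0 1; rewrite scale0r scale1r add0r (dot_eq0 vv) => /(_ erefl)[_ /eqP].
by rewrite oner_eq0.
Qed.

Lemma det22 (A : 'M[R]_2) : \det A = A 0 0 * A 1 1 - A 0 1 * A 1 0.
Proof.
rewrite (expand_det_row _ 0) !big_ord_recl big_ord0 addr0 /cofactor !det_mx11 !mxE /=.
have l00 : lift (0 : 'I_2) 0 = 1 by exact: val_inj.
have l10 : lift (1 : 'I_2) 0 = 0 by exact: val_inj.
by rewrite l00 l10 /bump /= expr0 expr1 mul1r mulN1r mulrN.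
Qed.

Lemma jacE (s : E -> E) z : differentiable s z -> \det ('J s z) = jac s z.
Proof.
move=> ds; rewrite det22 /jac -!partial_entry // /partial !deriveE //.
by rewrite !mxE [X in _ - X]mulrC.
Qed.

Lemma tr_invmx22 (A B : 'M[R]_2) : \det A != 0 ->
  \tr (invmx A *m B) = (A 1 1 * B 0 0 - A 0 1 * B 1 0 - A 1 0 * B 0 1 + A 0 0 * B 1 1) / \det A.
Proof.
move=> dA; have uA : A \in unitmx by rewrite unitmxE unitfE.
(* The adjugate over the determinant; addition in ['I_2] is modulo 2, so [i + 1] is the other
   index. *)
pose A' : 'M[R]_2 := (\det A)^-1 *: \matrix_(i, j) (if i == j then A (i + 1) (j + 1) else - A i j).
have s01 : (0 + 1 : 'I_2) = 1 by exact: val_inj.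
have s11 : (1 + 1 : 'I_2) = 0 by exact: val_inj.
have -> : invmx A = A'.
  apply: (can_inj (mulmxK uA)); rewrite mulVmx //.
  apply/matrixP => i j; rewrite /A' -scalemxAl !mxE !big_ord_recl big_ord0 addr0 !mxE.
  have l00 : lift (0 : 'I_2) 0 = 1 by exact: val_inj.
  rewrite l00; apply: (mulfI dA); rewrite mulrA mulfV // mul1r det22.
  by elim/ord2_ind: i; elim/ord2_ind: j; rewrite /= ?s01 ?s11; ring.
rewrite /A' -scalemxAl mxtraceZ mulrC; congr (_ / _).
rewrite /mxtrace !big_ord_recl big_ord0 addr0 !mxE !big_ord_recl !big_ord0 !addr0 !mxE.
have l00 : lift (0 : 'I_2) 0 = 1 by exact: val_inj.
by rewrite l00 /= s01 s11; ring.
Qed.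

Lemma det_invmx_mul (A B : 'M[R]_2) : \det (invmx A *m B) = \det B / \det A.
Proof. by rewrite det_mulmx det_inv mulrC. Qed.

(* [gauss_map X c], [metric X c] and [second_form X c] are convertible to [gmap F],
   [fff F] and [sff F] for [F = local_immersion X c]. *)
Definition gmap (F : E -> V3) z : V3 :=
  let n := cross (partial 0 F z) (partial 1 F z) in (Num.sqrt (dot n n))^-1 *: n.
Definition fff (F : E -> V3) z : 'M[R]_2 :=
  \matrix_(i, j) dot (partial i F z) (partial j F z).
Definition sff (F : E -> V3) z : 'M[R]_2 :=
  \matrix_(i, j) - dot (partial i (gmap F) z) (partial j F z).

Lemma fffE F z i j : fff F z i j = dot (partial i F z) (partial j F z).
Proof. by rewrite mxE. Qed.
Lemma sffE F z i j : sff F z i j = - dot (partial i (gmap F) z) (partial j F z).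
Proof. by rewrite mxE. Qed.

Definition C3 k U (u : E -> V3) := forall j, C k U (fun w => u w 0 j).
Definition d3 (u : E -> V3) z := forall j, dfb (fun w => u w 0 j) z.

Lemma d3_diff u z : d3 u z -> differentiable u z.
Proof. exact: differentiable_row. Qed.

Lemma C3_d3 k U u z : C3 k.+1 U u -> U z -> d3 u z.
Proof. by move=> H Uz j; case: (H j) => + _; apply. Qed.

Lemma pd_entry3 u z i j : d3 u z -> partial i u z 0 j = pd i (fun w => u w 0 j) z.
Proof. by move=> du; rewrite partial_entry //; exact: d3_diff. Qed.

Lemma C3_partial k U u i : open U -> C3 k.+1 U u -> C3 k U (partial i u).
Proof.
move=> oU Hu j; have [_ /(_ i) H] := Hu j.
apply: (Cn_ext oU _ H) => z Uz.
by rewrite pd_entry3 //; exact: C3_d3 Hu Uz.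
Qed.

Lemma smooth_C3 k U u : open U -> Cn k U u -> C3 k U u.
Proof.
move=> oU; elim: k u => [|k IH] u Hu j.
  move=> z Uz; apply: (@continuous_comp _ _ R^o u (fun M => M 0 j)); first exact: Hu.
  by apply: differentiable_continuous; exact: differentiable_coord.
have [du Hu'] := Hu.
apply: (@Cn_step R R^o _ _ _ (fun i w => partial i u w 0 j)) => //.
- by move=> z Uz; apply: differentiable_entry; exact: du.
- by move=> i z Uz; rewrite partial_entry //; exact: du.
- by move=> i; exact: (IH _ (Hu' i) j).
Qed.

Lemma C_dot k U u v : open U -> C3 k U u -> C3 k U v -> C k U (fun w => dot (u w) (v w)).
Proof.
move=> oU Hu Hv; apply: (@Cn_ext R R^o _ _ (fun w => u w 0 0 * v w 0 0 + u w 0 1 * v w 0 1 + u w 0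
  2%:R * v w 0 2%:R)) => //.
  by move=> z _; rewrite dotE.
by apply: C_D => //; [apply: C_D => //|]; apply: C_M.
Qed.

Lemma C3_cross k U u v : open U -> C3 k U u -> C3 k U v -> C3 k U (fun w => cross (u w) (v w)).
Proof.
move=> oU Hu Hv; elim/ord3_ind.
- apply: (@Cn_ext R R^o _ _ (fun w => u w 0 1 * v w 0 2%:R - u w 0 2%:R * v w 0 1)) => //;
  first by move=> z _; rewrite cross0E.
  by apply: C_B => //; apply: C_M.
- apply: (@Cn_ext R R^o _ _ (fun w => u w 0 2%:R * v w 0 0 - u w 0 0 * v w 0 2%:R)) => //;
  first by move=> z _; rewrite cross1E.
  by apply: C_B => //; apply: C_M.
- apply: (@Cn_ext R R^o _ _ (fun w => u w 0 0 * v w 0 1 - u w 0 1 * v w 0 0)) => //;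
  first by move=> z _; rewrite cross2E.
  by apply: C_B => //; apply: C_M.
Qed.

Lemma C3_scale k U (a : E -> R) u : open U -> C k U a -> C3 k U u -> C3 k U (fun w => a w *: u w).
Proof.
move=> oU Ha Hu j; apply: (@Cn_ext R R^o _ _ (fun w => a w * u w 0 j)) => //.
  by move=> z _; rewrite mxE.
exact: C_M.
Qed.

Lemma partial_dot i u v z : d3 u z -> d3 v z ->
  pd i (fun w => dot (u w) (v w)) z = dot (partial i u z) (v z) + dot (u z) (partial i v z).
Proof.
move=> du dv.
have -> : (fun w => dot (u w) (v w)) = (fun w => u w 0 0 * v w 0 0 + u w 0 1 * v w 0 1 + u w 0 2%:R
  * v w 0 2%:R).
  by apply: funext => w; rewrite dotE.
have dm j : dfb (fun w => u w 0 j * v w 0 j) z by apply: differentiableM; [exact: du|exact: dv].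
have pm j : pd i (fun w => u w 0 j * v w 0 j) z = partial i u z 0 j * v z 0 j + u z 0 j * partial i
  v z 0 j.
  by rewrite partialM ?pd_entry3.
rewrite partialD ?pm; last exact: dm.
  rewrite partialD ?pm; [|exact: dm|exact: dm].
  by move: (partial i u z) (partial i v z) (u z) (v z) => a c d e; rewrite !dotE; ring.
by apply: differentiableD; exact: dm.
Qed.

Lemma partial_cross i u v z j : d3 u z -> d3 v z ->
  pd i (fun w => cross (u w) (v w) 0 j) z =
  cross (partial i u z) (v z) 0 j + cross (u z) (partial i v z) 0 j.
Proof.
move=> du dv.
have dm a b : dfb (fun w => u w 0 a * v w 0 b) z by apply: differentiableM; [exact: du|exact: dv].
have pm a b : pd i (fun w => u w 0 a * v w 0 b) z = partial i u z 0 a * v z 0 b + u z 0 a * partial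
  i v z 0 b.
  by rewrite partialM ?pd_entry3.
have pB a b c d : pd i (fun w => u w 0 a * v w 0 b - u w 0 c * v w 0 d) z =
    (partial i u z 0 a * v z 0 b - partial i u z 0 c * v z 0 d) + (u z 0 a * partial i v z 0 b - u
      z 0 c * partial i v z 0 d).
  apply: etrans (partialB i (dm a b) (dm c d)) _; rewrite (pm a b) (pm c d).
  by move: (partial i u z) (partial i v z) (u z) (v z) => *; ring.
elim/ord3_ind: j.
- have -> : (fun w => cross (u w) (v w) 0 0) = (fun w => u w 0 1 * v w 0 2%:R - u w 0 2%:R * v w 0
  1) by apply: funext => w; rewrite cross0E.
  by rewrite pB !cross0E.
- have -> : (fun w => cross (u w) (v w) 0 1) = (fun w => u w 0 2%:R * v w 0 0 - u w 0 0 * v w 0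
  2%:R) by apply: funext => w; rewrite cross1E.
  by rewrite pB !cross1E.
- have -> : (fun w => cross (u w) (v w) 0 2%:R) = (fun w => u w 0 0 * v w 0 1 - u w 0 1 * v w 0 0)
  by apply: funext => w; rewrite cross2E.
  by rewrite pB !cross2E.
Qed.

(** * The unit normal and the second fundamental form of an immersed patch *)

Section Surface.
Variables (U : set E) (F : E -> V3).
Hypotheses (oU : open U) (CF : forall k, C3 k U F).
Let p i := partial i F.
Let N := gmap F.
Hypothesis reg : forall z, U z -> 0 < dot (cross (p 0 z) (p 1 z)) (cross (p 0 z) (p 1 z)).

Let DD z := dot (cross (p 0 z) (p 1 z)) (cross (p 0 z) (p 1 z)).

Lemma surf_Cp k i : C3 k U (p i).
Proof. exact: C3_partial. Qed.

Lemma surf_CN k : C3 k U N.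
Proof.
apply: C3_scale => //; last by apply: C3_cross => //; exact: surf_Cp.
apply: C_V => //.
  by move=> z Uz; rewrite gt_eqF // sqrtr_gt0 reg.
by apply: C_sqrt => //; apply: C_dot => //; apply: C3_cross => //; exact: surf_Cp.
Qed.

Lemma surf_NN z : U z -> dot (N z) (N z) = 1.
Proof.
move=> Uz; rewrite /N /gmap dotZl dotZr mulrA -expr2 exprVn sqr_sqrtr; last exact: dot_ge0.
by rewrite mulVf // gt_eqF // reg.
Qed.

Lemma surf_Np i z : dot (N z) (p i z) = 0.
Proof.
rewrite /N /gmap /p dotZl; elim/ord2_ind: i.
  by rewrite dot_cross_l mulr0.
by rewrite dot_cross_r mulr0.
Qed.

Lemma surf_dp i z : U z -> d3 (p i) z. Proof. exact: C3_d3 (surf_Cp 1 i). Qed.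
Lemma surf_dN z : U z -> d3 N z. Proof. exact: C3_d3 (surf_CN 1). Qed.

Lemma surf_dNN i z : U z -> dot (partial i N z) (N z) = 0.
Proof.
move=> Uz; have := partial_dot i (surf_dN Uz) (surf_dN Uz).
rewrite (near_partial i (open_near oU Uz surf_NN)) partialC (dotC (N z)) => /eqP.
by rewrite -mulr2n eq_sym mulrn_eq0 /= => /eqP.
Qed.

Lemma surf_dNn i z : U z -> dot (partial i N z) (cross (p 0 z) (p 1 z)) = 0.
Proof.
move=> Uz; have sq0 : (Num.sqrt (dot (cross (p 0 z) (p 1 z)) (cross (p 0 z) (p 1 z))))^-1 != 0.
  by rewrite invr_neq0 // gt_eqF // sqrtr_gt0 reg.
apply: (mulfI sq0); rewrite mulr0 -(surf_dNN i Uz).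
by symmetry; exact: dotZr.
Qed.

(** Comes from differentiating [dot (N z) (p j z) = 0]; with [surf_mixed] it yields the symmetry of
    the second form, and later the expression of the Hopf coefficient through [phi]. *)
Lemma surf_dNp i j z : U z -> - dot (partial i N z) (p j z) = dot (N z) (partial i (p j) z).
Proof.
move=> Uz; have := partial_dot i (surf_dN Uz) (surf_dp j Uz).
have -> : (fun w => dot (N w) (p j w)) = fun=> 0 by apply: funext => w; rewrite surf_Np.
by rewrite partialC => /eqP; rewrite eq_sym addrC addr_eq0 => /eqP ->.
Qed.

Lemma surf_mixed z : U z -> partial 1 (p 0) z = partial 0 (p 1) z.
Proof.
move=> Uz; apply/rowP => j.
apply: etrans (pd_entry3 1 j (surf_dp 0 Uz)) _.
apply: etrans _ (esym (pd_entry3 0 j (surf_dp 1 Uz))).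
have e i : forall w, U w -> p i w 0 j = pd i (fun w => F w 0 j) w.
  by move=> w Uw; rewrite /p pd_entry3 //; exact: C3_d3 (CF 1) Uw.
apply: etrans (near_partial 1 (open_near oU Uz (e 0))) _.
apply: etrans _ (esym (near_partial 0 (open_near oU Uz (e 1)))).
by symmetry; apply: mixed_partial oU (CF 2%N j) Uz.
Qed.

Lemma surf_det_fff z : \det (fff F z) = DD z.
Proof.
rewrite det22 !fffE /DD /p; move: (partial 0 F z) (partial 1 F z) => a b.
by rewrite lagrange_identity (dotC b) expr2.
Qed.

Lemma surf_minimal z : U z -> \tr (invmx (fff F z) *m sff F z) / 2 = 0 ->
  dot (p 1 z) (p 1 z) * sff F z 0 0 - dot (p 0 z) (p 1 z) * (sff F z 1 0 + sff F z 0 1)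
  + dot (p 0 z) (p 0 z) * sff F z 1 1 = 0.
Proof.
move=> Uz /eqP; rewrite mulf_eq0 invr_eq0 pnatr_eq0 orbF.
rewrite tr_invmx22; last by rewrite surf_det_fff gt_eqF // reg.
rewrite mulf_eq0 invr_eq0 surf_det_fff [DD z == 0]gt_eqF ?reg // orbF => /eqP.
rewrite !fffE /p; move: (partial 0 F z) (partial 1 F z) (sff F z 0 0) (sff F z 1 0) (sff F z 0 1)
  (sff F z 1 1) => a b c d e f.
rewrite (dotC b a) => H; rewrite -[RHS]H; move: (dot a a) (dot a b) (dot b b) => *; ring.
Qed.

(* For a minimal surface the vector valued form [N x dF] is closed: its
   exterior derivative is [2 H N] times the area form. *)
Lemma surf_conjugate_closed z : U z -> \tr (invmx (fff F z) *m sff F z) / 2 = 0 ->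
  forall j, pd 1 (fun w => - cross (N w) (p 0 w) 0 j) z = pd 0 (fun w => - cross (N w) (p 1 w) 0 j)
    z.
Proof.
move=> Uz H0.
have dN := surf_dN Uz; have d0 := surf_dp 0 Uz; have d1 := surf_dp 1 Uz.
(* Both sides are normal vectors, since the derivatives of [N] and of [F] are tangent. Only their
   components along [cross a b] have to be compared, and these differ by the numerator of the mean
   curvature. *)
have main : cross (partial 1 N z) (p 0 z) = cross (partial 0 N z) (p 1 z).
  have := surf_minimal Uz H0; rewrite !sffE -/N -/(p 0 z) -/(p 1 z).
  have := surf_dNn 0 Uz; have := surf_dNn 1 Uz; have := reg Uz.
  move: (p 0 z) (p 1 z) (partial 0 N z) (partial 1 N z) => a b c d n0 dn cn Hm.
  have key (u v : V3) : dot u (cross a b) = 0 -> dot v (cross a b) = 0 -> forall j,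
     dot (cross a b) (cross a b) * cross u v 0 j = dot (cross u v) (cross a b) * cross a b 0 j.
    move=> un vn j; apply/eqP; rewrite -subr_eq0; apply/eqP.
    transitivity (cross (cross a b) v 0 j * dot u (cross a b) - cross (cross a b) u 0 j * dot v
      (cross a b)).
      by elim/ord3_ind: j; rewrite !v3E; ring.
    by rewrite un vn !mulr0 subrr.
  have an : dot a (cross a b) = 0 by rewrite dotC dot_cross_l.
  have bn : dot b (cross a b) = 0 by rewrite dotC dot_cross_r.
  apply/rowP => j; apply: (mulfI (lt0r_neq0 n0)); rewrite (key _ _ dn an) (key _ _ cn bn);
    congr (_ * _).
  apply/eqP; rewrite -subr_eq0; apply/eqP; rewrite -[RHS]Hm.
  by rewrite !v3E; ring.
move=> j; have dc i : dfb (fun w => cross (N w) (p i w) 0 j) z.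
  by have [+ _] := C3_cross oU (surf_CN 1) (surf_Cp 1 i) j; apply.
have e i l : pd i (fun w => - cross (N w) (p l w) 0 j) z =
    - (cross (partial i N z) (p l z) 0 j + cross (N z) (partial i (p l) z) 0 j).
  exact: (etrans (partialN i (dc l)) (congr1 -%R (partial_cross i j dN (surf_dp l Uz)))).
have mid : - (cross (partial 1 N z) (p 0 z) 0 j + cross (N z) (partial 1 (p 0) z) 0 j)
   = - (cross (partial 0 N z) (p 1 z) 0 j + cross (N z) (partial 0 (p 1) z) 0 j).
  exact: (congr1 -%R (congr2 +%R (congr1 (fun v : V3 => v 0 j) main)
    (congr1 (fun v : V3 => cross (N z) v 0 j) (surf_mixed Uz)))).
exact: (etrans (e 1 0) (etrans mid (esym (e 0 1)))).
Qed.

End Surface.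

Lemma partial_comp3 i (u : E -> V3) (s : E -> E) z : differentiable s z -> d3 u (s z) ->
  partial i (fun w => u (s w)) z =
  pd i (fun w => s w 0 0) z *: partial 0 u (s z) + pd i (fun w => s w 0 1) z *: partial 1 u (s z).
Proof.
move=> ds du.
have dus : d3 (fun w => u (s w)) z.
  by move=> j; exact: (@differentiable_comp R E E R^o s (fun w => u w 0 j) z ds (du j)).
apply/rowP => j; apply: etrans (pd_entry3 i j dus) _.
apply: etrans (partial_comp i ds (du j)) _.
rewrite mxE; congr (_ + _); rewrite mxE; congr (_ * _); symmetry; exact: pd_entry3.
Qed.

(** * Behaviour of the fundamental forms under oriented changes of coordinates *)

Section ChangeOfCoordinates.
Variables (W V : set E) (Fa Fb : E -> V3) (s : E -> E).
Hypotheses (oW : open W) (oV : open V) (sWV : forall z, W z -> V (s z)).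
Hypothesis FaE : forall z, W z -> Fa z = Fb (s z).
Hypothesis Cs : forall k j, C k W (fun w => s w 0 j).
Hypothesis Js : forall z, W z -> 0 < jac s z.
Hypothesis CFb : forall k, C3 k V Fb.
Hypothesis regb : forall z, V z ->
  0 < dot (cross (partial 0 Fb z) (partial 1 Fb z)) (cross (partial 0 Fb z) (partial 1 Fb z)).

Let c i j z := pd i (fun w => s w 0 j) z.

Let ds z : W z -> differentiable s z.
Proof. by move=> Wz; apply: differentiable_row => j; case: (Cs 1%N j) => + _; apply. Qed.

Lemma change_partial z i : W z ->
  partial i Fa z = c i 0 z *: partial 0 Fb (s z) + c i 1 z *: partial 1 Fb (s z).
Proof.
move=> Wz; apply: etrans (near_partial i (open_near oW Wz FaE)) _.
apply: partial_comp3; first exact: ds.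
by apply: C3_d3 (CFb 1) _; exact: sWV.
Qed.

Let cross_lin (a b : V3) x y u v :
  cross (x *: a + y *: b) (u *: a + v *: b) = (x * v - y * u) *: cross a b.
Proof. by apply: rowP3; rewrite mxE ?(cross0E, cross1E, cross2E) !mxE; ring. Qed.

Let cross_ab z : W z -> cross (partial 0 Fa z) (partial 1 Fa z) =
  jac s z *: cross (partial 0 Fb (s z)) (partial 1 Fb (s z)).
Proof.
move=> Wz; apply: etrans (congr2 (@cross R) (change_partial 0 Wz) (change_partial 1 Wz)) _.
apply: etrans (cross_lin _ _ _ _ _ _) _; congr (_ *: _); rewrite /jac /c.
move: (pd 0 _ z) (pd 1 _ z) (pd 1 _ z) (pd 0 _ z) => *; ring.
Qed.

(** The cross product is multiplied by [jac s]; its positivity, that is the orientation, leaves the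
    unit normal unchanged. *)
Lemma change_gmap z : W z -> gmap Fa z = gmap Fb (s z).
Proof.
move=> Wz; rewrite /gmap (cross_ab Wz); have J := Js Wz.
move: (cross (partial 0 Fb (s z)) (partial 1 Fb (s z))) (jac s z) J => n j j0.
rewrite dotZl dotZr mulrA -expr2 sqrtrM ?sqr_ge0 // sqrtr_sqr gtr0_norm // scalerA.
by rewrite invfM mulrAC mulVf ?mul1r // gt_eqF.
Qed.

Lemma change_dgmap z i : W z -> partial i (gmap Fa) z =
  c i 0 z *: partial 0 (gmap Fb) (s z) + c i 1 z *: partial 1 (gmap Fb) (s z).
Proof.
move=> Wz; apply: etrans (near_partial i (open_near oW Wz change_gmap)) _.
apply: partial_comp3; first exact: ds.
by apply: (surf_dN oV CFb regb); exact: sWV.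
Qed.

Let dot_lin (a b d e : V3) x y u v :
  dot (x *: a + y *: b) (u *: d + v *: e) =
  x * u * dot a d + x * v * dot a e + y * u * dot b d + y * v * dot b e.
Proof. by rewrite dotDl !dotDr !dotZl !dotZr; ring. Qed.

Let dot_linN (a b d e : V3) x y u v :
  - dot (x *: a + y *: b) (u *: d + v *: e) =
  x * u * - dot a d + x * v * - dot a e + y * u * - dot b d + y * v * - dot b e.
Proof. by rewrite dot_lin; ring. Qed.

Lemma change_fff z i j : W z -> fff Fa z i j =
  c i 0 z * c j 0 z * fff Fb (s z) 0 0 + c i 0 z * c j 1 z * fff Fb (s z) 0 1 +
  c i 1 z * c j 0 z * fff Fb (s z) 1 0 + c i 1 z * c j 1 z * fff Fb (s z) 1 1.
Proof.
move=> Wz; apply: etrans (fffE _ _ _ _) _.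
apply: etrans (congr2 (@dot R) (change_partial i Wz) (change_partial j Wz)) _.
apply: etrans (dot_lin _ _ _ _ _ _ _ _) _.
by congr (_ * _ + _ * _ + _ * _ + _ * _); symmetry; exact: fffE.
Qed.

Lemma change_sff z i j : W z -> sff Fa z i j =
  c i 0 z * c j 0 z * sff Fb (s z) 0 0 + c i 0 z * c j 1 z * sff Fb (s z) 0 1 +
  c i 1 z * c j 0 z * sff Fb (s z) 1 0 + c i 1 z * c j 1 z * sff Fb (s z) 1 1.
Proof.
move=> Wz; apply: etrans (sffE _ _ _ _) _.
apply: etrans (congr1 -%R (congr2 (@dot R) (change_dgmap i Wz) (change_partial j Wz))) _.
apply: etrans (dot_linN _ _ _ _ _ _ _ _) _.
by congr (_ * _ + _ * _ + _ * _ + _ * _); symmetry; exact: sffE.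
Qed.

(** Both fundamental forms are transformed by congruence, so both determinants acquire the factor
    [jac s ^ 2], which cancels in the quotient. *)
Lemma change_curvature z : W z ->
  \det (invmx (fff Fa z) *m sff Fa z) = \det (invmx (fff Fb (s z)) *m sff Fb (s z)).
Proof.
move=> Wz.
have := change_fff 0 0 Wz; have := change_fff 0 1 Wz; have := change_fff 1 0 Wz;
  have := change_fff 1 1 Wz.
have := change_sff 0 0 Wz; have := change_sff 0 1 Wz; have := change_sff 1 0 Wz;
  have := change_sff 1 1 Wz.
have D0 : \det (fff Fb (s z)) != 0.
  by rewrite surf_det_fff gt_eqF // regb //; exact: sWV.
have : jac s z != 0 by rewrite gt_eqF // Js.
rewrite /jac -/(c 0 0 z) -/(c 1 1 z) -/(c 1 0 z) -/(c 0 1 z); move: D0.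
move: (fff Fb (s z)) (sff Fb (s z)) (fff Fa z) (sff Fa z) => A B A' B'.
move: (c 0 0 z) (c 0 1 z) (c 1 0 z) (c 1 1 z) => x y u v.
rewrite !det_invmx_mul !det22.
move: (A 0 0) (A 0 1) (A 1 0) (A 1 1) (B 0 0) (B 0 1) (B 1 0) (B 1 1).
move=> a00 a01 a10 a11 b00 b01 b10 b11 D0 J0 -> -> -> -> -> -> -> ->.
have -> : (x * x * b00 + x * y * b01 + y * x * b10 + y * y * b11) * (u * u * b00 + u * v * b01 + v
  * u * b10 + v * v * b11)
 - (x * u * b00 + x * v * b01 + y * u * b10 + y * v * b11) * (u * x * b00 + u * y * b01 + v * x *
   b10 + v * y * b11)
 = (x * v - u * y) ^+ 2 * (b00 * b11 - b01 * b10) by ring.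
have -> : (x * x * a00 + x * y * a01 + y * x * a10 + y * y * a11) * (u * u * a00 + u * v * a01 + v
  * u * a10 + v * v * a11)
 - (x * u * a00 + x * v * a01 + y * u * a10 + y * v * a11) * (u * x * a00 + u * y * a01 + v * x *
   a10 + v * y * a11)
 = (x * v - u * y) ^+ 2 * (a00 * a11 - a01 * a10) by ring.
by rewrite -mulf_div divff ?mul1r // expf_neq0.
Qed.

End ChangeOfCoordinates.

(* Isothermal coordinates: a coordinate function [u] of a minimal immersion is
   harmonic, so it has a conjugate harmonic function [v], a primitive of the
   closed form [- (N x dF)]; the pair [(u, v)] is isothermal. *)
Section Isothermal.
Variables (U : set E) (F : E -> V3).
Hypotheses (oU : open U) (CF : forall k, C3 k U F).
Hypothesis reg : forall z, U z ->
  0 < dot (cross (partial 0 F z) (partial 1 F z)) (cross (partial 0 F z) (partial 1 F z)).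
Hypothesis min : forall z, U z -> \tr (invmx (fff F z) *m sff F z) / 2 = 0.

Let cross_gmap (a b : V3) (d : R) j :
  - cross (d *: cross a b) a 0 j = - d * (dot a a * b 0 j - dot a b * a 0 j) /\
  - cross (d *: cross a b) b 0 j = d * (dot b b * a 0 j - dot a b * b 0 j).
Proof.
have sc k : (d *: cross a b) 0 k = d * cross a b 0 k by rewrite [LHS]mxE.
by elim/ord3_ind: j; rewrite !(cross0E, cross1E, cross2E, sc, dotE); split; ring.
Qed.

Let sumsq_gt0 (x y : R) : ~ (x = 0 /\ y = 0) -> 0 < x ^+ 2 + y ^+ 2.
Proof.
move=> H; rewrite lt0r addr_ge0 ?sqr_ge0 // andbT; apply/eqP => /eqP.
by rewrite paddr_eq0 ?sqr_ge0 // !sqrf_eq0 => /andP[/eqP h0 /eqP h1]; apply: H.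
Qed.

Let open_sumsq (V : set E) (f g : E -> R) : open V -> C 0 V f -> C 0 V g ->
  open (V `&` [set z | 0 < f z ^+ 2 + g z ^+ 2]).
Proof.
move=> oV Cf Cg.
apply: (@open_setI_preim _ _ V [set x : R | x > 0] (fun z => f z ^+ 2 + g z ^+ 2)) => // z Vz.
have -> : (fun z => f z ^+ 2 + g z ^+ 2) = (fun z => f z * f z + g z * g z) by apply: funext => w;
  rewrite !expr2.
have H : C 0 V (fun z => f z * f z + g z * g z) by apply: C_D => //; apply: C_M.
exact: H.
Qed.

(** Here [(a, b)] and [(c, d)] are the differentials of the pair, [W] is the area density and
    [(c, d)] is the Hodge star of [(a, b)]. Up to the factor [det g], the last two conclusions say
    that these covectors have equal length and are orthogonal for the dual metric. *)
Let isothermal_algebra (g00 g01 g11 x y W a b c d : R) :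
  0 <= g00 -> 0 < g00 * g11 - g01 * g01 -> W ^+ 2 = g00 * g11 - g01 * g01 -> 0 < W ->
  a = x -> b = y ->
  c = - W^-1 * (g00 * y - g01 * x) -> d = W^-1 * (g11 * x - g01 * y) ->
  0 < x ^+ 2 + y ^+ 2 ->
  0 < a * d - b * c /\
  g00 * d ^+ 2 - 2 * g01 * c * d + g11 * c ^+ 2 = g00 * b ^+ 2 - 2 * g01 * a * b + g11 * a ^+ 2 /\
  g00 * b * d - g01 * (a * d + b * c) + g11 * a * c = 0.
Proof.
move=> g00_ge0 D0 sqW W0 -> -> -> -> xy.
have g000 : 0 < g00.
  rewrite lt0r g00_ge0 andbT; apply/eqP => g00z.
  by move: D0; rewrite g00z mul0r sub0r oppr_gt0 ltNge -expr2 sqr_ge0.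
have Wn : W != 0 by rewrite gt_eqF.
split; last split.
- rewrite [X in 0 < X](_ : _ = (g11 * x ^+ 2 - 2 * g01 * x * y + g00 * y ^+ 2) / W); last by field.
  rewrite divr_gt0 //.
  have : 0 < g00 * (g11 * x ^+ 2 - 2 * g01 * x * y + g00 * y ^+ 2).
    have -> : g00 * (g11 * x ^+ 2 - 2 * g01 * x * y + g00 * y ^+ 2) = (g00 * y - g01 * x) ^+ 2 +
      (g00 * g11 - g01 * g01) * x ^+ 2 by ring.
    have [x0|x0] := eqVneq x 0.
      move: xy; rewrite x0 mulr0 subr0 expr0n /= mulr0 addr0 add0r => y0.
      by rewrite exprMn mulr_gt0 // exprn_gt0.
    by rewrite ltr_wpDl ?sqr_ge0 // mulr_gt0 // exprn_even_gt0.
  by rewrite pmulr_rgt0.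
- have e1 : W ^+ 2 * (g00 * (W^-1 * (g11 * x - g01 * y)) ^+ 2 - 2 * g01 * (- W^-1 * (g00 * y - g01
  * x)) * (W^-1 * (g11 * x - g01 * y)) + g11 * (- W^-1 * (g00 * y - g01 * x)) ^+ 2)
     = (g00 * g11 - g01 * g01) * (g00 * y ^+ 2 - 2 * g01 * x * y + g11 * x ^+ 2) by field.
  by apply: (mulfI (expf_neq0 2 Wn)); rewrite e1 -sqW; ring.
- by field.
Qed.

Theorem isothermal_coordinates z0 : U z0 ->
  exists (V : set E) (s : E -> E), [/\ open V /\ V z0, V `<=` U, forall k j, C k V (fun w => s w 0
    j) &
    forall z, V z -> 0 < jac s z /\
     let: g := fff F z in
     let: a := pd 0 (fun w => s w 0 0) z in let: b := pd 1 (fun w => s w 0 0) z in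
     let: c := pd 0 (fun w => s w 0 1) z in let: d := pd 1 (fun w => s w 0 1) z in
     g 0 0 * d ^+ 2 - 2 * g 0 1 * c * d + g 1 1 * c ^+ 2 =
       g 0 0 * b ^+ 2 - 2 * g 0 1 * a * b + g 1 1 * a ^+ 2 /\
     g 0 0 * b * d - g 0 1 * (a * d + b * c) + g 1 1 * a * c = 0].
Proof.
move=> Uz0.
(* Some coordinate function has nonzero gradient at [z0], since otherwise both tangent vectors and
   their cross product would vanish. *)
have [i Hi] : exists i, ~ (partial 0 F z0 0 i = 0 /\ partial 1 F z0 0 i = 0).
  apply: contrapT => H; have := reg Uz0.
  move: H; move: (partial 0 F z0) (partial 1 F z0) => a b H.
  have ai j : a 0 j = 0.
    by apply: contrapT => aj; apply: H; exists j => -[].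
  by rewrite v3E !(cross0E, cross1E, cross2E) !ai !mul0r !subr0 !mul0r !addr0 ltxx.
pose N := gmap F.
pose A (w : E) := - cross (N w) (partial 0 F w) 0 i.
pose B (w : E) := - cross (N w) (partial 1 F w) 0 i.
have CN k : C3 k U N := surf_CN oU CF reg k.
have Cp k l : C3 k U (partial l F) := surf_Cp oU CF k l.
have CA k : C k U A by apply: C_N => //; exact: (C3_cross oU (CN k) (Cp k 0) i).
have CB k : C k U B by apply: C_N => //; exact: (C3_cross oU (CN k) (Cp k 1) i).
have [V1 [v [oV1 V1z V1U Cv dv]]] := primitive oU Uz0 CA CB (fun z Uz => surf_conjugate_closed oU
  CF reg Uz (min Uz) i).
pose s (w : E) : E := pt (F w 0 i) (v w).
have s0 : (fun w => s w 0 0) = (fun w => F w 0 i) by apply: funext => w; rewrite pt0.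
have s1 : (fun w => s w 0 1) = v by apply: funext => w; rewrite pt1.
have Cs k j : C k V1 (fun w => s w 0 j).
  elim/ord2_ind: j; rewrite ?s0 ?s1 //.
  by apply: (@Cn_sub _ _ _ U) => //; exact: (CF k i).
pose V := V1 `&` [set z | partial 0 F z 0 i ^+ 2 + partial 1 F z 0 i ^+ 2 > 0].
have oV : open V.
  by apply: (@open_sumsq V1 (fun z => partial 0 F z 0 i) (fun z => partial 1 F z 0 i)) => //;
     apply: (@Cn_sub _ _ _ U) => //; exact: (Cp 0%N).
exists V, s; split.
- by split => //; split => //; exact: sumsq_gt0.
- by move=> z [/V1U].
- by move=> k j; apply: (@Cn_sub _ _ _ V1) => [z []|].
move=> z [V1z' /= xy]; have Uz := V1U _ V1z'.
have [v0 v1] := dv z V1z'.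
have dF : d3 F z := C3_d3 (CF 1) Uz.
have q l : pd l (fun w => s w 0 0) z = partial l F z 0 i.
  by rewrite s0; symmetry; exact: (pd_entry3 l i dF).
have detE := surf_det_fff F z; rewrite det22 in detE.
have D0 := reg Uz; rewrite -detE in D0.
have sq := etrans (sqr_sqrtr (dot_ge0 (cross (partial 0 F z) (partial 1 F z)))) (esym detE).
have Ws : 0 < Num.sqrt (dot (cross (partial 0 F z) (partial 1 F z)) (cross (partial 0 F z) (partial
  1 F z))).
  by rewrite sqrtr_gt0 reg.
have [A0 B0] := cross_gmap (partial 0 F z) (partial 1 F z)
  (Num.sqrt (dot (cross (partial 0 F z) (partial 1 F z)) (cross (partial 0 F z) (partial 1 F
    z))))^-1 i.
have c0 := etrans (congr1 (fun h : E -> R => pd 0 h z) s1) v0.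
have c1 := etrans (congr1 (fun h : E -> R => pd 1 h z) s1) v1.
cbv beta delta [A B N gmap] in c0, c1.
have c0' := etrans (etrans c0 A0) (esym (congr2 (fun e f => - _^-1 * (e * partial 1 F z 0 i - f *
  partial 0 F z 0 i))
    (fffE F z 0 0) (fffE F z 0 1))).
have c1' := etrans (etrans c1 B0) (esym (congr2 (fun e f => _^-1 * (e * partial 0 F z 0 i - f *
  partial 1 F z 0 i))
    (fffE F z 1 1) (fffE F z 0 1))).
have f01 : fff F z 1 0 = fff F z 0 1 := etrans (fffE F z 1 0) (etrans (dotC _ _) (esym (fffE F z 0
  1))).
have g0 := dot_ge0 (partial 0 F z); rewrite -(fffE F z 0 0) in g0.
rewrite f01 in D0 sq.
exact: (isothermal_algebra g0 D0 sq Ws (q 0) (q 1) c0' c1' xy).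
Qed.

End Isothermal.

End Surfaces.

(** * Minimal surfaces in conformal coordinates *)

Section ConformalMinimalSurfaces.
Variable R : realType.
Local Notation E := 'rV[R]_2.
Local Notation pd i f := (partial (V := R^o) i f).
Local Notation dfb f z := (differentiable (f : E -> R^o) z).
Local Notation C k U f := (Cn (V := R^o) k U f).
Local Notation Re := complex.Re.
Local Notation Im := complex.Im.
Local Notation cx := (R[i]).

Local Notation V3 := 'rV[R]_3.

(** Allows a function to be written with different denominators near different points, as happens
    for the Hopf coefficient. *)
Lemma hol_local (U : set E) (f : E -> cx) :
  (forall z, U z -> exists2 V : set E, V z & hol V f) -> hol U f.
Proof.
move=> H k; elim: k f H => //= k IH f H; split.
  by move=> z /H[V Vz Hf]; exact: hol_cder Hf Vz.
by apply: IH => z /H[V Vz Hf]; exists V => //; exact: hol_dz.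
Qed.

Lemma hol_open_neq0 (U : set E) (f : E -> cx) : open U -> hol U f ->
  open [set z | U z /\ f z != 0].
Proof.
move=> oU Hf; rewrite openE => z [Uz fz].
have [df _ _] := hol_cder Hf Uz.
by apply: filterS2 (open_nbhs_nbhs (conj oU Uz)) (cdiff_neq0 df fz) => w.
Qed.

Section NullCurveAlgebra.
Variable K : comRingType.
Variables (i p0 p1 p2 m0 m1 m2 d0 d1 d2 : K).
Hypothesis ii : i * i = -1.
Hypotheses (e0 : m1 * p2 - m2 * p1 = i * p0) (e1 : m2 * p0 - m0 * p2 = i * p1)
  (e2 : m0 * p1 - m1 * p0 = i * p2) (en : m0 * p0 + m1 * p1 + m2 * p2 = 0)
  (ep : p0 * p0 + p1 * p1 + p2 * p2 = 0) (ed : p0 * d0 + p1 * d1 + p2 * d2 = 0).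

(** In the application [p] is the complex gradient of the immersion, [m] the unit normal and [d] the
    derivative of [p]. The hypotheses say that the cross product of [m] and [p] is [i p] and that
    [p] is orthogonal to [m], to itself and to [d]. Each identity below is proved by writing its
    difference as an explicit combination of relations already known. *)
Let lin (a b : K) : a = b -> a - b = 0. Proof. by move=> ->; rewrite subrr. Qed.

Lemma null_conj : (p0 - i * p1) * (p0 + i * p1) = - (p2 * p2).
Proof.
apply/eqP; rewrite -subr_eq0.
have -> : (p0 - i * p1) * (p0 + i * p1) - - (p2 * p2) =
  (p0 * p0 + p1 * p1 + p2 * p2 - 0) - p1 * p1 * (i * i - -1) by ring.
by rewrite (lin ii) (lin ep) mulr0 subrr.
Qed.

Lemma null_minus : (1 - m2) * p2 = (m0 + i * m1) * (p0 - i * p1).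
Proof.
apply/eqP; rewrite eq_sym -subr_eq0.
have -> : (m0 + i * m1) * (p0 - i * p1) - (1 - m2) * p2 =
  (m0 * p0 + m1 * p1 + m2 * p2 - 0) - i * (m0 * p1 - m1 * p0 - i * p2) - (p2 + m1 * p1) * (i * i -
    -1) by ring.
by rewrite (lin ii) (lin en) (lin e2) !mulr0 !subr0.
Qed.

Lemma null_plus : (1 + m2) * (p0 - i * p1) = (m0 - i * m1) * p2.
Proof.
apply/eqP; rewrite -subr_eq0.
have -> : (1 + m2) * (p0 - i * p1) - (m0 - i * m1) * p2 =
  (m2 * p0 - m0 * p2 - i * p1) + i * (m1 * p2 - m2 * p1 - i * p0) + p0 * (i * i - -1) by ring.
by rewrite (lin ii) (lin e0) (lin e1) !mulr0 !addr0.
Qed.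

Lemma null_minus_conj : (1 - m2) * (p0 + i * p1) = - ((m0 + i * m1) * p2).
Proof.
apply/eqP; rewrite -subr_eq0.
have -> : (1 - m2) * (p0 + i * p1) - - ((m0 + i * m1) * p2) =
  - (m2 * p0 - m0 * p2 - i * p1) + i * (m1 * p2 - m2 * p1 - i * p0) + p0 * (i * i - -1) by ring.
by rewrite (lin ii) (lin e0) (lin e1) !mulr0 !addr0 oppr0.
Qed.

Lemma null_plus_conj : (1 + m2) * p2 = - ((m0 - i * m1) * (p0 + i * p1)).
Proof.
apply/eqP; rewrite -subr_eq0.
have -> : (1 + m2) * p2 - - ((m0 - i * m1) * (p0 + i * p1)) =
  (m0 * p0 + m1 * p1 + m2 * p2 - 0) + i * (m0 * p1 - m1 * p0 - i * p2) + (p2 - m1 * p1) * (i * i -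
    -1) by ring.
by rewrite (lin ii) (lin en) (lin e2) !mulr0 !addr0.
Qed.

(** The sum [m0 * d0 + m1 * d1 + m2 * d2] is the Hopf coefficient; this is the source of the
    derivative [- q / f] of the Gauss map. *)
Lemma null_wronskian : d2 * (p0 - i * p1) - p2 * (d0 - i * d1) =
  - ((m0 * d0 + m1 * d1 + m2 * d2) * (p0 - i * p1)).
Proof.
apply/eqP; rewrite -subr_eq0.
have -> : d2 * (p0 - i * p1) - p2 * (d0 - i * d1) - - ((m0 * d0 + m1 * d1 + m2 * d2) * (p0 - i *
  p1)) =
  d2 * ((1 + m2) * (p0 - i * p1) - (m0 - i * m1) * p2) + (m0 - i * m1) * (p0 * d0 + p1 * d1 + p2 *
    d2 - 0)
  - d0 * i * (m0 * p1 - m1 * p0 - i * p2) - d1 * (m0 * p1 - m1 * p0 - i * p2) - d0 * p2 * (i * i -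
    -1) by ring.
by rewrite (lin null_plus) (lin ii) (lin ed) (lin e2) !mulr0 !subr0 addr0.
Qed.

Lemma null_wronskian_conj : d2 * (p0 + i * p1) - p2 * (d0 + i * d1) =
  (m0 * d0 + m1 * d1 + m2 * d2) * (p0 + i * p1).
Proof.
apply/eqP; rewrite -subr_eq0.
have -> : d2 * (p0 + i * p1) - p2 * (d0 + i * d1) - (m0 * d0 + m1 * d1 + m2 * d2) * (p0 + i * p1) =
  d2 * ((1 - m2) * (p0 + i * p1) - - ((m0 + i * m1) * p2)) - (m0 + i * m1) * (p0 * d0 + p1 * d1 +
    p2 * d2 - 0)
  - d0 * i * (m0 * p1 - m1 * p0 - i * p2) + d1 * (m0 * p1 - m1 * p0 - i * p2) - d0 * p2 * (i * i -
    -1) by ring.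
by rewrite (lin null_minus_conj) (lin ii) (lin ed) (lin e2) !mulr0 !subr0 addr0.
Qed.

End NullCurveAlgebra.

(** * Weierstrass data, curvature and connection in a conformal patch *)

Section ConformalSurface.
Variables (U : set E) (F : E -> V3).
Hypotheses (oU : open U) (CF : forall k, C3 k U F).
Hypothesis reg : forall z, U z ->
  0 < dot (cross (partial 0 F z) (partial 1 F z)) (cross (partial 0 F z) (partial 1 F z)).
Hypothesis min : forall z, U z -> \tr (invmx (fff F z) *m sff F z) / 2 = 0.
Hypothesis conf : forall z, U z -> fff F z 0 0 = fff F z 1 1 /\ fff F z 0 1 = 0.

Let xx z := dot (partial 0 F z) (partial 0 F z).

Let conf_dot z : U z -> xx z = dot (partial 1 F z) (partial 1 F z) /\ dot (partial 0 F z) (partial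
  1 F z) = 0.
Proof.
move=> Uz; have [h0 h1] := conf Uz; split.
  exact: etrans (esym (fffE F z 0 0)) (etrans h0 (fffE F z 1 1)).
exact: etrans (esym (fffE F z 0 1)) h1.
Qed.

Let orthonormal_cross (a b : V3) : 0 < dot (cross a b) (cross a b) -> dot a a = dot b b -> dot a b
  = 0 ->
  0 < dot a a /\
  cross ((Num.sqrt (dot (cross a b) (cross a b)))^-1 *: cross a b) a = b /\
  cross ((Num.sqrt (dot (cross a b) (cross a b)))^-1 *: cross a b) b = - a.
Proof.
rewrite lagrange_identity => + h ab; rewrite -h ab expr0n /= !subr0 => aa.
have a0 : 0 < dot a a.
  by rewrite lt0r dot_ge0 andbT; apply/eqP => a0; rewrite a0 mulr0 ltxx in aa.
rewrite -expr2 sqrtr_sqr gtr0_norm //; split => //.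
have an : dot a a != 0 by rewrite gt_eqF.
have sc (k : R) (v : V3) j : (k *: v) 0 j = k * v 0 j by rewrite [LHS]mxE.
have sN (v : V3) j : (- v) 0 j = - v 0 j by rewrite [LHS]mxE.
have L j : cross (cross a b) a 0 j = dot a a * b 0 j - dot a b * a 0 j.
  by elim/ord3_ind: j; rewrite !(cross0E, cross1E, cross2E, dotE); ring.
have L' j : cross (cross a b) b 0 j = dot a b * b 0 j - dot b b * a 0 j.
  by elim/ord3_ind: j; rewrite !(cross0E, cross1E, cross2E, dotE); ring.
have Z (k : R) (v : V3) (w : V3) j : cross (k *: v) w 0 j = k * cross v w 0 j.
  by elim/ord3_ind: j; rewrite !(cross0E, cross1E, cross2E, sc); ring.
by split; apply/rowP => j; rewrite Z ?L ?L' ?sN -?h ab; field.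
Qed.

(** The coordinate vectors are orthogonal and of equal length, so the rotation by a right angle
    given by the cross product with the normal exchanges them up to sign. *)
Lemma conf_normal z : U z -> [/\ 0 < xx z, cross (gmap F z) (partial 0 F z) = partial 1 F z &
  cross (gmap F z) (partial 1 F z) = - partial 0 F z].
Proof.
move=> Uz; have [h0 h1] := conf_dot Uz.
by have [a [b c]] := orthonormal_cross (reg Uz) h0 h1; split.
Qed.

(* [phi j] is twice the [z]-derivative of the [j]-th coordinate of [F]. *)
Definition phi j (w : E) : cx := Complex (partial 0 F w 0 j) (- partial 1 F w 0 j).

Definition hopfF (w : E) : cx := Complex (sff F w 0 0) (- sff F w 0 1).

Let cauchy_riemann_parts (a b c d e : R) : a = b -> c = d -> e = - b ->
  Complex a c = 'i * Complex d e.
Proof. by move=> -> -> ->; apply: cplx_eq; rewrite !cE /=; ring. Qed.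

Lemma hol_phi j : hol U (phi j).
Proof.
apply: (hol_smooth oU).
- by move=> k; exact: (surf_Cp oU CF k 0 j).
- by move=> k; apply: C_N => //; exact: (surf_Cp oU CF k 1 j).
move=> z Uz.
have d0 := surf_dp oU CF 0 Uz; have d1 := surf_dp oU CF 1 Uz.
have mix : pd 1 (fun w => partial 0 F w 0 j) z = pd 0 (fun w => partial 1 F w 0 j) z.
  apply: etrans (esym (pd_entry3 1 j d0)) (etrans _ (pd_entry3 0 j d1)).
  exact: (congr1 (fun v : V3 => v 0 j) (surf_mixed oU CF Uz)).
(* Harmonicity of the coordinate functions: closedness of [- (N x dF)], read through [conf_normal],
   says that the Laplacian of [F] vanishes. *)
have har : pd 1 (fun w => - partial 1 F w 0 j) z = pd 0 (fun w => partial 0 F w 0 j) z.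
  have A w : U w -> - partial 1 F w 0 j = - cross (gmap F w) (partial 0 F w) 0 j.
    by move=> Uw; have [_ h _] := conf_normal Uw; exact: (congr1 (fun v : V3 => - v 0 j) (esym h)).
  have B w : U w -> - cross (gmap F w) (partial 1 F w) 0 j = partial 0 F w 0 j.
    move=> Uw; have [_ _ h] := conf_normal Uw.
    apply: etrans (congr1 (fun v : V3 => - v 0 j) h) _.
    by move: (partial 0 F w) => v; rewrite mxE opprK.
  have A' := near_partial (V := R^o) 1 (open_near oU Uz A).
  have B' := near_partial (V := R^o) 0 (open_near oU Uz B).
  exact: (etrans A' (etrans (surf_conjugate_closed oU CF reg Uz (min Uz) j) B')).
have neg : pd 0 (fun w => - partial 1 F w 0 j) z = - pd 0 (fun w => partial 1 F w 0 j) z.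
  exact: (partialN 0 (d1 j)).
exact: (cauchy_riemann_parts mix har neg).
Qed.

Lemma dz_phi j z : U z -> dz (phi j) z =
  Complex (partial 0 (partial 0 F) z 0 j) (- partial 0 (partial 1 F) z 0 j).
Proof.
move=> Uz; have [_ <- _] := hol_cder (hol_phi j) Uz.
have d0 := surf_dp oU CF 0 Uz; have d1 := surf_dp oU CF 1 Uz.
congr Complex; first exact: esym (pd_entry3 0 j d0).
apply: etrans (partialN 0 (d1 j)) _.
by congr (- _); symmetry; exact: (pd_entry3 0 j d1).
Qed.

Let nrm j (w : E) : cx := Complex (gmap F w 0 j) 0.

Let normal_cplx (n a b : V3) : cross n a = b -> cross n b = - a ->
  let p j : cx := Complex (a 0 j) (- b 0 j) in let m j : cx := Complex (n 0 j) 0 in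
  [/\ m 1 * p 2%:R - m 2%:R * p 1 = 'i * p 0, m 2%:R * p 0 - m 0 * p 2%:R = 'i * p 1,
     m 0 * p 1 - m 1 * p 0 = 'i * p 2%:R & m 0 * p 0 + m 1 * p 1 + m 2%:R * p 2%:R = 0].
Proof.
move=> h k p m.
have sN (v : V3) j : (- v) 0 j = - v 0 j by rewrite [LHS]mxE.
have H j : b 0 j = cross n a 0 j by rewrite h.
have K j : a 0 j = - cross n b 0 j by rewrite k sN opprK.
have na : n 0 0 * a 0 0 + n 0 1 * a 0 1 + n 0 2%:R * a 0 2%:R = 0.
  by rewrite !K cross0E cross1E cross2E; ring.
have nb : n 0 0 * b 0 0 + n 0 1 * b 0 1 + n 0 2%:R * b 0 2%:R = 0.
  by rewrite !H cross0E cross1E cross2E; ring.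
move: (H 0) (H 1) (H 2%:R) (K 0) (K 1) (K 2%:R); rewrite !cross0E !cross1E !cross2E.
rewrite /p /m; move: na nb; move: (n 0 0) (n 0 1) (n 0 2%:R) (a 0 0) (a 0 1) (a 0 2%:R) (b 0 0) (b
  0 1) (b 0 2%:R).
clear; move=> n0 n1 n2 a0 a1 a2 b0 b1 b2 na nb H0 H1 H2 K0 K1 K2.
split; apply: cplx_eq; rewrite !cE /=; lra.
Qed.

Let null_sum (a b : V3) : dot a a = dot b b -> dot a b = 0 ->
  let p j : cx := Complex (a 0 j) (- b 0 j) in
  p 0 * p 0 + p 1 * p 1 + p 2%:R * p 2%:R = 0.
Proof.
rewrite !dotE => h k p; rewrite /p; move: h k.
move: (a 0 0) (a 0 1) (a 0 2%:R) (b 0 0) (b 0 1) (b 0 2%:R) => a0 a1 a2 b0 b1 b2 h k.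
by apply: cplx_eq; rewrite !cE /=; lra.
Qed.

Lemma phi_normal z : U z ->
  [/\ nrm 1 z * phi 2%:R z - nrm 2%:R z * phi 1 z = 'i * phi 0 z,
   nrm 2%:R z * phi 0 z - nrm 0 z * phi 2%:R z = 'i * phi 1 z,
   nrm 0 z * phi 1 z - nrm 1 z * phi 0 z = 'i * phi 2%:R z &
   nrm 0 z * phi 0 z + nrm 1 z * phi 1 z + nrm 2%:R z * phi 2%:R z = 0].
Proof. by move=> Uz; have [_ h k] := conf_normal Uz; exact: (normal_cplx h k). Qed.

Lemma phi_null z : U z -> phi 0 z * phi 0 z + phi 1 z * phi 1 z + phi 2%:R z * phi 2%:R z = 0.
Proof. by move=> Uz; have [h k] := conf_dot Uz; exact: (null_sum h k). Qed.

Lemma phi_dphi z : U z ->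
  phi 0 z * dz (phi 0) z + phi 1 z * dz (phi 1) z + phi 2%:R z * dz (phi 2%:R) z = 0.
Proof.
move=> Uz; have d0 := hol_cder (hol_phi 0) Uz; have d1 := hol_cder (hol_phi 1) Uz;
  have d2 := hol_cder (hol_phi 2%:R) Uz.
have H := cder_dz (cder_near (open_near oU Uz phi_null)
  (cderD (cderD (cderM d0 d0) (cderM d1 d1)) (cderM d2 d2))).
have := etrans (esym (cder_dz (cderC 0 z))) H.
move: (dz (phi 0) z) (dz (phi 1) z) (dz (phi 2%:R) z) (phi 0 z) (phi 1 z) (phi 2%:R z) => a b c d e
  f h.
apply: (mulfI (x := 2)); first by rewrite pnatr_eq0.
by rewrite mulr0 [RHS]h; ring.
Qed.

Let cplx_dot (n a b : V3) :
  let p j : cx := Complex (a 0 j) (- b 0 j) in let m j : cx := Complex (n 0 j) 0 in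
  Complex (dot n a) (- dot n b) = m 0 * p 0 + m 1 * p 1 + m 2%:R * p 2%:R.
Proof. by move=> p m; rewrite !dotE; apply: cplx_eq; rewrite !cE /=; ring. Qed.

Lemma hopf_phi z : U z -> hopfF z =
  nrm 0 z * dz (phi 0) z + nrm 1 z * dz (phi 1) z + nrm 2%:R z * dz (phi 2%:R) z.
Proof.
move=> Uz; have E (j : 'I_2) := etrans (sffE F z 0 j) (surf_dNp oU CF reg 0 j Uz).
apply: etrans (congr2 (fun a b : R => Complex a (- b)) (E 0) (E 1)) _.
apply: esym (etrans (congr2 +%R (congr2 +%R (congr1 _ (dz_phi 0 Uz)) (congr1 _ (dz_phi 1 Uz)))
  (congr1 _ (dz_phi 2%:R Uz))) _).
exact: esym (cplx_dot _ _ _).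
Qed.

(** The factors [f] and [g] of the null relation have product [- u ^ 2]; the Gauss map is [u / f]
    and its inverse is [- u / g]. *)
Let f (w : E) : cx := phi 0 w - 'i * phi 1 w.
Let g (w : E) : cx := phi 0 w + 'i * phi 1 w.
Let u := phi 2%:R.
Let q := hopfF.

Let ii : 'i * 'i = -1 :> cx. Proof. by rewrite -expr2 sqr_i. Qed.

Lemma hol_phi_minus : hol U f.
Proof. exact: (holB oU (hol_phi 0) (holM oU (holC _ oU) (hol_phi 1))). Qed.
Lemma hol_phi_plus : hol U g.
Proof. exact: (holD oU (hol_phi 0) (holM oU (holC _ oU) (hol_phi 1))). Qed.

Lemma dz_phi_minus z : U z -> dz f z = dz (phi 0) z - 'i * dz (phi 1) z.
Proof.
move=> Uz; have d0 := hol_cder (hol_phi 0) Uz; have d1 := hol_cder (hol_phi 1) Uz.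
by apply: cder_dz (cder_eq (cderB d0 (cderM (cderC 'i z) d1)) _); rewrite mul0r add0r.
Qed.
Lemma dz_phi_plus z : U z -> dz g z = dz (phi 0) z + 'i * dz (phi 1) z.
Proof.
move=> Uz; have d0 := hol_cder (hol_phi 0) Uz; have d1 := hol_cder (hol_phi 1) Uz.
by apply: cder_dz (cder_eq (cderD d0 (cderM (cderC 'i z) d1)) _); rewrite mul0r add0r.
Qed.

Lemma wronskian_minus z : U z -> dz u z * f z - u z * dz f z = - (q z * f z).
Proof.
move=> Uz; rewrite dz_phi_minus // /q hopf_phi //; have [e0 e1 e2 en] := phi_normal Uz.
exact: (null_wronskian ii e0 e1 e2 (phi_dphi Uz)).
Qed.
Lemma wronskian_plus z : U z -> dz u z * g z - u z * dz g z = q z * g z.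
Proof.
move=> Uz; rewrite dz_phi_plus // /q hopf_phi //; have [e0 e1 e2 en] := phi_normal Uz.
exact: (null_wronskian_conj ii e0 e1 e2 (phi_dphi Uz)).
Qed.
Lemma phi_minus_plus z : U z -> f z * g z = - (u z * u z).
Proof. by move=> Uz; exact: (null_conj ii (phi_null Uz)). Qed.

(** A common zero of [f] and [g] would annihilate all of [phi], hence the tangent vector
    [partial 0 F]. So one of the two quotients is always regular. *)
Lemma phi_plus_neq0 z : U z -> f z = 0 -> g z != 0.
Proof.
move=> Uz f0; apply/eqP => g0; have [+ _ _] := conf_normal Uz; have := phi_minus_plus Uz.
rewrite f0 mul0r => /esym/eqP; rewrite oppr_eq0 mulf_eq0 orbb => /eqP u0.
have p0 : phi 0 z = 0.
  apply: (mulfI (x := 2)); first by rewrite pnatr_eq0.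
  rewrite mulr0; transitivity (f z + g z); first by rewrite /f /g; ring.
  by rewrite f0 g0 addr0.
have p1 : phi 1 z = 0.
  have : 'i * phi 1 z = 0 by move: g0; rewrite /g p0 add0r.
  by move/(congr1 ( *%R 'i)); rewrite mulrA ii mulr0 mulN1r => /eqP; rewrite oppr_eq0 => /eqP.
have e j : phi j z = 0 -> partial 0 F z 0 j = 0 by move/(congr1 (@complex.Re R)).
by rewrite /xx dotE (e 0 p0) (e 1 p1) (e 2%:R u0) !mul0r !addr0 ltxx.
Qed.

(** If the third entry of the normal is 1, unit length makes the other two vanish and the null
    relations kill [f] and [u]. Otherwise the null relations give the quotient, and [f = 0] would
    force [g = 0]. *)
Let stereo_cases z : U z ->
  (gmap F z 0 2%:R = 1 /\ f z = 0 /\ u z = 0) \/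
  (gmap F z 0 2%:R <> 1 /\ f z != 0 /\ stereographic (gmap F z) = Some (u z / f z)).
Proof.
move=> Uz; have [e0 e1 e2 en] := phi_normal Uz.
have Hm := null_minus ii e2 en; have Hp := null_plus ii e0 e1.
have Hmc := null_minus_conj ii e0 e1; have Hpc := null_plus_conj ii e2 en.
have N1 := surf_NN reg Uz; rewrite dotE in N1.
rewrite -/u -/(f z) -/(g z) in Hm Hp Hmc Hpc.
have fg0 := @phi_plus_neq0 z Uz; move: fg0 Hm Hp Hmc Hpc N1; rewrite /nrm /stereographic.
move: (gmap F z) (f z) (g z) (u z) => n ff gg uu fg0 Hm Hp Hmc Hpc N1.
have [n2|n2] := eqVneq (n 0 2%:R) 1; [left|right].
  move: Hp Hpc.
  have /eqP : n 0 0 ^+ 2 + n 0 1 ^+ 2 = 0 by move: N1; rewrite n2; lra.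
  rewrite paddr_eq0 ?sqr_ge0 // !sqrf_eq0 => /andP[/eqP n0 /eqP n1].
  have E : (1 + Complex (n 0 2%:R) 0 : cx) != 0.
    by apply/eqP => /(congr1 (@complex.Re R)); rewrite !cE /= n2 => /eqP;
      rewrite -[1 + 1]/(2%:R) pnatr_eq0.
  have Z : (Complex (n 0 0) 0 - 'i * Complex (n 0 1) 0 : cx) = 0.
    by rewrite n0 n1; apply: cplx_eq; rewrite !cE /=; ring.
  by rewrite Z !mul0r oppr0 => /eqP; rewrite mulf_eq0 (negbTE E) => /eqP -> /eqP;
    rewrite mulf_eq0 (negbTE E) => /eqP ->.
have D : (1 - Complex (n 0 2%:R) 0 : cx) = Complex (1 - n 0 2%:R) 0 by apply: cplx_eq;
  rewrite !cE /=; ring.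
have D0 : (Complex (1 - n 0 2%:R) 0 : cx) != 0.
  by apply/eqP => /(congr1 (@complex.Re R)) /= /eqP; rewrite subr_eq0 eq_sym (negbTE n2).
have S : (Complex (n 0 0) 0 + 'i * Complex (n 0 1) 0 : cx) = Complex (n 0 0) (n 0 1) by apply:
  cplx_eq; rewrite !cE /=; ring.
rewrite D S in Hm Hmc.
have f0 : ff != 0.
  apply/eqP => f0; have := fg0 f0; move: Hm; rewrite f0 mulr0 => /eqP.
  rewrite mulf_eq0 (negbTE D0) => /eqP u0; move: Hmc; rewrite u0 mulr0 oppr0 => /eqP.
  by rewrite mulf_eq0 (negbTE D0) => /= ->.
split; first exact/eqP; split => //; congr Some.
by apply/eqP; rewrite eqr_div // -Hm mulrC.
Qed.

(** Valid even at the pole: [finite_part] sends infinity to 0, and [u] vanishes there together with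
    [f]. *)
Lemma stereo_minus z : U z -> finite_part (stereographic (gmap F z)) = u z / f z.
Proof.
by move=> Uz; case: (stereo_cases Uz) => [[n2 [-> ->]]|[_ [_ ->]]] //;
  rewrite /stereographic n2 eqxx mul0r.
Qed.

(** Where [u = 0] and [f] is nonzero, the inverted Gauss map is infinite and both sides are 0. *)
Lemma stereo_plus z : U z -> finite_part (sphere_inv (stereographic (gmap F z))) = - u z / g z.
Proof.
move=> Uz; case: (stereo_cases Uz) => [[n2 [_ ->]]|[_ [f0 ->]]].
  by rewrite /stereographic n2 eqxx /= oppr0 mul0r.
have := phi_minus_plus Uz; move: f0; move: (f z) (g z) (u z) => ff gg uu f0 E /=.
have [->|u0] := eqVneq uu 0; first by rewrite mul0r eqxx oppr0 mul0r.
rewrite mulf_eq0 invr_eq0 (negbTE u0) (negbTE f0) /=.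
have g0 : gg != 0 by apply: contra_neq u0 => g0; move: E; rewrite g0 mulr0 => /esym/eqP;
  rewrite oppr_eq0 mulf_eq0 orbb => /eqP.
by rewrite invf_div; apply/eqP; rewrite eqr_div // E mulNr.
Qed.

Lemma stereo_infinity z : U z -> (stereographic (gmap F z) = None) <-> f z = 0.
Proof.
move=> Uz; case: (stereo_cases Uz) => [[n2 [-> _]]|[_ [f0 ->]]].
  by rewrite /stereographic n2 eqxx.
by split => // E; rewrite E eqxx in f0.
Qed.

Let Of := [set z | U z /\ f z != 0].
Let Og := [set z | U z /\ g z != 0].
Let oOf : open Of. Proof. exact: (hol_open_neq0 oU hol_phi_minus). Qed.
Let oOg : open Og. Proof. exact: (hol_open_neq0 oU hol_phi_plus). Qed.
Let OfU z : Of z -> U z. Proof. by case. Qed.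
Let OgU z : Og z -> U z. Proof. by case. Qed.
Let holf := hol_sub OfU hol_phi_minus.
Let holg := hol_sub OgU hol_phi_plus.
Let holuf := hol_sub OfU (hol_phi 2%:R).
Let holug := hol_sub OgU (hol_phi 2%:R).

(** Near each point [q] is, up to sign, a Wronskian divided by [f] or by [g], whichever is nonzero
    there. *)
Lemma hol_hopf : hol U q.
Proof.
apply: hol_local => z Uz; have [f0|f0] := eqVneq (f z) 0.
  exists Og; first by split => //; exact: phi_plus_neq0.
  have H := holM oOg (holB oOg (holM oOg (hol_dz holug) holg) (holM oOg holug (hol_dz holg)))
    (holV oOg (fun w (h : Og w) => h.2) holg).
  by apply: (hol_ext oOg _ H) => w [Uw gw]; rewrite wronskian_plus // mulfK.
exists Of => //.
have H := holM oOf (holN oOf (holB oOf (holM oOf (hol_dz holuf) holf) (holM oOf holuf (hol_dz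
  holf))))
    (holV oOf (fun w (h : Of w) => h.2) holf).
by apply: (hol_ext oOf _ H) => w [Uw fw]; rewrite wronskian_minus // opprK mulfK.
Qed.

Let sff10 z : U z -> sff F z 1 0 = sff F z 0 1.
Proof.
move=> Uz; apply: etrans (etrans (sffE F z 1 0) (surf_dNp oU CF reg 1 0 Uz)) _.
apply: etrans (congr1 (dot (gmap F z)) (surf_mixed oU CF Uz)) _.
exact: esym (etrans (sffE F z 0 1) (surf_dNp oU CF reg 0 1 Uz)).
Qed.

Let traceless (x y d h s k : R) : 0 < x -> x = y -> d = 0 -> y * h - d * s + x * k = 0 -> k = - h.
Proof.
move=> x0 <- -> H; have xn : x != 0 by rewrite gt_eqF.
by apply: (mulfI xn); rewrite mulrN; apply/eqP; rewrite -addr_eq0 -H; apply/eqP; ring.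
Qed.

Let sff11 z : U z -> sff F z 1 1 = - sff F z 0 0.
Proof.
move=> Uz; have [h0 h1] := conf_dot Uz; have [x0 _ _] := conf_normal Uz.
exact: (traceless x0 h0 h1 (surf_minimal reg Uz (min Uz))).
Qed.

Let scalar_mx22 (A : 'M[R]_2) x : A 0 0 = x -> A 1 1 = x -> A 0 1 = 0 -> A 1 0 = 0 -> A = x%:M.
Proof.
move=> h0 h1 h2 h3; apply/matrixP => i j; rewrite mxE.
by elim/ord2_ind: i; elim/ord2_ind: j; rewrite /= ?mulr1n ?mulr0n.
Qed.

Let fff_conf z : U z -> fff F z = (xx z)%:M.
Proof.
move=> Uz; have [h0 h1] := conf_dot Uz.
exact: (scalar_mx22 (fffE F z 0 0) (etrans (fffE F z 1 1) (esym h0)) (etrans (fffE F z 0 1) h1)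
  (etrans (fffE F z 1 0) (etrans (dotC _ _) h1))).
Qed.

Lemma curvature_conf z : U z -> \det (invmx (fff F z) *m sff F z) = - nsq (q z) / xx z ^+ 2.
Proof.
move=> Uz; rewrite det_invmx_mul [\det (sff F z)]det22 sff10 // sff11 // fff_conf // det_scalar.
by congr (_ / _); rewrite /nsq /q /hopfF /=; ring.
Qed.

(** Since [sqrt (- K) = |q| / xx] and the metric is [xx] times the identity, the conformal factor
    cancels. *)
Lemma flat_conf z : U z ->
  Num.sqrt (- \det (invmx (fff F z) *m sff F z)) *: fff F z = (Num.sqrt (nsq (q z)))%:M.
Proof.
move=> Uz; have [x0 _ _] := conf_normal Uz; rewrite curvature_conf // fff_conf //.
rewrite mulNr opprK sqrtrM ?nsq_ge0 // sqrtrV ?sqr_ge0 // sqrtr_sqr gtr0_norm //.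
by rewrite scale_scalar_mx mulfVK // gt_eqF.
Qed.

Let Om := [set z | U z /\ q z != 0].
Let oOm : open Om. Proof. exact: (hol_open_neq0 oU hol_hopf). Qed.

Let C_nsq k : C k U (fun w => nsq (q w)).
Proof.
have Cs i j : C k U (fun w => sff F w i j).
  apply: (Cn_ext oU (f := fun w => - dot (partial i (gmap F) w) (partial j F w))).
    by move=> w _; exact: esym (sffE F w i j).
  apply: C_N => //; apply: C_dot => //; last exact: surf_Cp.
  by apply: C3_partial => //; exact: surf_CN.
apply: (Cn_ext oU (f := fun w => sff F w 0 0 * sff F w 0 0 + sff F w 0 1 * sff F w 0 1)).
  by move=> w _; rewrite /nsq /q /hopfF /=; ring.
by apply: C_D => //; apply: C_M.
Qed.

Let mu w := Num.sqrt (nsq (q w)).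

Let mu_partial z i : Om z -> dfb mu z /\ 2 * mu z * pd i mu z = pd i (fun w => nsq (q w)) z.
Proof.
move=> Omz; have pos w : Om w -> 0 < nsq (q w).
  by move=> [_ qw]; rewrite lt0r nsq_eq0 nsq_ge0 qw.
have C1 : C 1 Om mu := C_sqrt oOm pos (Cn_sub (fun w (h : Om w) => h.1) (C_nsq 1)).
have dm : dfb mu z by case: C1 => + _; apply.
split => //; have E w : Om w -> mu w * mu w = nsq (q w).
  by move=> /pos/ltW h; rewrite -expr2 sqr_sqrtr.
apply: etrans (near_partial (V := R^o) i (open_near oOm Omz E)).
apply: etrans _ (esym (partialM i dm dm)).
by rewrite [RHS](_ : _ = 2 * mu z * pd i mu z) //; move: (mu z) (pd i mu z) => a b; ring.
Qed.

Let double_sum (a a' b b' : R) : a' * a + a * a' + (b' * b + b * b') = 2 * (a * a' + b * b').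
Proof. by ring. Qed.

Let nsq_partial z : Om z ->
  pd 0 (fun w => nsq (q w)) z = 2 * (Re (q z) * Re (dz q z) + Im (q z) * Im (dz q z)) /\
  pd 1 (fun w => nsq (q w)) z = 2 * (Im (q z) * Re (dz q z) - Re (q z) * Im (dz q z)).
Proof.
move=> [Uz _]; have cq := hol_cder hol_hopf Uz; have [[dr di] _ _] := cq.
have [r0 i0 r1 i1] := cder_partials cq.
have H i : pd i (fun w => nsq (q w)) z = 2 * (Re (q z) * pd i (fun w => Re (q w)) z + Im (q z) * pd
  i (fun w => Im (q w)) z).
  have -> : (fun w => nsq (q w)) = (fun w => Re (q w) * Re (q w) + Im (q w) * Im (q w)).
    by apply: funext => w; rewrite /nsq !expr2.
  exact: (etrans (etrans (partialD i (differentiableM dr dr) (differentiableM di di))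
    (congr2 +%R (partialM i dr dr) (partialM i di di))) (double_sum _ _ _ _)).
by split; apply: etrans (H _) _; rewrite ?r0 ?i0 ?r1 ?i1 //; congr (2 * _); rewrite mulrN addrC.
Qed.

(** With [m = |q|], the left side is the [z]-derivative of [log m], which is half the logarithmic
    derivative of [q]. The derivatives of [m] are known only through those of [m ^ 2]. *)
Let conn_algebra (m0 m1 m : R) (x d : cx) :
  2 * m * m0 = 2 * (Re x * Re d + Im x * Im d) ->
  2 * m * m1 = 2 * (Im x * Re d - Re x * Im d) ->
  m ^+ 2 = Re x ^+ 2 + Im x ^+ 2 -> m != 0 -> x != 0 ->
  Complex (m0 / (2 * m)) (- (m1 / (2 * m))) = d / (2 * x).
Proof.
move=> M0 M1 sq mn x0.
have d2 : 2 != 0 :> R by rewrite pnatr_eq0.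
have m2 : m ^+ 2 != 0 by rewrite expf_neq0.
have M0' : m0 / (2 * m) = (Re x * Re d + Im x * Im d) / (2 * m ^+ 2).
  by apply: (mulfI d2); rewrite -[X in X / (2 * m ^+ 2)]mulr1; move: M0;
    rewrite -mulrA => /(mulfI d2) <-; field.
have M1' : m1 / (2 * m) = (Im x * Re d - Re x * Im d) / (2 * m ^+ 2).
  by apply: (mulfI d2); rewrite -[X in X / (2 * m ^+ 2)]mulr1; move: M1;
    rewrite -mulrA => /(mulfI d2) <-; field.
have xx0 : (2 * x) != 0 by rewrite mulf_neq0 // pnatr_eq0.
apply: (mulIf xx0); rewrite mulfVK // M0' M1' sq.
rewrite sq in m2; apply: cplx_eq; rewrite !cE /=; by field.
Qed.

Lemma connection_conf (G : E -> 'M[R]_2) z : Om z -> (forall w, U w -> G w = (mu w)%:M) ->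
  Complex ((christoffel G 0 0 0 z - christoffel G 0 1 1 z) / 2%:R) (- christoffel G 0 0 1 z) =
  dz q z / (2 * q z).
Proof.
move=> Omz GE; have Uz := Omz.1.
have P l a b : pd l (fun w => G w a b) z = (if a == b then pd l mu z else 0).
  have E w : U w -> G w a b = (if a == b then mu w else 0).
    by move=> Uw; rewrite GE // mxE; case: (a == b).
  apply: etrans (near_partial (V := R^o) l (open_near oU Uz E)) _.
  by case: (a == b) => //; exact: partialC.
have mu0 : mu z != 0.
  by rewrite gt_eqF // sqrtr_gt0 lt0r nsq_eq0 nsq_ge0 Omz.2.
have [_ M0] := mu_partial 0 Omz; have [_ M1] := mu_partial 1 Omz.
have [N0 N1] := nsq_partial Omz.
have sq : mu z ^+ 2 = nsq (q z) by rewrite sqr_sqrtr // nsq_ge0.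
have l00 : lift (0 : 'I_2) 0 = 1 by exact: val_inj.
rewrite /christoffel !big_ord_recl !big_ord0 !l00 !P GE // invmx_scalar !mxE /=.
have q0 := Omz.2; have n0 : nsq (q z) != 0 by rewrite nsq_eq0.
move: M0 M1 sq mu0 n0 q0; rewrite N0 N1 /nsq; move: (pd 0 mu z) (pd 1 mu z) (mu z) (q z) (dz q z).
move=> m0 m1 m qq d M0 M1 sq mn n0 q0.
apply: etrans (conn_algebra M0 M1 sq mn q0).
congr Complex; rewrite !mulr1n !mulr0n !mul0r ?addr0; first by field.
by congr (- _); field.
Qed.

End ConformalSurface.

(** * The entropy coefficient of degree two as an expression in [gam] and [k] *)

Lemma dz_on (O : set E) (f g : E -> cx) z : open O -> (forall w, O w -> f w = g w) -> O z -> dz f z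
  = dz g z.
Proof. by move=> oO fg Oz; apply: dz_near; exact: (open_near oO Oz fg). Qed.

Lemma schwarzian_on (O : set E) (f g : E -> cx) z : open O -> (forall w, O w -> f w = g w) -> O z ->
  schwarzian_finite f z = schwarzian_finite g z.
Proof.
move=> oO fg Oz.
have H1 w : O w -> dz f w = dz g w by exact: dz_on oO fg.
have H2 w : O w -> dz (dz f) w = dz (dz g) w by exact: dz_on oO H1.
exact: (f_equal3 (fun a b c : cx => a / b - 3%:R / 2%:R * (c / b) ^+ 2) (dz_on oO H2 Oz) (H1 z Oz)
  (H2 z Oz)).
Qed.

Lemma schwarzian_Some (G : E -> sphere R) z : G z <> None ->
  schwarzian G z = schwarzian_finite (@finite_part R \o G) z.
Proof.
rewrite /schwarzian; move: (schwarzian_finite _ z) (schwarzian_finite _ z) => a b.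
by case: (G z).
Qed.

Lemma schwarzian_None (G : E -> sphere R) z : G z = None ->
  schwarzian G z = schwarzian_finite (@finite_part R \o @sphere_inv R \o G) z.
Proof.
rewrite /schwarzian; move: (schwarzian_finite _ z) (schwarzian_finite _ z) => a b.
by case: (G z).
Qed.

(* The coefficient of [dz^2] in [P_2], where [gam] is the connection
   coefficient and [k] the logarithmic derivative of a denominator of the Gauss
   map. *)
Definition entropy2 (gam k : E -> cx) z : cx :=
  dz gam z - 3 / 2 * gam z ^+ 2 + 2 * gam z * k z - dz k z - k z ^+ 2 / 2.

Section Quotient.
Variables (O : set E) (a f q : E -> cx).
Hypotheses (oO : open O) (Ha : hol O a) (Hf : hol O f) (Hq : hol O q).
Hypotheses (f0 : forall z, O z -> f z != 0) (q0 : forall z, O z -> q z != 0).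
Hypothesis W : forall z, O z -> dz a z * f z - a z * dz f z = - (q z * f z).

Let gam z : cx := dz q z / (2 * q z).
Let k z : cx := dz f z / f z.

Let hol_gam : hol O gam.
Proof.
have H w : O w -> 2 * q w != 0 by move=> Ow; rewrite mulf_neq0 ?q0 // pnatr_eq0.
exact: (holM oO (hol_dz Hq) (holV oO H (holM oO (holC _ oO) Hq))).
Qed.
Let hol_k : hol O k.
Proof. exact: (holM oO (hol_dz Hf) (holV oO f0 Hf)). Qed.

(** The quotient has derivative [P = - q / f] with [P' / P = L = 2 gam - k], so its Schwarzian is
    [L' - L ^ 2 / 2]. *)
Lemma schwarzian_quotient z : O z ->
  schwarzian_finite (fun w => a w / f w) z + gam z ^+ 2 / 2 - dz gam z = entropy2 gam k z.
Proof.
move=> Oz; pose P w : cx := - (q w / f w); pose L w : cx := 2 * gam w - k w.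
have P1 w : O w -> dz (fun w => a w / f w) w = P w.
  move=> Ow; apply: etrans (cder_dz (cder_div (hol_cder Ha Ow) (hol_cder Hf Ow) (f0 Ow))) _.
  by rewrite W // /P; have := f0 Ow; move: (f w) (q w) => x y x0; field.
have P2 w : O w -> cder P w (P w * L w).
  move=> Ow; apply: cder_eq (cderN (cder_div (hol_cder Hq Ow) (hol_cder Hf Ow) (f0 Ow))) _.
  rewrite /P /L /gam /k; have := f0 Ow; have := q0 Ow.
  by move: (f w) (q w) (dz q w) (dz f w) => x y s t x0 y0; field; rewrite x0 y0.
have L1 := cderB (cderM (cderC 2 z) (hol_cder hol_gam Oz)) (hol_cder hol_k Oz).
have P3 := cderM (P2 z Oz) L1.
have D1 w : O w -> dz (dz (fun w => a w / f w)) w = P w * L w.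
  by move=> Ow; rewrite (dz_on oO P1 Ow) (cder_dz (P2 w Ow)).
have Pz : P z != 0 by rewrite oppr_eq0 mulf_neq0 ?invr_eq0 ?f0 ?q0.
rewrite /schwarzian_finite (dz_on oO D1 Oz) (cder_dz P3) (D1 z Oz) (P1 z Oz) /entropy2 /L.
move: (P z) Pz (gam z) (k z) (dz gam z) (dz k z) => p p0 x y s t.
by field.
Qed.

End Quotient.

(* Both stereographic projections of the Gauss map give the same [P_2]. *)
Section TwoQuotients.
Variables (O : set E) (u f g q : E -> cx).
Hypotheses (oO : open O) (Hu : hol O u) (Hf : hol O f) (Hq : hol O q).
Hypotheses (f0 : forall z, O z -> f z != 0) (g0 : forall z, O z -> g z != 0)
  (u0 : forall z, O z -> u z != 0) (q0 : forall z, O z -> q z != 0).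
Hypothesis Wf : forall z, O z -> dz u z * f z - u z * dz f z = - (q z * f z).
Hypothesis Wg : forall z, O z -> dz u z * g z - u z * dz g z = q z * g z.

Lemma entropy2_conj z : O z ->
  entropy2 (fun w => dz q w / (2 * q w)) (fun w => dz g w / g w) z =
  entropy2 (fun w => dz q w / (2 * q w)) (fun w => dz f w / f w) z.
Proof.
move=> Oz; pose kf w := dz f w / f w; pose kg w := dz g w / g w.
pose v w := q w / u w.
(* Dividing the Wronskian identities by [u f] and [u g] expresses the logarithmic derivatives of [u]
   and [g] through [kf] and [v = q / u]; all terms in [v] cancel in the end. *)
have lg w : O w -> dz u w / u w = kf w - v w /\ kg w = kf w - 2 * v w.
  move=> Ow; have hf := Wf Ow; have hg := Wg Ow; have fn := f0 Ow; have gn := g0 Ow;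
    have un := u0 Ow.
  rewrite /kf /kg /v; move: hf hg fn gn un;
    move: (f w) (g w) (u w) (q w) (dz f w) (dz g w) (dz u w).
  move=> ff gg uu qq df dg du hf hg fn gn un.
  have hf' : du = uu * df / ff - qq by apply: (mulIf fn); rewrite mulrBl mulfVK //; apply/eqP;
    rewrite -subr_eq0; apply/eqP; move/eqP: hf; rewrite -subr_eq0 => /eqP <-; ring.
  have hg' : dg = (du - qq) * gg / uu.
    apply: (mulfI un); rewrite [RHS]mulrC mulfVK // mulrBl -hg; ring.
  by split; rewrite ?hg' hf'; field; rewrite ?fn ?un ?gn.
have hv := cder_div (hol_cder Hq Oz) (hol_cder Hu Oz) (u0 Oz).
have hk := hol_cder (holM oO (hol_dz Hf) (holV oO f0 Hf)) Oz.
have hkg : dz kg z = dz kf z - 2 * ((dz q z * u z - q z * dz u z) / u z ^+ 2).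
  have Ek w : O w -> kf w - 2 * v w = kg w by move=> /lg[_ ->].
  apply: etrans (cder_dz (cder_near (open_near oO Oz Ek) (cderB hk (cderM (cderC 2 z) hv)))) _.
  by rewrite mul0r add0r.
pose gam (w : E) := dz q w / (2 * q w).
apply: etrans (f_equal2 (fun b c : cx => dz gam z - 3 / 2 * gam z ^+ 2 + 2 * gam z * b - c - b ^+ 2
  / 2)
  (lg z Oz).2 hkg) _.
change (dz gam z - 3 / 2 * (dz q z / (2 * q z)) ^+ 2 + 2 * (dz q z / (2 * q z)) * (kf z - 2 * v z)
  - (dz kf z - 2 * ((dz q z * u z - q z * dz u z) / u z ^+ 2)) - (kf z - 2 * v z) ^+ 2 / 2 =
  dz gam z - 3 / 2 * (dz q z / (2 * q z)) ^+ 2 + 2 * (dz q z / (2 * q z)) * kf z - dz kf z - kf z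
    ^+ 2 / 2).
have := (lg z Oz).1; have un := u0 Oz; have qn := q0 Oz; rewrite /v.
move: (dz gam z) (dz kf z) (kf z) (dz q z) (q z) (u z) un qn (dz u z) => dg dk k dq qq uu un qn du
  h.
have {h} -> : du = uu * k - qq by move: h => /(congr1 (fun x => x * uu));
  rewrite mulfVK // => ->; field.
by field; rewrite un qn.
Qed.

End TwoQuotients.

Section ConformalEntropy.
Variables (U : set E) (F : E -> V3).
Hypotheses (oU : open U) (CF : forall k, C3 k U F).
Hypothesis reg : forall z, U z ->
  0 < dot (cross (partial 0 F z) (partial 1 F z)) (cross (partial 0 F z) (partial 1 F z)).
Hypothesis min : forall z, U z -> \tr (invmx (fff F z) *m sff F z) / 2 = 0.
Hypothesis conf : forall z, U z -> fff F z 0 0 = fff F z 1 1 /\ fff F z 0 1 = 0.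

Let u := phi F 2%:R.
Let f w := phi F 0 w - 'i * phi F 1 w.
Let g w := phi F 0 w + 'i * phi F 1 w.
Let q := hopfF F.
Let gam w := dz q w / (2 * q w).
Let S w := schwarzian (fun w => stereographic (gmap F w)) w.

Let Hu : hol U u := hol_phi oU CF reg min conf 2%:R.
Let Hf : hol U f := hol_phi_minus oU CF reg min conf.
Let Hg : hol U g := hol_phi_plus oU CF reg min conf.
Let Hq : hol U q := hol_hopf oU CF reg min conf.

Let open_nz (h1 h2 : E -> cx) : hol U h1 -> hol U h2 -> open [set z | [/\ U z, h1 z != 0 & h2 z !=
  0]].
Proof.
move=> H1 H2; have -> : [set z | [/\ U z, h1 z != 0 & h2 z != 0]] =
  [set z | U z /\ h1 z != 0] `&` [set z | U z /\ h2 z != 0].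
  by apply/seteqP; split=> z /=; [case|case=> [[]] ? ? []].
by apply: openI; apply: hol_open_neq0.
Qed.

Let via_f z : U z -> f z != 0 -> q z != 0 ->
  schwarzian_finite (@finite_part R \o (fun w => stereographic (gmap F w))) z + gam z ^+ 2 / 2 - dz
    gam z =
  entropy2 gam (fun w => dz f w / f w) z.
Proof.
move=> Uz fz qz; pose O := [set z | [/\ U z, f z != 0 & q z != 0]].
have oO : open O := open_nz Hf Hq.
have OU : O `<=` U by move=> w [].
have Oz : O z by [].
have W w : O w -> dz u w * f w - u w * dz f w = - (q w * f w).
  by move=> /OU; exact: (wronskian_minus oU CF reg min conf).
rewrite (schwarzian_on (g := fun w => u w / f w) oU _ Uz); last first.
  by move=> w Uw; exact: (stereo_minus reg conf Uw).
have f0 w : O w -> f w != 0 by case.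
have q0 w : O w -> q w != 0 by case.
exact: (schwarzian_quotient oO (hol_sub OU Hu) (hol_sub OU Hf) (hol_sub OU Hq) f0 q0 W Oz).
Qed.

Let wronskian_opp (x a b c d e : cx) : x = - a -> a * b - c * d = e -> x * b - - c * d = - e.
Proof. by move=> -> <-; ring. Qed.

Let via_g z : U z -> g z != 0 -> q z != 0 ->
  schwarzian_finite (@finite_part R \o @sphere_inv R \o (fun w => stereographic (gmap F w))) z +
    gam z ^+ 2 / 2 - dz gam z =
  entropy2 gam (fun w => dz g w / g w) z.
Proof.
move=> Uz fz qz; pose O := [set z | [/\ U z, g z != 0 & q z != 0]].
have oO : open O := open_nz Hg Hq.
have OU : O `<=` U by move=> w [].
have Oz : O z by [].
have Hu' : hol O u := hol_sub OU Hu.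
have W w : O w -> dz (fun w => - u w) w * g w - - u w * dz g w = - (q w * g w).
  by move=> Ow; exact: (wronskian_opp (cder_dz (cderN (hol_cder Hu' Ow))) (wronskian_plus oU CF reg
    min conf (OU w Ow))).
rewrite (schwarzian_on (g := fun w => - u w / g w) oU _ Uz); last first.
  by move=> w Uw; exact: (stereo_plus reg conf Uw).
have g0 w : O w -> g w != 0 by case.
have q0 w : O w -> q w != 0 by case.
exact: (schwarzian_quotient oO (holN oO Hu') (hol_sub OU Hg) (hol_sub OU Hq) g0 q0 W Oz).
Qed.

(** Where [f] and [g] are both nonzero so is [u], by the null relation, and the two quotients can be
    compared. *)
Let fg_conj z : U z -> f z != 0 -> g z != 0 -> q z != 0 ->
  entropy2 gam (fun w => dz g w / g w) z = entropy2 gam (fun w => dz f w / f w) z.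
Proof.
move=> Uz fz gz qz; pose O := [set z | [/\ U z, f z != 0 & g z != 0]] `&` [set z | U z /\ q z != 0].
have oO : open O by apply: openI; [exact: open_nz Hf Hg|exact: hol_open_neq0].
have OU : O `<=` U by move=> w [[]].
have Oz : O z by [].
have f0 w : O w -> f w != 0 by case=> -[].
have g0 w : O w -> g w != 0 by case=> -[].
have q0 w : O w -> q w != 0 by case=> _ [].
have u0 w : O w -> u w != 0.
  move=> Ow; apply/eqP => uw; have := phi_minus_plus conf (OU w Ow).
  rewrite -/(f w) -/(g w) -/(u w) uw mul0r oppr0 => /eqP.
  by rewrite mulf_eq0 (negbTE (f0 w Ow)) (negbTE (g0 w Ow)).
have Wf w (Ow : O w) := wronskian_minus oU CF reg min conf (OU w Ow).
have Wg w (Ow : O w) := wronskian_plus oU CF reg min conf (OU w Ow).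
exact: (entropy2_conj oO (hol_sub OU Hu) (hol_sub OU Hf) (hol_sub OU Hq) f0 g0 u0 q0 Wf Wg Oz).
Qed.

(** The denominator is chosen by its value at [p], so that [k] is holomorphic near [p] even if [p]
    is umbilic. At each point [schwarzian] selects a representative by the value of the Gauss map
    there; where this disagrees with the chosen denominator, [fg_conj] bridges the gap. *)
Theorem entropy2_local p : U p -> exists (V : set E) (k : E -> cx),
  [/\ open V /\ V p, V `<=` U, hol V k &
    forall z, V z -> q z != 0 -> S z + gam z ^+ 2 / 2 - dz gam z = entropy2 gam k z].
Proof.
move=> Up; have Sf z : U z -> f z != 0 -> q z != 0 -> S z + gam z ^+ 2 / 2 - dz gam z = entropy2
  gam (fun w => dz f w / f w) z.
  move=> Uz fz qz; apply: etrans _ (via_f Uz fz qz).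
  congr (_ + _ - _); apply: schwarzian_Some => /(stereo_infinity reg conf Uz) f0.
  by rewrite -[_ - _]/(f z) in f0; rewrite f0 eqxx in fz.
have Sg z : U z -> g z != 0 -> q z != 0 -> S z + gam z ^+ 2 / 2 - dz gam z = entropy2 gam (fun w =>
  dz g w / g w) z.
  move=> Uz gz qz; have [f0|f0] := eqVneq (f z) 0;
    last exact: etrans (Sf z Uz f0 qz) (esym (fg_conj Uz f0 gz qz)).
  apply: etrans _ (via_g Uz gz qz).
  by congr (_ + _ - _); apply: schwarzian_None; apply/(stereo_infinity reg conf Uz).
have [f0|f0] := eqVneq (f p) 0.
  exists [set z | U z /\ g z != 0], (fun w => dz g w / g w).
  have oV : open [set z | U z /\ g z != 0] by exact: hol_open_neq0.
  have VU : [set z | U z /\ g z != 0] `<=` U by move=> w [].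
  split => //; first by split => //; split => //; exact: (phi_plus_neq0 reg conf).
    have H := hol_sub VU Hg; apply: (holM oV (hol_dz H) (holV oV _ H)) => w [] //.
  by move=> w [Uw gw]; exact: Sg.
exists [set z | U z /\ f z != 0], (fun w => dz f w / f w).
have oV : open [set z | U z /\ f z != 0] by exact: hol_open_neq0.
have VU : [set z | U z /\ f z != 0] `<=` U by move=> w [].
split => //.
  have H := hol_sub VU Hf; apply: (holM oV (hol_dz H) (holV oV _ H)) => w [] //.
by move=> w [Uw fw]; exact: Sf.
Qed.

End ConformalEntropy.

End ConformalMinimalSurfaces.

(** * Holomorphic charts and umbilic points *)

Section Charts.
Variable R : realType.
Local Notation E := 'rV[R]_2.
Local Notation pd i f := (partial (V := R^o) i f).
Local Notation C k U f := (Cn (V := R^o) k U f).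
Local Notation cx := (R[i]).

Local Notation V3 := 'rV[R]_3.

Lemma Cn_entry n k U (u : E -> 'rV[R]_n) j : open U -> Cn k U u -> C k U (fun w => u w 0 j).
Proof.
move=> oU; elim: k u => [|k IH] u Hu.
  move=> z Uz; apply: (@continuous_comp _ _ R^o u (fun M => M 0 j)); first exact: Hu.
  by apply: differentiable_continuous; exact: differentiable_coord.
have [du Hu'] := Hu.
apply: (@Cn_step R R^o _ _ _ (fun i w => partial i u w 0 j)) => //.
- by move=> z Uz; apply: differentiable_entry; exact: du.
- by move=> i z Uz; rewrite partial_entry //; exact: du.
- by move=> i; exact: (IH _ (Hu' i)).
Qed.

Lemma Cn_row2 k U (s : E -> E) : open U -> (forall j, C k U (fun w => s w 0 j)) -> Cn k U s.
Proof.
move=> oU; elim: k s => [|k IH] s Hs.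
  by move=> z Uz; apply: cont_row2 => j; exact: Hs.
have ds z : U z -> differentiable s z.
  by move=> Uz; apply: differentiable_row => j; case: (Hs j) => + _; apply.
split => // i; apply: IH => j.
apply: (@Cn_ext R R^o _ _ (fun w => pd i (fun w => s w 0 j) w)) => //.
  by move=> z Uz; rewrite partial_entry //; exact: ds.
by case: (Hs j) => _; apply.
Qed.

Definition diffeo (W : set E) (s : E -> E) :=
  (forall k j, C k W (fun w => s w 0 j)) /\ (forall z, W z -> 0 < jac s z).

Lemma diffeo_diff W (s : E -> E) z : diffeo W s -> W z -> differentiable s z.
Proof. by move=> [Cs _] Wz; apply: differentiable_row => j; case: (Cs 1%N j) => + _; apply. Qed.

Lemma diffeo_smooth W (s : E -> E) : open W ->
  diffeo W s <-> (smooth_on W s /\ forall z, W z -> 0 < \det ('J s z)).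
Proof.
move=> oW; split=> [H|[sm J]].
  have [Cs J] := H; split; first by move=> k; exact: (Cn_row2 oW (Cs k)).
  by move=> z Wz; rewrite jacE ?J //; exact: (diffeo_diff H Wz).
split; first by move=> k j; exact: Cn_entry.
by move=> z Wz; rewrite -jacE ?J //; case: (sm 1%N) => + _; apply.
Qed.

Lemma jac_comp (s t : E -> E) z : differentiable t z -> differentiable s (t z) ->
  jac (fun w => s (t w)) z = jac s (t z) * jac t z.
Proof.
move=> dt ds; have P i j := partial_comp i dt (differentiable_entry j ds).
rewrite /jac !P.
move: (pd 0 (fun w => s w 0 0) (t z)) (pd 1 (fun w => s w 0 0) (t z)) (pd 0 (fun w => s w 0 1) (t
  z)) (pd 1 (fun w => s w 0 1) (t z)).
move: (pd 0 (fun w => t w 0 0) z) (pd 1 (fun w => t w 0 0) z) (pd 0 (fun w => t w 0 1) z) (pd 1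
  (fun w => t w 0 1) z).
by move=> *; ring.
Qed.

Lemma diffeo_comp W W' (s t : E -> E) : open W -> open W' -> (forall z, W z -> W' (t z)) ->
  diffeo W t -> diffeo W' s -> diffeo W (fun w => s (t w)).
Proof.
move=> oW oW' tW Dt Ds; split=> [k j|z Wz].
  exact: (C_comp oW oW' tW (Dt.1 k) (Ds.1 k j)).
rewrite jac_comp; [|exact: diffeo_diff Dt Wz|exact: diffeo_diff Ds (tW _ Wz)].
by rewrite mulr_gt0 ?(Dt.2 z) // Ds.2 //; exact: tW.
Qed.

Lemma diffeo_sub W W' (s : E -> E) : W' `<=` W -> diffeo W s -> diffeo W' s.
Proof.
move=> sW [Cs J]; split=> [k j|z /sW]; last exact: J.
exact: Cn_sub (Cs k j).
Qed.

Lemma inverse_partials (W : set E) (s t : E -> E) w : open W -> W w ->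
  (forall w, W w -> s (t w) = w) -> differentiable t w -> differentiable s (t w) ->
  let c i j := pd i (fun w => s w 0 j) (t w) in let d i j := pd i (fun w => t w 0 j) w in
  forall i j, d i 0 * c 0 j + d i 1 * c 1 j = (i == j)%:R.
Proof.
move=> oW Ww st dt ds c d i j.
rewrite -(partial_comp i dt (differentiable_entry j ds)).
rewrite -(partial_coord i j w); apply: near_partial.
by apply: (open_near oW Ww) => x /st ->.
Qed.

(** The Jacobians of inverse maps multiply to 1, so positivity passes to the inverse. *)
Lemma diffeo_inverse (W V : set E) (s t : E -> E) : open W -> (forall w, W w -> V (t w)) ->
  (forall w, W w -> s (t w) = w) -> (forall k j, C k W (fun w => t w 0 j)) -> diffeo V s ->
  diffeo W t.
Proof.
move=> oW tW st Ct Ds; split => // w Ww.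
have dt : differentiable t w by apply: differentiable_row => j; case: (Ct 1%N j) => + _; apply.
have ds := diffeo_diff Ds (tW w Ww).
have E1 : jac s (t w) * jac t w = 1.
  rewrite -jac_comp //.
  have P i j : pd i (fun w => s (t w) 0 j) w = (i == j)%:R.
    by rewrite -(partial_coord i j w); apply: near_partial; apply: (open_near oW Ww) => x /st ->.
  by rewrite /jac !P /= mulr1 mulr0 subr0.
have J := Ds.2 _ (tW w Ww).
by rewrite -(pmulr_rgt0 _ J) E1.
Qed.

(** * Charts of the surface and existence of holomorphic ones *)

Variable M : topologicalType.
Implicit Types (a b c : chart R M) (p : M).

Let ov a b : set E := chart_coord a @` (dom a `&` dom b).

Lemma overlapE a b z : ov a b z <-> img a z /\ dom b (param a z).
Proof.
split=> [[p [ap bp] <-]|[[p ap <-] bp]].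
  by split; [exists p|rewrite coordK].
by exists p => //; split => //; move: bp; rewrite coordK.
Qed.

Lemma open_overlap a b : open (ov a b).
Proof.
have -> : ov a b = img a `&` param a @^-1` dom b.
  by apply/seteqP; split=> z /overlapE.
apply: open_setI_preim; [exact: open_img|exact: param_continuous|exact: open_dom].
Qed.

Lemma coord_img c p : dom c p -> img c (chart_coord c p).
Proof. by exists p. Qed.

Lemma param_dom c z : img c z -> dom c (param c z).
Proof. by move=> [p cp <-]; rewrite coordK. Qed.

Lemma paramK c z : img c z -> chart_coord c (param c z) = z.
Proof. by move=> [p cp <-]; rewrite coordK. Qed.

Lemma param_near c (P : set M) p : dom c p -> (\forall p' \near p, P p') ->
  \forall w \near chart_coord c p, P (param c w).
Proof.
move=> cp Pp; rewrite -(coordK cp) in Pp.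
have pc := param_continuous (coord_img cp).
by apply: pc; exact: Pp.
Qed.

Lemma coord_near c (P : set E) p : dom c p -> (\forall z \near chart_coord c p, P z) ->
  \forall p' \near p, P (chart_coord c p').
Proof. by move=> cp Pp; have pc := Defs.coord_continuous cp; apply: pc; exact: Pp. Qed.

Lemma oriented_transitionE a b : oriented_transition a b <-> diffeo (ov a b) (chart_coord b \o
  param a).
Proof.
exact: iff_sym (diffeo_smooth _ (@open_overlap a b)).
Qed.

Variables (S : oriented_surface R M) (X : M -> V3).
Hypothesis Xmin : minimal_immersion S X.

Lemma chart_smooth c : charts S c -> forall k, C3 k (img c) (local_immersion X c).
Proof. by move=> Sc k; have [sm _] := Xmin Sc; apply: smooth_C3 => //; exact: open_img. Qed.

Lemma chart_regular c : charts S c -> forall z, img c z ->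
  0 < dot (cross (partial 0 (local_immersion X c) z) (partial 1 (local_immersion X c) z))
    (cross (partial 0 (local_immersion X c) z) (partial 1 (local_immersion X c) z)).
Proof. by move=> Sc z cz; have [_ /(_ z cz)[fr _]] := Xmin Sc; exact: row_free_cross fr. Qed.

Lemma chart_minimal c : charts S c -> forall z, img c z ->
  \tr (invmx (fff (local_immersion X c) z) *m sff (local_immersion X c) z) / 2 = 0.
Proof. by move=> Sc z cz; have [_ /(_ z cz)[_ H]] := Xmin Sc. Qed.

Lemma curvature_transition a b p : charts S a -> charts S b -> dom a p -> dom b p ->
  gauss_curvature X a (chart_coord a p) = gauss_curvature X b (chart_coord b p).
Proof.
move=> Sa Sb ap bp; have [/oriented_transitionE[Ct Jt] _] := charts_compatible Sa Sb.
have sWV z : ov a b z -> img b ((chart_coord b \o param a) z).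
  by move=> /overlapE[az bz]; exact: coord_img.
have FaE z : ov a b z -> local_immersion X a z = local_immersion X b ((chart_coord b \o param a) z).
  by move=> /overlapE[az bz]; rewrite /local_immersion /= coordK.
have Wz : ov a b (chart_coord a p) by exists p.
have H := change_curvature (@open_overlap a b) (@open_img _ _ b) sWV FaE Ct Jt (chart_smooth Sb)
  (chart_regular Sb) Wz.
by apply: etrans H _; rewrite /= coordK.
Qed.

Lemma umbilicP c p : charts S c -> dom c p ->
  umbilic S X p <-> gauss_curvature X c (chart_coord c p) = 0.
Proof.
move=> Sc cp; split=> [[b [Sb bp K0]]|K0]; last by exists c.
by rewrite -K0; exact: curvature_transition.
Qed.

Section NewChart.
Variables (c : chart R M) (V W : set E) (s t : E -> E).
Hypotheses (Sc : charts S c) (oV : open V) (oW : open W) (VU : V `<=` img c).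
Hypotheses (st : forall z, V z -> W (s z) /\ t (s z) = z) (ts : forall w, W w -> V (t w) /\ s (t w)
  = w).
Hypotheses (Ds : diffeo V s) (Ct : forall k j, C k W (fun w => t w 0 j)).

Let tV w : W w -> V (t w). Proof. by move=> /ts[]. Qed.
Let stK w : W w -> s (t w) = w. Proof. by move=> /ts[]. Qed.
Let Dt : diffeo W t. Proof. exact: (diffeo_inverse oW tV stK Ct Ds). Qed.

Let D : set M := dom c `&` chart_coord c @^-1` V.

Let oD : open D.
Proof. exact: (open_setI_preim (@open_dom _ _ c) (@Defs.coord_continuous _ _ c) oV). Qed.

Let imgW : (s \o chart_coord c) @` D = W.
Proof.
apply/seteqP; split=> w; first by move=> [p [cp /st[Wp _]] <-].
move=> Ww; have [Vt stw] := ts Ww; have cw := VU Vt.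
exists (param c (t w)); first by split; [exact: param_dom|rewrite /= paramK].
by rewrite /= paramK.
Qed.

Let oI : open ((s \o chart_coord c) @` D). Proof. by rewrite imgW. Qed.

Let cK p : D p -> (param c \o t) ((s \o chart_coord c) p) = p.
Proof. by move=> [cp /st[_ /= ->]]; exact: coordK. Qed.

Let cc p : D p -> {for p, continuous (s \o chart_coord c)}.
Proof.
move=> [cp Vp]; apply: continuous_comp; first exact: Defs.coord_continuous.
exact: differentiable_continuous (diffeo_diff Ds Vp).
Qed.

Let pc w : ((s \o chart_coord c) @` D) w -> {for w, continuous (param c \o t)}.
Proof.
rewrite imgW => Ww; apply: continuous_comp; last exact: (param_continuous (VU (tV Ww))).
exact: differentiable_continuous (diffeo_diff Dt Ww).
Qed.

Let a := Chart oD oI cK cc pc.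

Let imgaE : img a = W. Proof. exact: imgW. Qed.

Let compat b : charts S b -> compatible a b.
Proof.
move=> Sb; have [/oriented_transitionE Dcb /oriented_transitionE Dbc] := charts_compatible Sc Sb.
split; apply/oriented_transitionE.
  have sub w : ov a b w -> W w /\ ov c b (t w).
    move=> /overlapE[]; rewrite imgaE => Ww bw; split => //; apply/overlapE; split => //.
    exact: (VU (tV Ww)).
  apply: (@diffeo_comp (ov a b) (ov c b) (chart_coord b \o param c) t) => //.
  - exact: open_overlap.
  - exact: open_overlap.
  - by move=> w /sub[].
  - by apply: diffeo_sub Dt => w /sub[].
have sub z : ov b a z -> ov b c z /\ V ((chart_coord c \o param b) z).
  by move=> /overlapE[bz [cz Vz]]; split => //; apply/overlapE.
apply: (@diffeo_comp (ov b a) V s (chart_coord c \o param b)) => //.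
- exact: open_overlap.
- by move=> z /sub[].
- by apply: diffeo_sub Dbc => z /sub[].
Qed.

(** The chart [c] is restricted to the points over [V] and followed by [s]; being compatible with
    the whole atlas, the result belongs to it by maximality. *)
Lemma new_chart : exists a : chart R M, [/\ charts S a, dom a = dom c `&` chart_coord c @^-1` V,
  img a = W & param a = param c \o t].
Proof. by exists a; split => //; apply: charts_maximal => b; exact: compat. Qed.

End NewChart.

(** [c00], ..., [c11] are the entries of the inverse Jacobian matrix of the isothermal pair. The two
    conditions on its gradients turn into equal diagonal entries and a vanishing off-diagonal entry
    of the metric in the new coordinates. *)
Let conformal_algebra (a b c d c00 c01 c10 c11 g00 g01 g10 g11 : R) :
  0 < a * d - b * c -> g10 = g01 ->
  g00 * d ^+ 2 - 2 * g01 * c * d + g11 * c ^+ 2 = g00 * b ^+ 2 - 2 * g01 * a * b + g11 * a ^+ 2 ->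
  g00 * b * d - g01 * (a * d + b * c) + g11 * a * c = 0 ->
  c00 * a + c01 * b = 1 -> c00 * c + c01 * d = 0 -> c10 * a + c11 * b = 0 -> c10 * c + c11 * d = 1
    ->
  c00 * c00 * g00 + c00 * c01 * g01 + c01 * c00 * g10 + c01 * c01 * g11 =
  c10 * c10 * g00 + c10 * c11 * g01 + c11 * c10 * g10 + c11 * c11 * g11 /\
  c00 * c10 * g00 + c00 * c11 * g01 + c01 * c10 * g10 + c01 * c11 * g11 = 0.
Proof.
move=> J -> H1 H2 e0 e1 e2 e3; have Jn : a * d - b * c != 0 by rewrite gt_eqF.
have E00 : c00 = d / (a * d - b * c).
  by apply: (mulIf Jn); rewrite mulfVK // -[RHS]mulr1 -e0 -[LHS]addr0 -(mulr0 b) -e1; ring.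
have E01 : c01 = - c / (a * d - b * c).
  by apply: (mulIf Jn); rewrite mulfVK // -[RHS]mulr1 -e0 -[LHS]subr0 -(mulr0 a) -e1; ring.
have E10 : c10 = - b / (a * d - b * c).
  by apply: (mulIf Jn); rewrite mulfVK // -[RHS]mulr1 -e3 -[LHS]subr0 -(mulr0 d) -e2; ring.
have E11 : c11 = a / (a * d - b * c).
  by apply: (mulIf Jn); rewrite mulfVK // -[RHS]mulr1 -e3 -[LHS]addr0 -(mulr0 c) -e2; ring.
rewrite E00 E01 E10 E11; move: (a * d - b * c) Jn => j Jn.
have j2 : j ^+ 2 != 0 by rewrite expf_neq0.
split; apply: (mulIf j2).
  transitivity (g00 * d ^+ 2 - 2 * g01 * c * d + g11 * c ^+ 2); first by field.
  by rewrite H1; field.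
rewrite mul0r -oppr0 -H2; by field.
Qed.

Theorem holomorphic_chart p : exists2 c, holomorphic_coordinate S X c & dom c p.
Proof.
have [c Sc cp] := charts_cover S p; have Uz := coord_img cp.
have oc : open (img c) := @open_img _ _ c.
have CF := chart_smooth Sc; have reg := chart_regular Sc.
have [V [s [[oV Vz] VU Cs iso]]] := isothermal_coordinates oc CF reg (chart_minimal Sc) Uz.
have [V' [W [t [[oV' oW] [V'z V'V] st ts [_ Ct]]]]] :=
  inverse_function oV Vz Cs (lt0r_neq0 (iso _ Vz).1).
have Ds : diffeo V' s.
  by split=> [k j|z /V'V/iso[]//]; apply: Cn_sub (Cs k j).
have V'U : V' `<=` img c by move=> z /V'V/VU.
have [a [Sa dE iE pE]] := new_chart Sc oV' oW V'U st ts Ds Ct.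
exists a; last by rewrite dE.
split => // w; rewrite iE => Ww.
have tV w' : W w' -> V' (t w') by move=> /ts[].
have stK w' : W w' -> s (t w') = w' by move=> /ts[].
have Dt := diffeo_inverse oW tV stK Ct Ds.
have FaE w' : W w' -> local_immersion X a w' = local_immersion X c (t w').
  by move=> _; rewrite /local_immersion pE.
have tU w' : W w' -> img c (t w') by move=> /tV/V'U.
have ch i j := @change_fff R W (img c) (local_immersion X a) (local_immersion X c) t oW tU FaE Dt.1
  CF w i j Ww.
have inv := inverse_partials oW Ww stK (diffeo_diff Dt Ww) (diffeo_diff Ds (tV _ Ww)).
have sym : fff (local_immersion X c) (t w) 1 0 = fff (local_immersion X c) (t w) 0 1.
  exact: (etrans (fffE _ _ 1 0) (etrans (dotC _ _) (esym (fffE _ _ 0 1)))).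
have [J [I1 I2]] := iso _ (V'V _ (tV _ Ww)).
have [A B] := conformal_algebra J sym I1 I2 (inv 0 0) (inv 0 1) (inv 1 0) (inv 1 1).
split; first exact: (etrans (ch 0 0) (etrans A (esym (ch 1 1)))).
exact: (etrans (ch 0 1) B).
Qed.

(** * The Hopf and entropy coefficients in a holomorphic chart *)

Section HolomorphicChart.
Variable c : chart R M.
Hypothesis hc : holomorphic_coordinate S X c.

Let Sc : charts S c. Proof. by case: hc. Qed.
Let F := local_immersion X c.
Let oU : open (img c) := @open_img _ _ c.
Let CF := chart_smooth Sc.
Let reg := chart_regular Sc.
Let min := chart_minimal Sc.
Let conf : forall z, img c z -> fff F z 0 0 = fff F z 1 1 /\ fff F z 0 1 = 0.
Proof. by case: hc => _; apply. Qed.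

Lemma hol_hopf_chart : hol (img c) (hopf X c).
Proof. exact: (hol_hopf oU CF reg min conf). Qed.

Lemma umbilic_hopf p : dom c p -> umbilic S X p <-> hopf X c (chart_coord c p) = 0.
Proof.
move=> cp; have cz := coord_img cp; apply: (iff_trans (umbilicP Sc cp)).
have [x0 _ _] := conf_normal reg conf cz.
have KE : gauss_curvature X c (chart_coord c p) =
  - nsq (hopf X c (chart_coord c p)) / dot (partial 0 F (chart_coord c p)) (partial 0 F
    (chart_coord c p)) ^+ 2.
  exact: (curvature_conf oU CF reg min conf cz).
have := KE; move: (gauss_curvature X c _) (hopf X c _) (dot _ _) x0 => K h x x0 -> {KE}.
have x2 : (x ^+ 2)^-1 != 0 by rewrite invr_eq0 expf_neq0 // gt_eqF.
split=> [/eqP|->]; last by rewrite (eqP (_ : nsq 0 == 0)) ?nsq_eq0 // oppr0 mul0r.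
by rewrite mulf_eq0 (negbTE x2) orbF oppr_eq0 nsq_eq0 => /eqP.
Qed.

Let nz := [set z | img c z /\ hopf X c z != 0].
Let gam w := dz (hopf X c) w / (2 * hopf X c w).

Lemma connection_hopf z : nz z -> connection_coef X c z = gam z.
Proof.
move=> nzz; apply: (connection_conf oU CF reg min conf nzz) => w cw.
exact: (flat_conf oU CF reg min conf cw).
Qed.

Lemma entropy2_chart z : img c z -> exists (V : set E) (k : E -> cx),
  [/\ open V /\ V z, V `<=` img c, hol V k &
    forall w, V w -> hopf X c w != 0 -> entropy X c 2 w = entropy2 gam k w].
Proof.
move=> cz; have [V [k [oV VU Hk H]]] := entropy2_local oU CF reg min conf cz.
exists V, k; split => // w Vw qw; apply: etrans _ (H w Vw qw).
have onz : open nz by exact: hol_open_neq0 oU hol_hopf_chart.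
have nzw : nz w by split => //; exact: VU.
exact: (congr2 (fun x y => schwarzian (stereo_gauss_map X c) w + x ^+ 2 / 2%:R - y)
  (connection_hopf nzw) (dz_on onz connection_hopf nzw)).
Qed.

(** The relation of degree four holds off the umbilic points, that is where the Hopf coefficient is
    nonzero, and this is the set on which [umbilic_coefficient] asks for its identities. *)
Lemma umbilic_equation p (n : nat) (b : cx) : dom c p -> (0 < n)%N ->
  (forall k, (k < n)%N -> iter k (@dz R) (hopf X c) (chart_coord c p) = 0) ->
  iter n (@dz R) (hopf X c) (chart_coord c p) != 0 ->
  on_nonumbilic S X (fun c z => entropy X c 4 z = b * entropy X c 2 z ^+ 2) ->
  12 * (n%:R + 2) ^+ 2 + b * (3 * n%:R ^+ 2 + 4 * n%:R) = 0.
Proof.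
move=> cp n0 q0 qn e4b; have [V [k [[oV Vz] VU Hk e2E]]] := entropy2_chart (coord_img cp).
have Hq := hol_sub VU hol_hopf_chart.
have VN z : [set z | V z /\ hopf X c z != 0] z -> nz z by move=> [/VU].
have P := umbilic_coefficient oV Vz Hq Hk n0 q0 qn (gam := gam) (e2 := entropy X c 2) (e3 :=
  entropy X c 3) (e4 := entropy X c 4).
apply: P => // z Oz.
- by case: Oz => ? ?; exact: e2E.
- exact: (congr1 (fun x => dz (entropy X c 2) z - 2 * x * entropy X c 2 z) (connection_hopf (VN z
  Oz))).
- exact: (congr1 (fun x => dz (entropy X c 3) z - 3 * x * entropy X c 3 z) (connection_hopf (VN z
  Oz))).
- have [Vz' qz] := Oz; have cz := VU z Vz'.
  rewrite -(paramK cz); apply: e4b => //; first exact: param_dom.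
  by rewrite umbilic_hopf ?paramK //; [exact/eqP|exact: param_dom].
Qed.

Lemma flat_iter p k : (\forall p' \near p, umbilic S X p') -> dom c p ->
  iter k (@dz R) (hopf X c) (chart_coord c p) = 0.
Proof.
move=> up cp; have cz := coord_img cp.
pose O := interior [set w | img c w /\ hopf X c w = 0].
have oO : open O := open_interior _.
have Oz : O (chart_coord c p).
  have H1 := param_near cp up.
  have H2 : nbhs (chart_coord c p) (img c) by apply: open_nbhs_nbhs.
  suff H : \forall w \near chart_coord c p, img c w /\ hopf X c w = 0 by exact: H.
  apply: filterS2 H1 H2 => w /= uw cw; split => //.
  by have := (umbilic_hopf (param_dom cw)).1 uw; rewrite paramK.
suff : forall w, O w -> iter k (@dz R) (hopf X c) w = 0 by apply.
elim: k => [w /interior_subset[]//|k IH w Ow].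
by rewrite iterS (dz_on oO IH Ow) (cder_dz (cderC 0 w)).
Qed.

Lemma flat_near p : dom c p ->
  (forall k, iter k (@dz R) (hopf X c) (chart_coord c p) = 0) -> \forall p' \near p, umbilic S X p'.
Proof.
move=> cp H; have := hol_unique_continuation oU (coord_img cp) hol_hopf_chart H.
move=> qz; have H1 := coord_near cp qz.
have H2 : nbhs p (dom c) by apply: open_nbhs_nbhs; split => //; exact: open_dom.
by apply: filterS2 H1 H2 => p' /= q0 cp'; apply/umbilic_hopf.
Qed.

End HolomorphicChart.

(** * Finite order of the umbilic points, by connectedness *)

Hypothesis Xnf : nonflat S X.

Lemma finite_order c p : holomorphic_coordinate S X c -> dom c p ->
  exists k, iter k (@dz R) (hopf X c) (chart_coord c p) != 0.
Proof.
move=> hc cp; apply: contrapT => /forallNP H.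
have {}H k : iter k (@dz R) (hopf X c) (chart_coord c p) = 0.
  by apply: contrapT => /eqP; exact: H.
pose A := interior (umbilic S X).
have Ap : A p := flat_near hc cp H.
(* At a limit point of [A], a nonzero derivative of some order would stay nonzero nearby, hence at a
   point of [A] in the same chart, where all derivatives vanish. *)
have clA : closed A.
  move=> p0 clp0; have [c0 hc0 cp0] := holomorphic_chart p0.
  apply: (flat_near hc0 cp0) => k; apply: contrapT => /eqP nzk.
  have := hol_cder (hol_iter k (hol_hopf_chart hc0)) (coord_img cp0) => -[dk _ _].
  have H1 := coord_near cp0 (cdiff_neq0 dk nzk).
  have H2 : nbhs p0 (dom c0) by apply: open_nbhs_nbhs; split => //; exact: open_dom.
  have [p1 [Ap1 [/= n1 d1]]] := clp0 _ (filterI H1 H2).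
  by move: n1; rewrite (flat_iter hc0 k Ap1 d1) eqxx.
have AT : A = setT.
  apply: (surface_connected S); first by exists p.
    by exists A; [exact: open_interior|rewrite setTI].
  by exists A; rewrite ?setTI.
have [p1 np1] := Xnf; apply: np1; apply: interior_subset.
by rewrite -/A AT.
Qed.

(** [m] is the least order of a nonvanishing derivative; it is positive because the Hopf coefficient
    itself vanishes at an umbilic point. *)
Lemma umbilic_order p : umbilic S X p -> exists m c, [/\ (0 < m)%N, holomorphic_coordinate S X c,
  dom c p &
  (forall k, (k < m)%N -> iter k (@dz R) (hopf X c) (chart_coord c p) = 0) /\
  iter m (@dz R) (hopf X c) (chart_coord c p) != 0].
Proof.
move=> up; have [c hc cp] := holomorphic_chart p.
have ex := finite_order hc cp; exists (ex_minn ex), c.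
case: ex_minnP => m nzm mmin; split => //.
  rewrite lt0n; apply/eqP => m0; move: nzm; rewrite m0 /=.
  by move/umbilic_hopf: up => -> //; rewrite eqxx.
split => // k km; apply: contrapT => /eqP /mmin.
by rewrite leqNgt km.
Qed.

End Charts.

(** * Degree four *)

Section DegreeFour.
Variable R : realType.
Local Notation E := 'rV[R]_2.
Local Notation cx := (R[i]).

Local Notation ex := mpoly.fun_of_multinom.

(* Comparing coefficients of [lambda ^ 4]: the only monomial of weight 4 in
   variables of weights 2 and 3 is the square of the first. *)
Lemma weighted_homogeneous4 (psi : mpoly.mpoly (4 - 2) R[i]) : weighted_homogeneous (n := 4) psi ->
  exists b : cx, forall v : 'I_(4 - 2) -> cx, mpoly.meval v psi = b * v ord0 ^+ 2.
Proof.
move=> [_ H].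
pose wt (m : mpoly.multinom (4 - 2)) := (\sum_(i < 4 - 2) (i + 2) * ex m i)%N.
pose cf := mpoly.mcoeff (R := R[i]) (n := 4 - 2).
exists (\sum_(m <- mpoly.msupp psi | wt m == 4%N) cf m psi) => v.
pose t m := cf m psi * \prod_(i < 4 - 2) v i ^+ ex m i.
(* For fixed [v], the homogeneity relation as a polynomial in [lambda]; it vanishes at every nonzero
   [lambda]. *)
pose P : {poly cx} := \sum_(m <- mpoly.msupp psi) t m *: 'X^(wt m) - mpoly.meval v psi *: 'X^4.
have Pl l : l != 0 -> P.[l] = 0.
  move=> l0; rewrite /P hornerD hornerN hornerZ hornerXn horner_sum mulrC -(H l v l0) mpoly.mevalE.
  apply/eqP; rewrite subr_eq0; apply/eqP; apply: eq_bigr => m _.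
  rewrite hornerZ hornerXn /t -mulrA; congr (_ * _).
  under [in RHS]eq_bigr do rewrite exprMn -exprM.
  by rewrite big_split /= mulrC; congr (_ * _); rewrite prodrXr.
have P0 : P = 0.
  apply: contrapT => /eqP Pn0.
  (* The integers from 1 to [size P] are more distinct roots than a nonzero [P] can have. *)
  pose rs := [seq (i.+1%:R : cx) | i <- iota 0 (size P)].
  have ur : uniq rs by rewrite map_inj_uniq ?iota_uniq // => i j /eqP; rewrite eqr_nat => /eqP [].
  have ar : all (root P) rs.
    by apply/allP => x /mapP[i _ ->]; rewrite rootE Pl // pnatr_eq0.
  by have := max_poly_roots Pn0 ar ur; rewrite size_map size_iota ltnn.
have := congr1 (fun p : {poly cx} => p`_4) P0.
rewrite /P coefB coefZ coefXn eqxx mulr1 coef_sum coef0 => /eqP; rewrite subr_eq0 => /eqP <-.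
rewrite mulr_suml [RHS]big_mkcond; apply: eq_bigr => m _.
rewrite coefZ coefXn eq_sym; case: ifP => [/eqP w4|_]; last by rewrite mulr0.
rewrite mulr1 /t; congr (_ * _); move: w4; rewrite /wt !big_ord_recl !big_ord0 /= addn0 mulr1.
move: (ex m ord0) (ex m (lift ord0 ord0)) => a b.
rewrite /bump /= => E.
have [-> ->] : a = 2%N /\ b = 0%N by lia.
by rewrite expr0 mulr1.
Qed.

(** The alternative in which [P_4] vanishes identically is covered by [b = 0]. *)
Lemma degree4_relation (M : topologicalType) (S : oriented_surface R M) (X : M -> 'rV[R]_3) :
  satisfies_degree S X 4 ->
  exists b : cx, on_nonumbilic S X (fun c z => entropy X c 4 z = b * entropy X c 2 z ^+ 2).
Proof.
case=> [H|[psi /weighted_homogeneous4[b bE] H]].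
  by exists 0 => c hc p cp np; rewrite mul0r; exact: H.
by exists b => c hc p cp np; rewrite (H c hc p cp np) bE.
Qed.

(** Eliminating [b] leaves an equation in natural numbers whose sides differ by a multiple of
    [(m - n) (8 n m + 12 (n + m) + 16)], and the second factor is positive. *)
Lemma weight_inj (n m : nat) (b : cx) : (0 < n)%N -> (0 < m)%N ->
  12 * (n%:R + 2) ^+ 2 + b * (3 * n%:R ^+ 2 + 4 * n%:R) = 0 ->
  12 * (m%:R + 2) ^+ 2 + b * (3 * m%:R ^+ 2 + 4 * m%:R) = 0 -> n = m.
Proof.
move=> n0 m0 En Em.
have E : ((12 * (n + 2) ^ 2 * (3 * m ^ 2 + 4 * m))%:R : cx) = (12 * (m + 2) ^ 2 * (3 * n ^ 2 + 4 *
  n))%:R.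
  rewrite !(natrM, natrD, natrX); apply/eqP; rewrite -subr_eq0; apply/eqP.
  move: En Em; move: (n%:R : cx) (m%:R : cx) => x y En Em.
  transitivity ((12 * (x + 2) ^+ 2 + b * (3 * x ^+ 2 + 4 * x)) * (3 * y ^+ 2 + 4 * y) -
    (12 * (y + 2) ^+ 2 + b * (3 * y ^+ 2 + 4 * y)) * (3 * x ^+ 2 + 4 * x)); first by ring.
  by rewrite En Em !mul0r subrr.
by move/eqP: E; rewrite eqr_nat => /eqP E; nia.
Qed.

End DegreeFour.

Theorem proposition4p7 (R : realType) (M : topologicalType)
    (S : oriented_surface R M) (X : M -> 'rV[R]_3) (n : nat) :
  minimal_immersion S X ->
  has_degree S X 4 ->
  (1 <= n)%N ->
  (exists2 p, umbilic S X p & hopf_vanishes_to_order S X p n) ->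
  (forall p, umbilic S X p -> hopf_vanishes_to_order S X p n) /\
  on_nonumbilic S X (fun c z =>
    entropy X c 4 z +
    12%:R * (n%:R + 2%:R) ^+ 2 / (3%:R * n%:R ^+ 2 + 4%:R * n%:R) *
    entropy X c 2 z ^+ 2 = 0).
Proof.
move=> Xmin [Xnf _ /degree4_relation[b e4b] _] n1 [p0 _ [c0 [hc0 cp0 q0 /eqP qn]]].
have En := umbilic_equation Xmin hc0 cp0 n1 q0 qn e4b.
split=> [p /(umbilic_order Xmin Xnf)[m [c [m0 hc cp [qm0 qm]]]]|c hc p cp np].
  have Em := umbilic_equation Xmin hc cp m0 qm0 qm e4b.
  by rewrite (weight_inj n1 m0 En Em); exists c; split => //; exact/eqP.
rewrite (e4b c hc p cp np); move: (entropy X c 2 _) => e.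
have D : 3 * n%:R ^+ 2 + 4 * n%:R != 0 :> R[i].
  by rewrite -natrX -!natrM -natrD pnatr_eq0; lia.
(* The square of the entropy coefficient factors out, and it remains to solve [En] for [b]. *)
rewrite -mulrDl; apply/eqP; rewrite mulf_eq0; apply/orP; left; apply/eqP.
apply: (mulIf D); rewrite mul0r mulrDl mulfVK // addrC; exact: En.
Qed.
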